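(* Let $K$ be a finitely generated field of characteristic $p$ of positive transcendence degree over $\mathbb{F}_p$. Let $\phi:A\to K\{\tau\}$ be a Drinfeld module with a non-constant $t\in A$ such that $\phi_t=\sum_{i=0}^r a_i\tau^i$ is monic. Let $F$ be the algebraic closure of $\mathbb{F}_p$ in $K$, $\{x_1,\dots,x_n\}$ a transcendence basis of $K/F$, $M_{K/F}$ the associated coherent good set of valuations and $\hat h$ the global height associated to $\phi$ with respect to $M_{K/F}$. For $x\in K^{\mathrm{alg}}$ let $F_x$ be the algebraic closure of $\mathbb{F}_p$ in $K(x)$ and $S_x$ the set of valuations of $K(x)$ lying over $M_{K/F}$ at which $\phi$ has bad reduction. If $x$ is not a torsion point of $\phi$, then $$\hat h(x)>\frac{q^{-r(2+(r^2+r)|S_x|)}}{[K(x):F(x_1,\dots,x_n)]}.$$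
   Context: Setting: $p$ prime, $q$ a power of $p$, $A$ the ring of functions on a nonsingular projective curve over $\mathbb{F}_q$ regular away from a fixed closed point. $K\{\tau\}$ twisted polynomials with $\tau(x)=x^q$; a Drinfeld module $\phi:A\to K\{\tau\}$ is a ring morphism with $\tau^0$-coefficient of $\phi_a$ equal to $i(a)$ for a fixed morphism $i:A\to K$, not all $\phi_a$ constant. $\deg(\phi_a)$ is the degree as polynomial in $x$. Torsion: $\phi_a(x)=0$ for some nonzero $a$. Good reduction at $v$: all coefficients of all $\phi_a$ ($a\ne0$) $v$-integral with leading coefficient a $v$-unit; else bad. Valuations normalized with value group $\mathbb{Z}$. $M_{K/F}$: on $F(x_1,\dots,x_n)$ take $v_P$ (order at irreducible $P\in F[x_1,\dots,x_n]$, degree $\deg P$) and $v_\infty(Q_1/Q_2)=\deg Q_2-\deg Q_1$ (degree 1); $M_{K/F}$ is the set of all extensions $w$ to $K$ with $d(w)=f(w|v)d(v)/[K:F(x_1,\dots,x_n)]$. On a finite extension $L$ of $K$, valuations $w$ over $v\in M_{K/F}$ have $d(w)=f(w|v)d(v)/[L:K]$. Local height: $\hat h_w(y)=-d(w)\lim_n\min\{0,w(\phi_{a^n}(y))\}/\deg(\phi_{a^n})$ ($a\in A$ non-constant); global height $\hat h(y)=\sum_w\hat h_w(y)$ over all such $w$ on any finite $L\ni y$ (independent of $L$). *)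

(* Defs.v *)
From mathcomp Require Import all_boot all_order all_algebra all_field.
From mathcomp Require Import finmap.
From mathcomp Require Import all_classical all_reals all_analysis.
From mathcomp Require mpoly.
(* The notations of mpoly clash with those of the analysis library, so
   {mpoly F[n]} is written [mpoly n F]. *)
Import -(notations) mpoly.

Set Implicit Arguments.
Unset Strict Implicit.
Unset Printing Implicit Defensive.

Import Order.TTheory GRing.Theory Num.Theory.
Import numFieldNormedType.Exports.

Local Open Scope classical_set_scope.
Local Open Scope ring_scope.

(* Degree [L : E] of a field embedding j : E -> L; 0 when it is infinite. *)
Definition field_degree (E L : fieldType) (j : E -> L) : nat :=
  xget 0%N [set d | exists b : 'I_d -> L,
    forall y, exists! c : {ffun 'I_d -> E}, y = \sum_(k < d) j (c k) * b k].

(* A chosen way of writing z as numer z / denom z. *)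
Definition numer (D : idomainType) (z : {fraction D}) : D := (frac (repr z)).1.
Definition denom (D : idomainType) (z : {fraction D}) : D := (frac (repr z)).2.

Definition prime_field_map (p : nat) (K : fieldType) (c : 'F_p) : K :=
  (nat_of_ord c)%:R.

(* The map F(X_1, ..., X_n) -> K, Q1 / Q2 |-> Q1(g) / Q2(g); it is a field
   embedding when g is algebraically independent over F. *)
Definition ratfun_eval (n : nat) (F K : fieldType) (k : F -> K) (g : 'I_n -> K)
    (z : {fraction (mpoly n F)}) : K :=
  mmap k g (numer z) / mmap k g (denom z).

Definition finitely_generated_field (F K : fieldType) (k : F -> K) : Prop :=
  exists n (g : 'I_n -> K), forall y, exists Q1 Q2 : mpoly n F,
    mmap k g Q2 != 0 /\ y = mmap k g Q1 / mmap k g Q2.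

Definition transcendence_basis (n : nat) (F K : fieldType) (k : F -> K)
    (g : 'I_n -> K) : Prop :=
  (forall Q : mpoly n F, Q != 0 -> mmap k g Q != 0) /\
  (forall y, algebraicOver (ratfun_eval k g) y).

Record normalized_valuation (L : fieldType) (v : L -> \bar int) : Prop := {
  nval0 : v 0 = +oo%E ;
  nval_fin : forall x, x != 0 -> v x \is a fin_num ;
  nvalM : forall x y, v (x * y) = (v x + v y)%E ;
  nvalD : forall x y, (Order.min (v x) (v y) <= v (x + y)%R)%E ;
  nval_norm : exists x, v x = 1%E
}.

(* w extends v along j : E -> L up to the ramification index e, both
   valuations being normalized. *)
Definition lies_over (E L : fieldType) (j : E -> L)
    (v : E -> \bar int) (w : L -> \bar int) : Prop :=
  exists2 e : nat, (0 < e)%N & forall z, w (j z) = ((e%:Z)%:E * v z)%E.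

(* f(w|v): the residue classes of b_0, ..., b_(d-1) form a basis of
   O_w / m_w over O_v / m_v. *)
Definition residue_basis (E L : fieldType) (j : E -> L)
    (v : E -> \bar int) (w : L -> \bar int) (d : nat) (b : 'I_d -> L) : Prop :=
  [/\ forall k, (0 <= w (b k))%E,
      forall y, (0 <= w y)%E ->
        exists2 c : 'I_d -> E, (forall k, 0 <= v (c k))%E &
          (0 < w (y - \sum_(k < d) j (c k) * b k)%R)%E
    & forall c : 'I_d -> E, (forall k, 0 <= v (c k))%E ->
        (0 < w (\sum_(k < d) j (c k) * b k)%R)%E -> forall k, (0 < v (c k))%E].

Definition residue_degree (E L : fieldType) (j : E -> L)
    (v : E -> \bar int) (w : L -> \bar int) : nat :=
  xget 0%N [set d | exists b : 'I_d -> L, residue_basis j v w b].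

(* A set of valuations v with their degrees d(v) is a set of pairs
   (v, d(v)). *)
Definition weighted_valuation (R : realType) (L : fieldType) : Type :=
  ((L -> \bar int) * R)%type.

(* All the extensions w to L of the valuations v of M, with
   d(w) = f(w|v) d(v) / [L : E]. *)
Definition extend_valuations (R : realType) (E L : fieldType) (j : E -> L)
    (M : set (weighted_valuation R E)) : set (weighted_valuation R L) :=
  [set wd | normalized_valuation wd.1 /\
     exists2 vd, M vd & lies_over j vd.1 wd.1 /\
       wd.2 = (residue_degree j vd.1 wd.1)%:R * vd.2 / (field_degree j)%:R].

Section RationalFunctions.
Variables (n : nat) (F : fieldType).
Implicit Types (P Q : mpoly n F) (z : {fraction (mpoly n F)}).

Definition mpoly_irreducible P : Prop :=
  [/\ P != 0, P \isn't a GRing.unit &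
      forall Q1 Q2, P = Q1 * Q2 ->
        Q1 \is a GRing.unit \/ Q2 \is a GRing.unit].

(* Total degree (msize is one more than the total degree). *)
Definition mdegree Q : nat := (msize Q).-1.

Definition mpoly_dvd P Q : Prop := exists S, Q = S * P.

(* Only used for Q != 0. *)
Definition mpoly_order P Q : nat :=
  xget 0%N [set k | mpoly_dvd (P ^+ k) Q /\ ~ mpoly_dvd (P ^+ k.+1) Q].

Definition order_valuation P z : \bar int :=
  if z == 0 then +oo%E
  else ((mpoly_order P (numer z))%:Z - (mpoly_order P (denom z))%:Z)%:E.

Definition infinity_valuation z : \bar int :=
  if z == 0 then +oo%E
  else ((mdegree (denom z))%:Z - (mdegree (numer z))%:Z)%:E.

Definition ratfun_valuations (R : realType) :
    set (weighted_valuation R {fraction (mpoly n F)}) :=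
  [set vd | (exists2 P, mpoly_irreducible P &
               vd = (order_valuation P, (mdegree P)%:R))
            \/ vd = (infinity_valuation, 1)].

End RationalFunctions.

(* M_{K/F}, for a field F embedded in K by jF and a transcendence basis X. *)
Definition good_valuations (R : realType) (n : nat) (F K : fieldType)
    (jF : F -> K) (X : 'I_n -> K) : set (weighted_valuation R K) :=
  extend_valuations (ratfun_eval jF X) (@ratfun_valuations n F R).

Arguments good_valuations R [n F K] jF X _.

(* Nonsingular projective curves over Fq correspond to the finitely generated
   extensions C of Fq of transcendence degree 1 (their function fields), and
   the closed points to the normalized valuations of C; these are
   automatically trivial on the finite field Fq. *)
Definition curve_function_field (Fq C : fieldType) (k : Fq -> C) : Prop :=
  finitely_generated_field k /\
  exists g : 'I_1 -> C, transcendence_basis k g.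

Definition regular_away (C : fieldType) (vinf : C -> \bar int) : set C :=
  [set f | forall v, normalized_valuation v -> v <> vinf -> (0 <= v f)%E].

Definition nonconstant (Fq C : fieldType) (k : Fq -> C) (f : C) : Prop :=
  ~ algebraicOver k f.

(* K{tau} is {poly K} as an additive group, 'X^i standing for tau^i, with
   the product determined by tau * c = c ^+ q * tau. *)
Definition twisted_mul (K : fieldType) (q : nat) (f g : {poly K}) : {poly K} :=
  \sum_(i < size f) \sum_(j < size g)
    (f`_i * g`_j ^+ (q ^ i)) *: 'X^(i + j).

Definition twisted_eval (K : fieldType) (L : fieldExtType K) (q : nat)
    (f : {poly K}) (y : L) : L :=
  \sum_(i < size f) f`_i *: y ^+ (q ^ i).

(* Degree in x of the polynomial \sum_i f_i x^(q^i), for f != 0. *)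
Definition twisted_degree (K : fieldType) (q : nat) (f : {poly K}) : nat :=
  (q ^ (size f).-1)%N.

Record drinfeld_module (q : nat) (A : comNzRingType) (K : fieldType)
    (i : A -> K) (phi : A -> {poly K}) : Prop := {
  drinfeld1 : phi 1 = 1 ;
  drinfeldD : forall a b, phi (a + b) = phi a + phi b ;
  drinfeldM : forall a b, phi (a * b) = twisted_mul q (phi a) (phi b) ;
  drinfeld_const : forall a, (phi a)`_0 = i a ;
  drinfeld_nontrivial : exists a, (1 < size (phi a))%N
}.

Section Heights.
Variables (R : realType) (q : nat) (A : comNzRingType) (K : fieldType).
Variables (phi : A -> {poly K}) (L : fieldExtType K).

Definition torsion_point (y : L) : Prop :=
  exists2 a, a != 0 & twisted_eval q (phi a) y = 0.

Definition good_reduction (w : L -> \bar int) : Prop :=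
  forall a, a != 0 ->
    (forall k, 0 <= w (in_alg L (phi a)`_k))%E /\
    w (in_alg L (lead_coef (phi a))) = 0%E.

Definition bad_places (M : set (weighted_valuation R L)) :
    set (L -> \bar int) :=
  [set w | (exists d, M (w, d)) /\ ~ good_reduction w].

Definition local_height (a : A) (wd : weighted_valuation R L) (y : L) : R :=
  - wd.2 * limn (fun m : nat =>
    (fine (Order.min 0%E (wd.1 (twisted_eval q (phi (a ^+ m)) y))))%:~R
      / (twisted_degree q (phi (a ^+ m)))%:R : R).

(* The sum of the local heights over M, as a sum of nonnegative terms in the
   extended reals. *)
Definition global_height (a : A) (M : set (weighted_valuation R L)) (y : L) :
    \bar R :=
  (\esum_(wd in M) (local_height a wd y)%:E)%E.

End Heights.

(* Main.v *)
(* Suppose that every local height of [x], without its degree factor, is at most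
   [q ^ - r (2 + N)], with [N = (r ^ 2 + r) |S_x|]. The [N + 1]-dimensional
   [F_q]-space of the [phi_P(x)], [P] a polynomial in [t] of degree at most [N],
   then consists of elements of height less than 1 everywhere, and stays of height
   at most 1 under [phi_(t^2)]. A point that escapes to infinity at [w] has local
   height [- w]; so at a good place all these elements are integral. At a bad place
   some coefficient of [phi_(t^2)] is so negative that, by Lagrange interpolation,
   [phi_(t^2)] cannot remain small on an [F_q]-space of dimension more than [2 r]
   without points of positive valuation: the points of positive valuation have
   codimension at most [2 r <= r ^ 2 + r]. Hence some [P <> 0] makes [phi_P(x)]
   integral everywhere and of positive valuation at the bad places. If there are
   bad places this element, being constant, is zero. If there are none, it and the
   coefficients of [phi_t] lie in a finite field, so its orbit under [phi_t] is
   finite. Either way [x] is a torsion point. *)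
From HB Require Import structures.
Require Import Defs.
From mathcomp Require Import all_boot all_order all_algebra all_field.
From mathcomp Require Import finmap.
From mathcomp Require Import all_classical all_reals all_analysis.
From mathcomp Require Import zify ring lra.
From mathcomp Require polyXY.
From mathcomp Require mpoly.
Import -(notations) mpoly.
Set Implicit Arguments.
Unset Strict Implicit.
Unset Printing Implicit Defensive.
Import Order.TTheory GRing.Theory Num.Theory.
Import numFieldNormedType.Exports.
Local Open Scope classical_set_scope.
Local Open Scope ring_scope.

(** * Valuations *)

(** The escape criterion explains [phi_(t ^ 2)]. With [c] the largest pole order of a coefficient of
    [phi_t], a point is known to escape only strictly below [- c]. Interpolating [phi_t] would just
    force a value at most [- c], whereas [phi_(t ^ 2)] has a coefficient of valuation exactly
    [- c q ^ r]: this lies below [- c], and the resulting height, at least [c q ^ r >= 2],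
    contradicts a height at most 1. The exponent pays for this: [phi_P] multiplies heights by at
    most [q ^ (r N)], [phi_(t ^ 2)] by a further [q ^ (2 r)]. Heights are computed with [a] but
    orbits are followed under [t]; this is consistent because [A] is commutative, so that every
    [phi_b] scales the height by its degree. What is used of the valuations is collected in
    [good_system]. It holds on [F(X_1, ..., X_n)] by unique factorization and passes to finite
    extensions; the substantial point there is that a non-integral element is negative at some
    extension of the valuation. Each degree [d(w)] is at least [1 / [K(x) : F(X_1, ..., X_n)]], so
    one large local height gives the bound. *)

Record valuation (L : fieldType) (v : L -> \bar int) : Prop := {
  val0 : v 0 = +oo%E ;
  val_fin : forall x, x != 0 -> v x \is a fin_num ;
  valM : forall x y, v (x * y) = (v x + v y)%E ;
  valD : forall x y, (Order.min (v x) (v y) <= v (x + y)%R)%E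
}.

Lemma normalized_valuationW (L : fieldType) (v : L -> \bar int) :
  normalized_valuation v -> valuation v.
Proof. by case. Qed.

Lemma ltEe_succ (k : int) (z : \bar int) : (k%:E < z)%E = ((k + 1)%:E <= z)%E.
Proof.
case: z => [z||]; first by rewrite lte_fin lee_fin lezD1.
  by rewrite ltry leey.
by rewrite ltNge leNye /= leeNy_eq.
Qed.

Lemma mulrnZ (k : int) n : k *+ n = k * n%:Z.
Proof. by rewrite -mulr_natr natz. Qed.

Section Valuation.
Variables (L : fieldType) (v : L -> \bar int).
Hypothesis hv : valuation v.
Implicit Types (x y z : L) (k l : int).

Lemma val_ge_add (b : \bar int) x y :
  (b <= v x -> b <= v y -> b <= v (x + y)%R)%E.
Proof. by move=> hx hy; apply: le_trans (valD hv x y); rewrite le_min hx hy. Qed.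

Lemma val_gt_add (b : \bar int) x y :
  (b < v x -> b < v y -> b < v (x + y)%R)%E.
Proof. by move=> hx hy; apply: lt_le_trans (valD hv x y); rewrite lt_min hx hy. Qed.

Lemma val_eqy x : (v x == +oo%E) = (x == 0).
Proof.
apply/eqP/eqP => [h|->]; last exact: val0.
by apply: contraTeq isT => /(val_fin hv); rewrite h.
Qed.

Lemma valE x : x != 0 -> v x = (fine (v x))%:E.
Proof. by move=> /(val_fin hv) h; rewrite fineK. Qed.

Lemma valP x : x != 0 -> exists k, v x = k%:E.
Proof. by move=> h; exists (fine (v x)); apply: valE. Qed.

Lemma val_neq0 x k : v x = k%:E -> x != 0.
Proof. by move=> h; rewrite -val_eqy h. Qed.

Lemma val1 : v 1 = 0%E.
Proof.
have := valM hv 1 1; rewrite mulr1; have [k ->] := valP (oner_neq0 L).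
by rewrite -EFinD => -[] /eqP; rewrite -subr_eq0 opprD addNKr oppr_eq0 => /eqP ->.
Qed.

Lemma val_eq_mul x y k l : v x = k%:E -> v y = l%:E -> v (x * y) = (k + l)%:E.
Proof. by rewrite (valM hv) => -> ->. Qed.

Lemma val_eq_exp x k n : v x = k%:E -> v (x ^+ n) = (k *+ n)%:E.
Proof.
move=> h; elim: n => [|n IH]; first by rewrite val1.
by rewrite exprS mulrS; apply: val_eq_mul.
Qed.

Lemma val_ge_mul x y k l :
  (k%:E <= v x -> l%:E <= v y -> (k + l)%:E <= v (x * y)%R)%E.
Proof. by move=> hx hy; rewrite (valM hv) EFinD leeD. Qed.

Lemma val_ge_exp x k n : (k%:E <= v x -> (k *+ n)%:E <= v (x ^+ n)%R)%E.
Proof.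
move=> h; elim: n => [|n IH]; first by rewrite val1.
by rewrite exprS mulrS; apply: val_ge_mul.
Qed.

Lemma valN1 : v (- 1) = 0%E.
Proof.
have h : (-1 : L) != 0 by rewrite oppr_eq0 oner_eq0.
have [k hk] := valP h; have := val_eq_mul hk hk; rewrite mulrNN mulr1 val1 hk.
move=> -[] /esym/eqP; rewrite -mulr2n mulrn_eq0 /= => /eqP ->; exact: erefl.
Qed.

Lemma valN x : v (- x) = v x.
Proof. by rewrite -mulN1r (valM hv) valN1 add0e. Qed.

Lemma valB (b : \bar int) x y :
  (b <= v x -> b <= v y -> b <= v (x - y)%R)%E.
Proof. by move=> hx hy; apply: val_ge_add; rewrite ?valN. Qed.

Lemma val_eq_inv x k : v x = k%:E -> v x^-1 = (- k)%:E.
Proof.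
move=> h; have x0 := val_neq0 h; have [l hl] := valP (invr_neq0 x0).
have := val_eq_mul h hl; rewrite mulfV // val1 hl => -[] /esym/eqP.
by rewrite addrC addr_eq0 => /eqP ->.
Qed.

Lemma val_ge_sum (I : Type) (s : seq I) (P : pred I) (f : I -> L) (b : \bar int) :
  (forall i, P i -> (b <= v (f i))%E) -> (b <= v (\sum_(i <- s | P i) f i)%R)%E.
Proof.
move=> h; apply: (big_ind (fun z => (b <= v z)%E)) => //.
- by rewrite (val0 hv) leey.
- exact: val_ge_add.
Qed.

Lemma val_gt_sum (I : Type) (s : seq I) (P : pred I) (f : I -> L) (b : \bar int) :
  (b < +oo)%E -> (forall i, P i -> (b < v (f i))%E) ->
  (b < v (\sum_(i <- s | P i) f i)%R)%E.
Proof.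
move=> hb h; apply: (big_ind (fun z => (b < v z)%E)) => //.
- by rewrite (val0 hv).
- exact: val_gt_add.
Qed.

Lemma val_lt_add x y : (v x < v y)%E -> v (x + y) = v x.
Proof.
move=> h; apply/eqP; rewrite eq_le andbC; apply/andP; split.
  by apply: val_ge_add => //; apply: ltW.
rewrite leNgt; apply/negP => h2.
have : (v x < v (x + y - y)%R)%E by apply: val_gt_add; rewrite ?valN.
by rewrite addrK ltxx.
Qed.

Lemma val_lt_sum n (f : 'I_n -> L) (i0 : 'I_n) :
  f i0 != 0 -> (forall i, i != i0 -> (v (f i0) < v (f i))%E) ->
  v (\sum_i f i) = v (f i0).
Proof.
move=> f0 h; rewrite (bigD1 i0) //=; apply: val_lt_add.
by apply: val_gt_sum => //; rewrite ltey val_eqy.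
Qed.

(* In particular elements algebraic over the prime field have valuation 0. *)
Lemma val_exp_fixed x n : (1 < n)%N -> x != 0 -> x ^+ n = x -> v x = 0%E.
Proof.
move=> n1 /valP[k hk] h; have := val_eq_exp n hk; rewrite h hk => -[] /eqP.
case: n n1 {h} => [|[|n]] // _; rewrite mulrS -subr_eq0 opprD addNKr oppr_eq0.
by rewrite mulrn_eq0 => /eqP ->.
Qed.

End Valuation.

Lemma sum_ord_widen (V : nmodType) (m n : nat) (F : nat -> V) :
  (forall i, (m <= i)%N -> F i = 0) -> (m <= n)%N ->
  \sum_(i < m) F i = \sum_(i < n) F i.
Proof.
move=> h mn; rewrite (big_ord_widen_cond n predT F mn) /= [LHS]big_mkcond /=.
by apply: eq_bigr => i _; case: ltnP => // /h.
Qed.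

(** * Twisted polynomials *)

Section Frobenius.
Variables (p q e : nat) (R : comNzRingType).
Hypotheses (hp : p \in [pchar R]) (hq : q = (p ^ e)%N).

Lemma pnat_q m : [pchar R].-nat (q ^ m)%N.
Proof.
have hp' := pcharf_prime hp; rewrite hq -expnM.
by rewrite (eq_pnat _ (pcharf_eq hp)) pnatX pnat_id.
Qed.

Lemma frobD m (x y : R) : (x + y) ^+ (q ^ m) = x ^+ (q ^ m) + y ^+ (q ^ m).
Proof. exact/exprDn_pchar/pnat_q. Qed.

Lemma frob0 m : (0 : R) ^+ (q ^ m) = 0.
Proof. by rewrite expr0n expn_eq0 hq expn_eq0; case: (p) (pcharf_prime hp). Qed.

Lemma frobN m (x : R) : (- x) ^+ (q ^ m) = - x ^+ (q ^ m).
Proof. by apply/eqP; rewrite -addr_eq0 -frobD addNr frob0. Qed.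

Lemma frob_sum m (I : Type) (s : seq I) (P : pred I) (f : I -> R) :
  (\sum_(i <- s | P i) f i) ^+ (q ^ m) = \sum_(i <- s | P i) f i ^+ (q ^ m).
Proof. exact: (big_morph (fun x => x ^+ (q ^ m)) (frobD m) (frob0 m)). Qed.

End Frobenius.

Section Twisted.
Variables (p q e : nat) (K : fieldType).
Hypotheses (hp : p \in [pchar K]) (hq : q = (p ^ e)%N) (he : (0 < e)%N).
Implicit Types (f g : {poly K}).

Lemma q_gt1 : (1 < q)%N.
Proof. by rewrite hq -(exp1n e) ltn_exp2r // prime_gt1 // (pcharf_prime hp). Qed.

Lemma qX_gt0 m : (0 < q ^ m)%N.
Proof. by rewrite expn_gt0 (ltnW q_gt1). Qed.

Lemma coef_twisted_mul f g n :
  (twisted_mul q f g)`_n = \sum_(i < n.+1) f`_i * g`_(n - i) ^+ (q ^ i).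
Proof.
pose F i := if (i <= n)%N then f`_i * g`_(n - i) ^+ (q ^ i) else 0.
transitivity (\sum_(i < size f) F i).
  rewrite coef_sum; apply: eq_bigr => i _; rewrite coef_sum /F.
  under eq_bigr => j _ do rewrite coefZ coefXn.
  case: leqP => hin; last first.
    rewrite big1 // => j _; case: eqP => [h|_]; last by rewrite mulr0.
    by move: hin; rewrite h -ltn_subRL subnn.
  case: (ltnP (n - i) (size g)) => hg; last first.
    rewrite (nth_default _ hg) (frob0 hp hq) mulr0 big1 // => j _.
    case: eqP => [h|_]; last by rewrite mulr0.
    by move: hg; rewrite h addKn leqNgt ltn_ord.
  rewrite (bigD1 (Ordinal hg)) //= subnKC // eqxx mulr1 big1 ?addr0 // => j hj.
  case: eqP => [h|_]; last by rewrite mulr0.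
  by move: hj; rewrite -val_eqE /= h addKn eqxx.
rewrite (@sum_ord_widen _ _ (maxn (size f) n.+1)) ?leq_maxl //; last first.
  by move=> i hi; rewrite /F nth_default // mul0r if_same.
rewrite -(@sum_ord_widen _ n.+1) ?leq_maxr //; last first.
  by move=> i hi; rewrite /F leqNgt hi.
by apply: eq_bigr => i _; rewrite /F -ltnS ltn_ord.
Qed.

Lemma twisted_mul0 g : twisted_mul q 0 g = 0.
Proof. by rewrite /twisted_mul size_poly0 big_ord0. Qed.

(** Only the product of the two leading terms reaches the coefficient at the sum [s] of the degrees,
    so [K{tau}] has no zero divisors. The twist falls on the right factor alone. *)
Lemma twisted_mul_lead f g : f != 0 -> g != 0 ->
  size (twisted_mul q f g) = (size f + size g).-1 /\
  lead_coef (twisted_mul q f g) = lead_coef f * lead_coef g ^+ (q ^ (size f).-1).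
Proof.
move=> f0 g0; have sf : (0 < size f)%N by rewrite size_poly_gt0.
have sg : (0 < size g)%N by rewrite size_poly_gt0.
set s := ((size f).-1 + (size g).-1)%N.
have hs : (size f + size g).-1 = s.+1 by rewrite /s -subn1 -!subn1; lia.
have lc : (twisted_mul q f g)`_s = lead_coef f * lead_coef g ^+ (q ^ (size f).-1).
  rewrite coef_twisted_mul.
  have hi : ((size f).-1 < s.+1)%N by rewrite /s; lia.
  rewrite (bigD1 (Ordinal hi)) //= {2}/s addKn big1 ?addr0 // => i hj.
  have [h|h] := leqP (size f) i; first by rewrite nth_default ?mul0r.
  rewrite [g`__]nth_default ?(frob0 hp hq) ?mulr0 //.
  have {hj h} h2 : (i < (size f).-1)%N by rewrite ltn_neqAle -ltnS prednK // h andbT.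
  by rewrite /s -[in leqLHS](prednK sg) -addnBAC ?(ltnW h2) // -addn1 addnC leq_add2r subn_gt0.
have lc0 : (twisted_mul q f g)`_s != 0.
  by rewrite lc mulf_neq0 ?expf_neq0 // lead_coef_eq0.
have sz : size (twisted_mul q f g) = s.+1.
  apply/eqP; rewrite eqn_leq; apply/andP; split; last first.
    by rewrite ltnNge; apply: contra lc0 => h; rewrite nth_default.
  apply/leq_sizeP => j hj; rewrite coef_twisted_mul big1 // => i _.
  have [h|h] := leqP (size f) i; first by rewrite nth_default ?mul0r.
  rewrite [g`__]nth_default ?(frob0 hp hq) ?mulr0 //; move: hj h sf sg; rewrite /s.
  by case: (size f) (size g) => [|u] [|w] //=; move: (nat_of_ord i) => k; clear; lia.
by rewrite hs sz lead_coefE sz.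
Qed.

Section Eval.
Variable L : fieldExtType K.
Implicit Types (x y : L).

Lemma pchar_ext : p \in [pchar L].
Proof. by rewrite pchar_lalg. Qed.

Lemma twisted_evalE n f y : (size f <= n)%N ->
  twisted_eval q f y = \sum_(i < n) f`_i *: y ^+ (q ^ i).
Proof.
move=> h; apply: (@sum_ord_widen _ (size f) n (fun i => f`_i *: y ^+ (q ^ i))) => // i hi.
by rewrite nth_default // scale0r.
Qed.

Lemma twisted_evalDl f g y :
  twisted_eval q (f + g) y = twisted_eval q f y + twisted_eval q g y.
Proof.
set n := maxn (size f) (size g).
rewrite !(@twisted_evalE n) ?leq_maxl ?leq_maxr ?size_polyD // -big_split /=.
by apply: eq_bigr => i _; rewrite coefD scalerDl.
Qed.

Lemma twisted_eval0l y : twisted_eval q 0 y = 0.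
Proof. by rewrite /twisted_eval size_poly0 big_ord0. Qed.

Lemma twisted_eval_suml (I : Type) (s : seq I) (P : pred I) (f : I -> {poly K}) y :
  twisted_eval q (\sum_(i <- s | P i) f i) y = \sum_(i <- s | P i) twisted_eval q (f i) y.
Proof.
by apply: (big_morph (fun f => twisted_eval q f y)) => [u w|];
  rewrite ?twisted_eval0l ?twisted_evalDl.
Qed.

Lemma twisted_evalX c m y : twisted_eval q (c *: 'X^m) y = c *: y ^+ (q ^ m).
Proof.
rewrite (@twisted_evalE m.+1); last first.
  by apply: leq_trans (size_scale_leq _ _) _; rewrite size_polyXn.
rewrite big_ord_recr /= coefZ coefXn eqxx mulr1 big1 ?add0r // => i _.
by rewrite coefZ coefXn ltn_eqF // mulr0 scale0r.
Qed.

Lemma twisted_eval0 f : twisted_eval q f (0 : L) = 0.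
Proof.
by rewrite /twisted_eval big1 // => i _; rewrite (frob0 pchar_ext hq) scaler0.
Qed.

Lemma twisted_evalM f g y :
  twisted_eval q (twisted_mul q f g) y = twisted_eval q f (twisted_eval q g y).
Proof.
rewrite twisted_eval_suml {2}/twisted_eval; apply: eq_bigr => i _.
rewrite twisted_eval_suml (frob_sum pchar_ext hq) scaler_sumr; apply: eq_bigr => j _.
by rewrite twisted_evalX exprZn -exprM -expnD addnC scalerA.
Qed.

End Eval.
End Twisted.

(** * Interpolation and bad reduction *)

Section IntegralPoly.
Variables (L : fieldType) (w : L -> \bar int).
Hypothesis hw : valuation w.

Definition integral_coefs (f : {poly L}) := forall m, (0%:E <= w f`_m)%E.

Lemma integral_coefsM f g : integral_coefs f -> integral_coefs g -> integral_coefs (f * g).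
Proof.
move=> hf hg m; rewrite coefM; apply: (val_ge_sum hw) => i _.
by rewrite -[0]addr0; apply: (val_ge_mul hw).
Qed.

Lemma integral_coefs_prod (I : Type) (s : seq I) (P : pred I) (f : I -> {poly L}) :
  (forall i, P i -> integral_coefs (f i)) -> integral_coefs (\prod_(i <- s | P i) f i).
Proof.
move=> h; apply: (big_ind integral_coefs) => //; last exact: integral_coefsM.
by move=> m; rewrite coefC; case: eqP => _; rewrite ?(val1 hw) ?(val0 hw).
Qed.

(* The Lagrange basis polynomial at [psi u] is [X / psi u] times the product
   of the [X / psi t - 1] for [t] different from [0] and [u], because
   [psi u - psi u'] and [psi t] run over the same set. *)
Lemma interpolation_bound (V : finZmodType) (psi : V -> L) (G : {poly L}) (b : \bar int) :
  (forall u v, psi (u - v) = psi u - psi v) ->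
  (forall u, u != 0 -> (w (psi u) <= 0)%E) ->
  (size G <= #|V|)%N -> G.[0] = 0 ->
  (forall u, (b <= w G.[psi u])%E) -> forall m, (b <= w G`_m)%E.
Proof.
move=> psiB hpsi hsize hG0 hb m.
have psi0 : psi 0 = 0 by rewrite -(subrr (0 : V)) psiB subrr.
have psin0 u : u != 0 -> psi u != 0.
  by move=> /hpsi; apply: contraTneq => ->; rewrite (val0 hw).
have psiI : injective psi.
  move=> u v h; apply/eqP; rewrite -subr_eq0; apply: contraT => /psin0.
  by rewrite psiB h subrr eqxx.
have hV u : u != 0 -> (0%:E <= w (psi u)^-1)%E.
  move=> u0; have [k hk] := valP hw (psin0 _ u0).
  by rewrite (val_eq_inv hw hk) lee_fin oppr_ge0 -lee_fin -hk hpsi.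
pose ell u := \prod_(t | t != u) ((psi u - psi t)^-1 *: ('X - (psi t)%:P)).
have ellE u v : (ell u).[psi v] = (u == v)%:R.
  rewrite /ell horner_prod; have [<-|uv] := eqVneq u v.
    apply: big1 => t tu; rewrite hornerZ hornerXsubC mulVf // -psiB psin0 //.
    by rewrite subr_eq0 eq_sym.
  by rewrite (bigD1 v) 1?eq_sym //= hornerZ hornerXsubC subrr mulr0 mul0r.
have ell_size u : (size (ell u) <= #|V|)%N.
  apply: leq_trans (size_prod_leq _ _) _.
  have hs t : t != u -> size ((psi u - psi t)^-1 *: ('X - (psi t)%:P)) = 2.
    move=> tu; rewrite size_scale ?size_XsubC // invr_eq0 -psiB psin0 //.
    by rewrite subr_eq0 eq_sym.
  rewrite (eq_bigr (fun=> 2)) // sum_nat_const.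
  have -> : #|[pred t | t != u]| = #|V|.-1 by rewrite cardC1.
  by case: #|V| (max_card (pred1 u)) => [|k]; rewrite ?card1 //= => _; lia.
have GE : G = \sum_u G.[psi u] *: ell u.
  apply/eqP; rewrite -subr_eq0; apply: contraT => h.
  set P := G - _ in h.
  have hr : all (root P) (map psi (enum V)).
    apply/allP => _ /mapP[v _ ->]; rewrite rootE /P hornerD hornerN horner_sum.
    rewrite (bigD1 v) //= hornerZ ellE eqxx mulr1 big1 ?addr0 ?subrr // => u uv.
    by rewrite hornerZ ellE (negbTE uv) mulr0.
  have := max_poly_roots h hr; rewrite map_inj_uniq // enum_uniq size_map -cardE.
  move=> /(_ isT); rewrite ltnNge => /negP[]; apply: leq_trans (size_polyD _ _) _.
  rewrite geq_max hsize size_polyN; apply: (big_ind (fun f : {poly L} => size f <= #|V|)%N).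
  - by rewrite size_poly0.
  - by move=> f g hf hg; apply: leq_trans (size_polyD _ _) _; rewrite geq_max hf.
  - by move=> u _; apply: leq_trans (size_scale_leq _ _) _.
have ell_int u : u != 0 -> integral_coefs (ell u).
  move=> u0.
  have -> : ell u = ((psi u)^-1 *: 'X) *
      \prod_(t | (t != 0) && (t != u)) ((psi t)^-1 *: ('X - (psi t)%:P)).
    have -> : ell u = (\prod_(t | t != u) (psi u - psi t)^-1) *:
                        \prod_(t | t != u) ('X - (psi t)%:P).
      by rewrite /ell scaler_prod.
    have -> : \prod_(t | t != u) (psi u - psi t)^-1 = \prod_(t | t != 0) (psi t)^-1.
      rewrite (reindex_inj (h := fun t => u - t)); last first.
        by move=> s t /addrI/oppr_inj.
      apply: eq_big => t; first by rewrite -subr_eq0 addrAC subrr sub0r oppr_eq0.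
      by move=> _; rewrite psiB opprB addrCA subrr addr0.
    rewrite scaler_prod -[in RHS]scalerAl -[in RHS]scalerAr [in RHS]scalerA.
    rewrite (bigD1 u) //=; congr (_ *: _).
    rewrite (bigD1 0) 1?eq_sym //= psi0 subr0; congr (_ * _).
    by apply: eq_bigl => t; rewrite andbC.
  apply: integral_coefsM.
    move=> k; rewrite coefZ coefX; case: eqP => _; last by rewrite mulr0 (val0 hw) leey.
    by rewrite mulr1 hV.
  apply: integral_coefs_prod => t /andP[t0 _] k.
  rewrite scalerBr coefB !coefZ coefX coefC.
  apply: (valB hw).
    by case: eqP => _; rewrite ?mulr1 ?hV // mulr0 (val0 hw) leey.
  by case: eqP => _; rewrite ?mulVf ?psin0 ?(val1 hw) // mulr0 (val0 hw) leey.
rewrite GE coef_sum; apply: (val_ge_sum hw) => u _; rewrite coefZ.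
have [->|u0] := eqVneq u 0; first by rewrite psi0 hG0 mul0r (val0 hw) leey.
rewrite (valM hw) -[b]adde0; apply: leeD (hb u) (ell_int u u0 m).
Qed.

End IntegralPoly.

Section Local.
Variables (p q e : nat) (K : fieldType) (L : fieldExtType K) (w : L -> \bar int).
Hypotheses (hp : p \in [pchar K]) (hq : q = (p ^ e)%N) (he : (0 < e)%N).
Hypothesis hw : valuation w.
Implicit Types (f g : {poly K}) (y : L) (c : nat) (k : int).

Definition coefs_ge c f := forall m, ((- c%:Z)%:E <= w (in_alg L f`_m))%E.

Lemma coefs_ge_ex f : exists c, coefs_ge c f.
Proof.
exists (\sum_(m < size f) `|fine (w (in_alg L f`_m))|)%N => m.
have [hm|hm] := ltnP m (size f); last first.
  by rewrite nth_default // rmorph0 (val0 hw) leey.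
have [->|h0] := eqVneq (in_alg L f`_m) 0; first by rewrite (val0 hw) leey.
rewrite (valE hw h0) lee_fin (bigD1 (Ordinal hm)) //=; set F := fine _; lia.
Qed.

Lemma val_term c f y k m i : coefs_ge c f -> (k%:E <= w y)%E ->
  ((- c%:Z + k *+ (q ^ i))%:E <= w (f`_m *: y ^+ (q ^ i))%R)%E.
Proof.
move=> hc hy; rewrite -mulr_algl -in_algE; apply: (val_ge_mul hw) (hc m) _.
exact: (val_ge_exp hw).
Qed.

(** Below [- c] the leading term dominates strictly: with [d] the degree in tau and [i < d],
    [k (q ^ d - q ^ i) <= k < - c]. *)
Lemma twisted_eval_escape c f y k : f != 0 ->
  w (in_alg L (lead_coef f)) = 0%E -> coefs_ge c f ->
  w y = k%:E -> k < - c%:Z ->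
  w (twisted_eval q f y) = (k *+ (q ^ (size f).-1))%:E.
Proof.
move=> f0 hl hc hy hk; rewrite /twisted_eval.
have sf : (0 < size f)%N by rewrite size_poly_gt0.
have hi : ((size f).-1 < size f)%N by rewrite prednK.
have e0 : w (f`_(Ordinal hi) *: y ^+ (q ^ Ordinal hi)) = (k *+ (q ^ (size f).-1))%:E.
  rewrite -mulr_algl -in_algE -[RHS]add0e (valM hw) /= -lead_coefE hl.
  by rewrite (val_eq_exp hw _ hy).
rewrite (val_lt_sum hw (i0 := Ordinal hi)) //; first exact: (val_neq0 hw e0).
move=> i hii; rewrite e0.
apply: lt_le_trans (val_term i i hc (_ : (k%:E <= w y)%E)); last by rewrite hy.
have : (i < (size f).-1)%N.
  by rewrite ltn_neqAle -ltnS prednK // ltn_ord andbT; move: hii; rewrite -val_eqE.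
rewrite lte_fin !mulrnZ -(ltn_exp2l _ _ (q_gt1 hp hq he)).
move: (q ^ i)%N (q ^ (size f).-1)%N => a b ab.
have [d ->] : exists d, (b = a + d.+1)%N by exists (b - a).-1; lia.
have : k * d%:Z <= 0 by rewrite mulr_le0_ge0 //; lia.
by lia.
Qed.

Lemma twisted_eval_ge c d f y : coefs_ge c f -> ((- d%:Z)%:E <= w y)%E ->
  ((- (c + d * q ^ (size f).-1)%:Z)%:E <= w (twisted_eval q f y))%E.
Proof.
move=> hc hy; rewrite /twisted_eval; apply: (val_ge_sum hw) => i _.
apply: le_trans (val_term i i hc hy); rewrite lee_fin mulNrn -opprD lerN2.
rewrite PoszD lerD2l mulrnZ -PoszM lez_nat leq_mul2l leq_pexp2l ?orbT //.
  exact: ltnW (q_gt1 hp hq he).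
by rewrite -ltnS prednK // (leq_ltn_trans _ (ltn_ord i)).
Qed.

(** [c] is the exact largest pole order and [m] the last index that attains it. Being last makes one
    term strictly dominant in a suitable coefficient of a twisted product. *)
Lemma coefs_ge_tight f : (exists m, (w (in_alg L f`_m) < 0)%E) ->
  exists c m, [/\ (0 < c)%N, coefs_ge c f, w (in_alg L f`_m) = (- c%:Z)%:E &
    forall j, (m < j)%N -> ((1 - c%:Z)%:E <= w (in_alg L f`_j))%E].
Proof.
case=> m0 hm0.
pose P c := `[< coefs_ge c f >].
have exP : exists c, P c by have [c hc] := coefs_ge_ex f; exists c; apply/asboolP.
case: (ex_minnP exP) => c /asboolP hc cmin.
have c0 : (0 < c)%N.
  rewrite lt0n; apply: contraTneq hm0 => c0; rewrite -leNgt.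
  by have := hc m0; rewrite c0.
pose Q m := w (in_alg L f`_m) == (- c%:Z)%:E.
have exQ : exists m, Q m.
  apply: contrapT => hn; suff : (c <= c.-1)%N by rewrite -ltnS prednK // ltnn.
  apply: cmin; apply/asboolP => m; have := hc m; rewrite le_eqVlt => /orP[h|].
    by case: hn; exists m; rewrite /Q eq_sym.
  by rewrite ltEe_succ; apply: le_trans; rewrite lee_fin; lia.
have ubQ m : Q m -> (m <= size f)%N.
  rewrite leqNgt /Q; move=> h; apply: contraTN h => h.
  by rewrite (nth_default _ (ltnW h)) rmorph0 (val0 hw).
case: (ex_maxnP exQ ubQ) => m /eqP hm mmax; exists c, m; split=> // j mj.
have := hc j; rewrite le_eqVlt => /orP[h|].
  by have := mmax j; rewrite /Q eq_sym h => /(_ isT); rewrite leqNgt mj.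
by rewrite ltEe_succ; apply: le_trans; rewrite lee_fin; lia.
Qed.

(** In the sum for index [r + m], the term [i = r] is the [q ^ r]-th power of the worst coefficient.
    For [i < r] the second factor has index beyond [m], so the term is at least
    [- c + (1 - c) q ^ i], which exceeds [- c q ^ r] because [q ^ r >= q ^ i + 1]. *)
Lemma twisted_square_coef f c m r : f \is monic -> size f = r.+1 ->
  (0 < c)%N -> coefs_ge c f -> w (in_alg L f`_m) = (- c%:Z)%:E ->
  (forall j, (m < j)%N -> ((1 - c%:Z)%:E <= w (in_alg L f`_j))%E) ->
  w (in_alg L (twisted_mul q f f)`_(r + m)) = (- (c * q ^ r)%:Z)%:E.
Proof.
move=> hf hs c0 hc hm hmax; rewrite (coef_twisted_mul hp hq) rmorph_sum.
have hi : (r < (r + m).+1)%N by rewrite ltnS leq_addr.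
have fr : f`_r = 1 by have := monicP hf; rewrite lead_coefE hs.
have e0 : w (in_alg L (f`_r * f`_(r + m - r) ^+ (q ^ r)))
    = (- (c * q ^ r)%:Z)%:E.
  rewrite fr mul1r addKn rmorphXn (val_eq_exp hw _ hm); congr EFin.
  by rewrite mulNrn mulrnZ PoszM.
rewrite (val_lt_sum hw (i0 := Ordinal hi)) //; first exact: (val_neq0 hw e0).
move=> i hii; rewrite e0; have [ri|ir] := ltnP r i.
  by rewrite [f`_i]nth_default ?hs // mul0r rmorph0 (val0 hw) ltey.
have {}ir : (i < r)%N by rewrite ltn_neqAle ir andbT; move: hii; rewrite -val_eqE.
rewrite (rmorphM (in_alg L)) (rmorphXn (in_alg L)).
have h1 : (m < r + m - i)%N by clear -ir; lia.
apply: lt_le_trans (val_ge_mul hw (hc i) (val_ge_exp hw (q ^ i) (hmax _ h1))).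
rewrite lte_fin; move: ir; rewrite -(ltn_exp2l _ _ (q_gt1 hp hq he)) => ir.
rewrite mulrnZ PoszM; have := qX_gt0 hp hq he i.
move: (q ^ i)%N (q ^ r)%N c0 ir => a b c0 ab a0; nia.
Qed.

(** If all values exceeded [- c q ^ r], [interpolation_bound] would bound every coefficient of the
    twisted square in the same way, against [twisted_square_coef]. The square has degree
    [q ^ (r + r)] as an ordinary polynomial, which dictates the number of interpolation points. *)
Lemma bad_reduction_bound f r : f \is monic -> size f = r.+1 ->
  (exists m, (w (in_alg L f`_m) < 0)%E) ->
  exists c, [/\ (0 < c)%N, coefs_ge c f &
    forall (V : finZmodType) (psi : V -> L),
      (forall u v, psi (u - v) = psi u - psi v) ->
      (forall u, u != 0 -> (w (psi u) <= 0)%E) ->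
      (q ^ (r + r) < #|V|)%N ->
      exists u, (w (twisted_eval q f (twisted_eval q f (psi u)))
                   <= (- (c * q ^ r)%:Z)%:E)%E].
Proof.
move=> hf hs /coefs_ge_tight [c [m [c0 hc hm hmax]]]; exists c; split=> //.
move=> V psi psiB hpsi cardV; apply: contrapT => hn.
have hgt u : ((- (c * q ^ r)%:Z)%:E <
    w (twisted_eval q f (twisted_eval q f (psi u))))%E.
  by rewrite ltNge; apply/negP => h; apply: hn; exists u.
set f2 := twisted_mul q f f.
have f0 : f != 0 by rewrite -size_poly_gt0 hs.
have sf2 : size f2 = (r + r).+1.
  by have [-> _] := twisted_mul_lead hp hq he f0 f0; rewrite hs addSn addnS.
pose G : {poly L} := \sum_(i < size f2) in_alg L f2`_i *: 'X^(q ^ i).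
have hG y : G.[y] = twisted_eval q f (twisted_eval q f y).
  rewrite -(twisted_evalM hp hq) -/f2 /G horner_sum; apply: eq_bigr => i _.
  by rewrite hornerZ hornerXn in_algE mulr_algl.
have sG : (size G <= #|V|)%N.
  apply: leq_trans cardV; apply: (big_ind (fun g : {poly L} => size g <= _)%N).
  - by rewrite size_poly0.
  - by move=> g h hg hh; apply: leq_trans (size_polyD _ _) _; rewrite geq_max hg.
  - move=> i _; apply: leq_trans (size_scale_leq _ _) _; rewrite size_polyXn ltnS.
    by rewrite leq_pexp2l ?(ltnW (q_gt1 hp hq he)) // -ltnS -sf2.
have G0 : G.[0] = 0 by rewrite hG !(twisted_eval0 hp hq).
have cG : G`_(q ^ (r + m)) = in_alg L f2`_(r + m).
  rewrite /G coef_sum; have [h|h] := ltnP (r + m) (size f2).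
    rewrite (bigD1 (Ordinal h)) //= coefZ coefXn eqxx mulr1 big1 ?addr0 // => i hi.
    rewrite coefZ coefXn eqn_exp2l ?(q_gt1 hp hq he) // eq_sym.
    by move: hi; rewrite -val_eqE /= => /negbTE ->; rewrite mulr0.
  rewrite (nth_default _ h) rmorph0 big1 // => i _.
  rewrite coefZ coefXn eqn_exp2l ?(q_gt1 hp hq he) // gtn_eqF ?mulr0 //.
  exact: leq_trans (ltn_ord i) h.
have := @interpolation_bound _ _ hw V psi G (- (c * q ^ r)%:Z + 1)%:E psiB hpsi sG G0 _
  (q ^ (r + m))%N.
rewrite cG (twisted_square_coef hf hs c0 hc hm hmax) lee_fin.
have h u : ((- (c * q ^ r)%:Z + 1)%:E <= w G.[psi u])%E by rewrite hG -ltEe_succ.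
by move=> /(_ h); rewrite lezD1 ltxx.
Qed.

End Local.

(** * Local heights *)

Section Tate.
Variables (R : realType) (D C : R).
Hypotheses (hD : 2 <= D) (hC : 0 <= C).
Implicit Types (l : nat -> R).

Let D0 : 0 < D. Proof. by move: hD; lra. Qed.
Let DX0 m : 0 < D ^+ m. Proof. exact: exprn_gt0. Qed.

Lemma tate_null : (fun m => C / D ^+ m) @ \oo --> (0 : R).
Proof.
have -> : (fun m => C / D ^+ m) = geometric C D^-1.
  by apply/funext => m; rewrite /geometric /= exprVn.
apply: cvg_geometric; rewrite ger0_norm ?invr_ge0 ?ltW //.
by rewrite invf_lt1 //; move: hD; lra.
Qed.

(** The uniqueness side of Tate's argument: a defect that is multiplied by [D] at each step and
    stays bounded must vanish. *)
Lemma tate_zero (x : R) : (forall m, D ^+ m * `|x| <= C) -> x = 0.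
Proof.
move=> h; apply/eqP; rewrite -normr_le0.
apply: (@ler_cvg_to _ \oo _ _ (fun=> `|x|) (fun m => C / D ^+ m)).
- exact: cvg_cst.
- exact: tate_null.
- by near=> m; rewrite ler_pdivlMr // mulrC.
Unshelve. all: by end_near. Qed.

(** With [s m = l m / D ^ m], the sequence [s m + C / D ^ m] decreases and [s m - C / D ^ m]
    increases, because [D >= 2] gives [C <= (D - 1) C]. Comparison with the terms at [m = 0] bounds
    the limit. *)
Lemma tate_cvg l : (forall m, `|l m.+1 - D * l m| <= C) ->
  cvgn (fun m => l m / D ^+ m) /\ `|limn (fun m => l m / D ^+ m) - l 0| <= C.
Proof.
move=> h; set s := fun m => l m / D ^+ m.
have step m : s m.+1 - s m = (l m.+1 - D * l m) / D ^+ m.+1.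
  by rewrite /s exprS; field; rewrite !gt_eqF.
have stepC m : C / D ^+ m - C / D ^+ m.+1 = (D - 1) * C / D ^+ m.+1.
  by rewrite exprS; field; rewrite !gt_eqF.
have hstep m : `|s m.+1 - s m| <= C / D ^+ m - C / D ^+ m.+1.
  rewrite step normrM stepC normfV (gtr0_norm (DX0 _)) ler_pM2r ?invr_gt0 //.
  apply: le_trans (h m) _; rewrite -[leLHS]mul1r ler_wpM2r //.
  by rewrite lerBrDl -[1 + 1]/(2 : R).
have hu : {homo (fun m => s m + C / D ^+ m) : n m / (n <= m)%N >-> m <= n}.
  by apply/nonincreasing_seqP => m; have := hstep m; rewrite ler_norml => /andP[]; lra.
have hz : {homo (fun m => s m - C / D ^+ m) : n m / (n <= m)%N >-> n <= m}.
  by apply/nondecreasing_seqP => m; have := hstep m; rewrite ler_norml => /andP[]; lra.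
have C0 m : 0 <= C / D ^+ m by rewrite divr_ge0 // ltW.
have s0 : s 0 = l 0 by rewrite /s expr0 divr1.
have cu : cvgn (fun m => s m + C / D ^+ m).
  apply: nonincreasing_is_cvgn hu _; exists (s 0 - C / D ^+ 0) => _ [m _ <-].
  by apply: le_trans (hz 0 m (leq0n m)) _ => /=; have := C0 m; lra.
have cs : cvgn s.
  have -> : s = (fun m => s m + C / D ^+ m) - (fun m => C / D ^+ m).
    by apply/funext => m /=; rewrite !fctE addrK.
  by apply: is_cvgB => //; apply: cvgP tate_null.
split=> //; rewrite ler_distl -s0; apply/andP; split.
  apply: limr_ge => //; near=> m; have := hz 0 m (leq0n m); rewrite expr0 divr1.
  by have := C0 m; lra.
apply: limr_le => //; near=> m; have := hu 0 m (leq0n m); rewrite expr0 divr1.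
by have := C0 m; lra.
Unshelve. all: by end_near. Qed.

Lemma tate_scale l l' d : (forall m, `|l' m - d * l m| <= C) ->
  cvgn (fun m => l m / D ^+ m) ->
  limn (fun m => l' m / D ^+ m) = d * limn (fun m => l m / D ^+ m).
Proof.
move=> h hl; apply: cvg_lim => //.
have h0 : (fun m => (l' m - d * l m) / D ^+ m) @ \oo --> (0 : R).
  apply/cvgr0Pnorm_le => eps eps0.
  have /cvgr0Pnorm_le/(_ eps eps0) := tate_null; apply: filterS => m /=.
  apply: le_trans; rewrite !normrM ler_wpM2r // (le_trans (h m)) //.
  exact: ler_norm.
have -> : (fun m => l' m / D ^+ m) =
  (fun m => (l' m - d * l m) / D ^+ m) + (fun m => d * (l m / D ^+ m)).
  by apply/funext => m; rewrite !fctE; field; rewrite gt_eqF.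
rewrite -[d * limn _]add0r; apply: cvgD => //.
by apply: cvgMl_tmp.
Qed.

End Tate.

(** * Pole orders and local heights of a Drinfeld module *)

Section DrinfeldModule.
Variables (p q e : nat) (A : comNzRingType) (K : fieldType) (i : A -> K).
Variable phi : A -> {poly K}.
Hypotheses (hp : p \in [pchar K]) (hq : q = (p ^ e)%N) (he : (0 < e)%N).
Hypothesis hphi : drinfeld_module q i phi.

Lemma drinfeld0 : phi 0 = 0.
Proof. by apply: (addrI (phi 0)); rewrite -(drinfeldD hphi) !addr0. Qed.

Lemma drinfeldN a : phi (- a) = - phi a.
Proof.
by apply/eqP; rewrite -addr_eq0 -(drinfeldD hphi) addNr drinfeld0.
Qed.

Lemma drinfeld_sum (I : Type) (s : seq I) (P : pred I) (F : I -> A) :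
  phi (\sum_(j <- s | P j) F j) = \sum_(j <- s | P j) phi (F j).
Proof. exact: (big_morph phi (drinfeldD hphi) drinfeld0). Qed.

Lemma drinfeld_exp a m : phi a != 0 ->
  size (phi (a ^+ m)) = (m * (size (phi a)).-1).+1.
Proof.
move=> a0; elim: m => [|m IH]; first by rewrite (drinfeld1 hphi) size_poly1.
have am0 : phi (a ^+ m) != 0 by rewrite -size_poly_gt0 IH.
rewrite exprS (drinfeldM hphi).
have [-> _] := twisted_mul_lead hp hq he a0 am0.
rewrite IH mulSn addnS /=; move: a0; rewrite -size_poly_gt0.
by case: (size _).
Qed.

(* Compare the leading coefficients in [phi_t phi_b = phi_b phi_t]. *)
Lemma drinfeld_lead t r b : phi t \is monic -> size (phi t) = r.+1 -> phi b != 0 ->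
  lead_coef (phi b) ^+ (q ^ r) = lead_coef (phi b).
Proof.
move=> ht hr b0; have t0 := monic_neq0 ht.
have [_ h1] := twisted_mul_lead hp hq he t0 b0.
have [_ h2] := twisted_mul_lead hp hq he b0 t0.
move: h1; rewrite -(drinfeldM hphi) mulrC (drinfeldM hphi) h2.
by rewrite (monicP ht) expr1n mulr1 mul1r hr /= => <-.
Qed.

Section Action.
Variable L : fieldExtType K.

Lemma drinfeld_actM a b (y : L) :
  twisted_eval q (phi (a * b)) y = twisted_eval q (phi a) (twisted_eval q (phi b) y).
Proof. by rewrite (drinfeldM hphi) (twisted_evalM hp hq). Qed.

Lemma drinfeld_actD a b (y : L) :
  twisted_eval q (phi (a + b)) y = twisted_eval q (phi a) y + twisted_eval q (phi b) y.
Proof. by rewrite (drinfeldD hphi) (twisted_evalDl q). Qed.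

Lemma drinfeld_actN a (y : L) :
  twisted_eval q (phi (- a)) y = - twisted_eval q (phi a) y.
Proof.
apply/eqP; rewrite -addr_eq0 -drinfeld_actD addNr drinfeld0.
by rewrite (twisted_eval0l q).
Qed.

End Action.

Section LocalHeight.
Variables (R : realType) (L : fieldExtType K) (w : L -> \bar int).
Hypothesis hw : valuation w.
Variables (t : A) (r : nat).
Hypotheses (hr : size (phi t) = r.+1) (r0 : (0 < r)%N) (hmonic : phi t \is monic).

(** This is minus the usual order of the pole, hence nonpositive. The minimum with 0 also gives
    [y = 0], of valuation [+oo], the finite value 0. *)
Definition pole_order (y : L) : int := fine (Order.min 0%E (w y)).

Lemma pole_order_neg y k : w y = k%:E -> k < 0 -> pole_order y = k.
Proof.
by move=> h k0; rewrite /pole_order h min_r // lee_fin ltW.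
Qed.

Lemma pole_order_bound y c : ((- c%:Z)%:E <= w y)%E -> - c%:Z <= pole_order y <= 0.
Proof.
rewrite /pole_order => h; have [h0|h0] := leP 0%E (w y).
  by rewrite /= oppr_le0 lexx andbT; lia.
have y0 : y != 0 by apply: contraTneq h0 => ->; rewrite (val0 hw).
by move: h h0; rewrite (valE hw y0) /= lee_fin lte_fin => -> /ltW ->.
Qed.

(** By [drinfeld_lead] the leading coefficient is fixed by a power of Frobenius, so it is a root of
    unity. *)
Lemma val_drinfeld_lead b : phi b != 0 -> w (in_alg L (lead_coef (phi b))) = 0%E.
Proof.
move=> b0; apply: (@val_exp_fixed _ _ hw _ (q ^ r)).
- by rewrite -(exp1n r) ltn_exp2r // (q_gt1 hp hq he).
- by rewrite fmorph_eq0 lead_coef_eq0.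
- by rewrite -rmorphXn (drinfeld_lead hmonic hr).
Qed.

(** Above the escape threshold [- c] both pole orders are bounded; below it the difference is
    exactly 0. *)
Lemma pole_order_drinfeld b : phi b != 0 -> exists C : nat, forall y,
  `|pole_order (twisted_eval q (phi b) y)
     - pole_order y * (q ^ (size (phi b)).-1)%N%:Z| <= C%:Z.
Proof.
move=> b0; have [c hc] := coefs_ge_ex hp hq he hw (phi b).
set Q := (q ^ (size (phi b)).-1)%N; exists (c + c * Q)%N => y.
have [h|h] := leP (- c%:Z)%:E (w y).
  have /andP[h1 h2] := pole_order_bound h.
  have /andP[h3 h4] := pole_order_bound (twisted_eval_ge hp hq he hw hc h).
  rewrite -/Q in h3; move: h1 h2 h3 h4; rewrite !PoszD !PoszM.
  have hQ : 0 <= Q%:Z by [].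
  have hc0 : 0 <= c%:Z by [].
  move: hQ hc0; move: (Q%:Z) (c%:Z) (pole_order y) (pole_order (twisted_eval _ _ _)).
  move=> u d v z u0 d0 h1 h2 h3 h4; rewrite ler_norml; apply/andP; split; nia.
have y0 : y != 0 by apply: contraTneq h => ->; rewrite (val0 hw).
move: h; rewrite (valE hw y0) lte_fin => h.
have Q0 := qX_gt0 hp hq he (size (phi b)).-1; rewrite -/Q in Q0.
have e1 := twisted_eval_escape hp hq he hw b0 (val_drinfeld_lead b0) hc (valE hw y0) h.
rewrite (pole_order_neg (valE hw y0)) 1?(pole_order_neg e1).
- by rewrite mulrnZ subrr normr0.
- by rewrite mulrnZ pmulr_llt0 ?ltz_nat //; apply: lt_le_trans h _; rewrite oppr_le0.
- by apply: lt_le_trans h _; rewrite oppr_le0.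
Qed.

Variable a : A.
Hypothesis ha : (1 < size (phi a))%N.

Definition local_height0 (y : L) : R :=
  - limn (fun m : nat => (pole_order (twisted_eval q (phi (a ^+ m)) y))%:~R
      / (twisted_degree q (phi (a ^+ m)))%:R : R).

Let D : R := (q ^ (size (phi a)).-1)%:R.

Let a0 : phi a != 0. Proof. by rewrite -size_poly_gt0 ltnW. Qed.

Let D2 : 2 <= D.
Proof.
rewrite /D (ler_nat R 2); apply: leq_trans (q_gt1 hp hq he) _.
rewrite -[X in (X <= _)%N]expn1 leq_pexp2l ?(ltnW (q_gt1 hp hq he)) //.
by rewrite -ltnS prednK // ltnW.
Qed.

Let degE m : (twisted_degree q (phi (a ^+ m)))%:R = D ^+ m :> R.
Proof. by rewrite /twisted_degree drinfeld_exp //= mulnC expnM natrX. Qed.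

Lemma local_height0E y : local_height0 y =
  - limn (fun m => (pole_order (twisted_eval q (phi (a ^+ m)) y))%:~R / D ^+ m : R).
Proof.
rewrite /local_height0; set f := fun m => _; set g := fun m => _.
by have -> : f = g by apply/funext => m; rewrite /f /g degE.
Qed.

Let intr_bound (u v : int) (Q C : nat) : `|u - v * Q%:Z| <= C%:Z ->
  `|u%:~R - Q%:R * v%:~R| <= C%:R :> R.
Proof.
move=> h; have : (`|u - v * Q%:Z|)%:~R <= C%:Z%:~R :> R by rewrite ler_int.
by rewrite intr_norm intrB intrM -!pmulrn mulrC.
Qed.

(** [C] is independent of [y], which allows the estimate to be applied along a whole orbit in
    [local_height0_escape]. *)
Lemma local_height0_cvg : exists2 C : R, 0 <= C & forall y,
  cvgn (fun m => (pole_order (twisted_eval q (phi (a ^+ m)) y))%:~R / D ^+ m : R) /\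
  `|local_height0 y + (pole_order y)%:~R| <= C.
Proof.
have [C hC] := pole_order_drinfeld a0; exists C%:R => // y.
pose l m : R := (pole_order (twisted_eval q (phi (a ^+ m)) y))%:~R.
have hl m : `|l m.+1 - D * l m| <= C%:R.
  by rewrite /l exprS drinfeld_actM; apply: intr_bound.
have [h1 h2] := tate_cvg D2 (ler0n R C) hl; split=> //.
rewrite local_height0E -normrN opprD opprK; move: h2.
by rewrite /l expr0 (drinfeld1 hphi) /twisted_eval size_poly1 big_ord1 coefC eqxx
  scale1r expn0 expr1.
Qed.

(** Since [phi_b] commutes with [phi_(a ^ m)], the estimate of [pole_order_drinfeld] for [b] holds
    at every term of the limit defined by [a]. *)
Lemma local_height0_scale b y : phi b != 0 ->
  local_height0 (twisted_eval q (phi b) y) = (q ^ (size (phi b)).-1)%:R * local_height0 y.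
Proof.
move=> b0; have [C hC] := pole_order_drinfeld b0.
have [C' _ /(_ y)[hy _]] := local_height0_cvg.
rewrite !local_height0E mulrN; congr (- _).
pose l' m : R := (pole_order (twisted_eval q (phi (a ^+ m)) (twisted_eval q (phi b) y)))%:~R.
apply: (@tate_scale _ _ C%:R D2 _ l' _ _ hy) => m; rewrite /l'.
by rewrite -drinfeld_actM mulrC drinfeld_actM; apply: intr_bound.
Qed.

(** The whole orbit of [z] under [t] escapes, with pole orders exactly [k q ^ (r m)], while the
    height of its [m]-th point is [q ^ (r m)] times that of [z]. So [q ^ (r m) (h + k)] stays
    bounded, [h] being the height of [z]. *)
Lemma local_height0_escape c z k : coefs_ge w c (phi t) ->
  w z = k%:E -> k < - c%:Z -> local_height0 z = - k%:~R.
Proof.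
move=> hc hz hk; apply/eqP; rewrite -subr_eq0 opprK; apply/eqP.
have [C C0 hC] := local_height0_cvg.
pose Dt : R := (q ^ r)%:R.
have Dt2 : 2 <= Dt.
  rewrite /Dt (ler_nat R 2); apply: leq_trans (q_gt1 hp hq he) _.
  by rewrite -[X in (X <= _)%N]expn1 leq_pexp2l ?(ltnW (q_gt1 hp hq he)).
apply: (@tate_zero _ _ C Dt2) => m.
have t0 := monic_neq0 hmonic.
have hTm : w (twisted_eval q (phi (t ^+ m)) z) = (k *+ (q ^ (m * r)))%:E.
  elim: m => [|m IH].
    by rewrite (drinfeld1 hphi) /twisted_eval size_poly1 big_ord1 coefC eqxx
      scale1r expn0 expr1.
  rewrite exprS drinfeld_actM.
  rewrite (twisted_eval_escape hp hq he hw t0 (val_drinfeld_lead t0) hc IH).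
    by rewrite hr /= -mulrnA -expnD mulSn addnC.
  apply: le_lt_trans (hk); rewrite mulrnZ ler_neMr //.
    by apply: le_trans (ltW hk) _; rewrite oppr_le0.
  by rewrite -[1]/(1%N%:Z) lez_nat (qX_gt0 hp hq he).
have [_] := hC (twisted_eval q (phi (t ^+ m)) z).
rewrite local_height0_scale -?size_poly_gt0 drinfeld_exp // hr /=.
rewrite (pole_order_neg hTm); last first.
  rewrite mulrnZ pmulr_llt0 ?ltz_nat ?(qX_gt0 hp hq he) //.
  by apply: lt_le_trans hk _; rewrite oppr_le0.
rewrite mulrnZ intrM -pmulrn mulrC -mulrDl normrM mulrC.
by rewrite [X in X * _]ger0_norm // natrX /Dt natrX -exprM mulnC.
Qed.

End LocalHeight.
End DrinfeldModule.

(** * Finite extensions *)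

Section FiniteEmbedding.
Variables (E L : fieldType) (j : {rmorphism E -> L}).
Implicit Types (I J : finType).

Definition spanning I (b : I -> L) := forall y, exists c : I -> E, y = \sum_k j (c k) * b k.

Lemma span_ord (S : set L) I (b : I -> L) :
  (forall y, S y -> exists c : I -> E, y = \sum_k j (c k) * b k) ->
  exists N (b' : 'I_N -> L), forall y, S y ->
    exists c : 'I_N -> E, y = \sum_k j (c k) * b' k.
Proof.
move=> h; exists #|I|, (b \o enum_val) => y /h[c ->]; exists (c \o enum_val).
by rewrite (reindex (@enum_val I predT)) //; apply/onW_bij/enum_val_bij.
Qed.

Definition independent I (b : I -> L) :=
  forall c : I -> E, \sum_k j (c k) * b k = 0 -> forall k, c k = 0.

Definition finite_embedding := exists N (b : 'I_N -> L), spanning b.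

Lemma linear_dependence I J (b : I -> L) (z : J -> L) :
  (forall k, exists c : I -> E, z k = \sum_i j (c i) * b i) -> (#|I| < #|J|)%N ->
  ~ independent z.
Proof.
move=> /choice[c hc] hIJ hz.
pose M : 'M[E]_(#|J|, #|I|) := \matrix_(k, i) c (enum_val k) (enum_val i).
have hk : kermx M != 0.
  rewrite -mxrank_eq0 mxrank_ker -lt0n subn_gt0.
  exact: leq_ltn_trans (rank_leq_col M) hIJ.
have /rowV0Pn[u /sub_kermxP hu u0] := hk.
suff : u = 0 by move=> h; rewrite h eqxx in u0.
apply/rowP => k; rewrite mxE -[k]enum_valK.
apply: (hz (fun s => u 0 (enum_rank s))).
under eq_bigr => s _ do rewrite hc mulr_sumr.
rewrite exchange_big big1 //= => i _.
transitivity (j (\sum_s u 0 (enum_rank s) * c s i) * b i).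
  by rewrite rmorph_sum mulr_suml; apply: eq_bigr => s _; rewrite rmorphM mulrA.
have := congr1 (fun m : 'rV_#|I| => m 0 (enum_rank i)) hu; rewrite !mxE => h.
have -> : \sum_s u 0 (enum_rank s) * c s i = 0; last by rewrite rmorph0 mul0r.
rewrite -[RHS]h [RHS](reindex (@enum_rank J)) /=; last exact/onW_bij/enum_rank_bij.
by apply: eq_big => // s _; rewrite mxE !enum_rankK.
Qed.

(* An element outside the span of a maximal independent family would enlarge it. *)
Definition extend_family d (b : 'I_d -> L) (y : L) (k : 'I_d.+1) : L :=
  oapp b y (unlift ord_max k).

Lemma extend_family_sum d (b : 'I_d -> L) y (c : 'I_d.+1 -> E) :
  \sum_k j (c k) * extend_family b y k =
  \sum_(k < d) j (c (lift ord_max k)) * b k + j (c ord_max) * y.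
Proof.
rewrite (bigD1_ord ord_max) //= addrC /extend_family unlift_none /=; congr (_ + _).
by apply: eq_bigr => k _; rewrite liftK.
Qed.

Lemma maximal_family (P : forall d, ('I_d -> L) -> Prop) N :
  (exists b : 'I_0 -> L, P 0%N b) ->
  (forall d (b : 'I_d -> L), P d b -> (d <= N)%N) ->
  exists d (b : 'I_d -> L), P d b /\ forall b' : 'I_d.+1 -> L, ~ P d.+1 b'.
Proof.
move=> h0 hN; apply: contrapT => hn.
have h d : exists b : 'I_d -> L, P d b.
  elim: d => // d [b hb]; apply: contrapT => h; apply: hn; exists d, b; split=> // b' hb'.
  by apply: h; exists b'.
by have [b /hN] := h N.+1; rewrite ltnn.
Qed.

Lemma basis_exists : finite_embedding ->
  exists d (b : 'I_d -> L), spanning b /\ independent b.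
Proof.
move=> [N [s hs]].
have [||d [b [hb hmax]]] := @maximal_family (fun d b => independent b) N.
- by exists (fun=> 0) => c _ [].
- move=> d b hb; rewrite leqNgt; apply/negP => h.
  by apply: (@linear_dependence _ _ s b) hb; rewrite ?card_ord.
exists d, b; split=> // y.
have := hmax (extend_family b y) => /existsNP[c] /not_implyP[].
rewrite extend_family_sum => hc /existsNP[k hk].
have cm : c ord_max != 0.
  apply/eqP => h; move: hc; rewrite h rmorph0 mul0r addr0 => /hb hc; apply: hk.
  by case: (unliftP ord_max k) => [i|] ->.
exists (fun k => - c (lift ord_max k) / c ord_max).
have jc : j (c ord_max) != 0 by rewrite fmorph_eq0.
apply: (mulfI jc); rewrite mulr_sumr; apply/eqP; rewrite -subr_eq0; apply/eqP.
rewrite -[RHS]hc addrC; congr (_ + _); rewrite -sumrN; apply: eq_bigr => i _.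
rewrite fmorph_div rmorphN mulrA [j (c ord_max) * _]mulrC divfK //.
by rewrite mulNr opprK.
Qed.

(** [field_degree] is a choice made by [xget]; it is the dimension, and not the default 0, because
    any two bases have the same size. *)
Lemma field_degreeE I (b : I -> L) : spanning b -> independent b ->
  field_degree j = #|I|.
Proof.
move=> hs hi.
have hb : [set d | exists b : 'I_d -> L,
    forall y, exists! c : {ffun 'I_d -> E}, y = \sum_(k < d) j (c k) * b k] #|I|.
  exists (b \o enum_val) => y; have [c hc] := hs y.
  exists [ffun k => c (enum_val k)]; split=> /=.
    rewrite hc (reindex (@enum_val I predT)); last exact/onW_bij/enum_val_bij.
    by apply: eq_bigr => k _; rewrite ffunE.
  move=> c' hc'; apply/ffunP => k; rewrite ffunE; apply/eqP; rewrite -subr_eq0; apply/eqP.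
  rewrite -[c' k](_ : c' (enum_rank (enum_val k)) = _); last by rewrite enum_valK.
  apply: (hi (fun i => c i - c' (enum_rank i))).
  under eq_bigr => i _ do rewrite rmorphB mulrBl.
  rewrite sumrB -hc hc' [X in _ - X](reindex (@enum_val I predT)); last exact/onW_bij/enum_val_bij.
  by apply/eqP; rewrite subr_eq0; apply/eqP; apply: eq_bigr => i _; rewrite enum_valK.
rewrite /field_degree; case: xgetP => [d _ [b' hb']|/(_ #|I|)]; last by move=> /(_ hb).
have hs' : spanning b'.
  by move=> y; have [c [hc _]] := hb' y; exists c.
have hi' : independent b'.
  move=> c hc k; have [c0 [_ hu]] := hb' 0.
  have e1 : c0 = [ffun k => c k].
    by apply: hu; rewrite -[LHS]hc; apply: eq_bigr => i _; rewrite ffunE.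
  have e2 : c0 = [ffun=> 0].
    by apply: hu; rewrite big1 // => i _; rewrite ffunE rmorph0 mul0r.
  by have := congr1 (fun f : {ffun _ -> _} => f k) (etrans (esym e1) e2); rewrite !ffunE.
apply/eqP; rewrite eqn_leq; apply/andP; split; rewrite leqNgt; apply/negP => h.
  by apply: (@linear_dependence _ _ b b') hi'; rewrite ?card_ord.
by apply: (@linear_dependence _ _ b' b) hi; rewrite ?card_ord.
Qed.

Lemma field_degree_gt0 : finite_embedding -> (0 < field_degree j)%N.
Proof.
move=> /basis_exists[d [b [hs hi]]]; rewrite (field_degreeE hs hi) card_ord.
case: d b hs {hi} => // b /(_ 1)[c]; rewrite big_ord0 => /eqP.
by rewrite oner_eq0.
Qed.

Lemma finite_dependence I (z : I -> L) : finite_embedding ->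
  (field_degree j < #|I|)%N ->
  exists2 c : I -> E, \sum_k j (c k) * z k = 0 & exists k, c k != 0.
Proof.
move=> /basis_exists[d [b [hs hi]]]; rewrite (field_degreeE hs hi) => h.
have := @linear_dependence _ _ b z (fun k => hs (z k)) h.
move=> /existsNP[c] /not_implyP[hc /existsNP[k /eqP hk]]; exists c => //.
by exists k.
Qed.

End FiniteEmbedding.

Lemma field_degree_comp (E K L : fieldType) (j1 : {rmorphism E -> K})
    (j2 : {rmorphism K -> L}) : finite_embedding j1 -> finite_embedding j2 ->
  field_degree (j2 \o j1) = (field_degree j1 * field_degree j2)%N.
Proof.
move=> /basis_exists[d1 [b1 [s1 i1]]] /basis_exists[d2 [b2 [s2 i2]]].
rewrite (field_degreeE s1 i1) (field_degreeE s2 i2) !card_ord.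
pose b (k : 'I_d1 * 'I_d2) := j2 (b1 k.1) * b2 k.2.
have hE (c : 'I_d1 * 'I_d2 -> E) : \sum_k (j2 \o j1) (c k) * b k =
    \sum_(k2 < d2) j2 (\sum_(k1 < d1) j1 (c (k1, k2)) * b1 k1) * b2 k2.
  under [RHS]eq_bigr => k2 _ do rewrite rmorph_sum mulr_suml.
  rewrite exchange_big pair_big /=; apply: eq_bigr => -[k1 k2] _ /=.
  by rewrite rmorphM mulrA.
rewrite (@field_degreeE _ _ (j2 \o j1) _ b) ?card_prod ?card_ord //.
  move=> y; have [c2 hc2] := s2 y; have /choice[c1 hc1] := fun k => s1 (c2 k).
  exists (fun k => c1 k.2 k.1); rewrite hE hc2.
  by apply: eq_bigr => k _; rewrite [c2 k]hc1.
move=> c; rewrite hE => /i2 h [k1 k2].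
by have /i1/(_ k1) := h k2.
Qed.

Lemma finite_embedding_in_alg (K : fieldType) (L : fieldExtType K) :
  finite_embedding (in_alg L).
Proof.
exists (\dim {:L}), (fun k => (vbasis {:L})`_k) => y.
exists (fun k => coord (vbasis {:L}) k y).
rewrite [LHS](coord_vbasis (memvf y)); apply: eq_bigr => k _.
by rewrite mulr_algl.
Qed.

(** * Finite subextensions as subsets of a fixed field *)

Section FiniteSubfields.
Variables (E L : fieldType) (j : {rmorphism E -> L}).
Implicit Types (S : set L) (y z : L).

(** The spanning family of [fs_span] may lie outside [S], which makes the finiteness condition easy
    to check. Closure under inverses follows from it ([fs_inv]). Working with subsets of [L] allows
    elements to be adjoined without changing the ambient field. *)
Record finite_subfield S : Prop := {
  fs_img : forall c, S (j c) ;
  fs_add : forall y z, S y -> S z -> S (y + z) ;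
  fs_mul : forall y z, S y -> S z -> S (y * z) ;
  fs_span : exists N (b : 'I_N -> L), forall y, S y ->
    exists c : 'I_N -> E, y = \sum_k j (c k) * b k
}.

Definition algebraic_over_set S z :=
  exists f : {poly L}, [/\ f != 0, forall i, S f`_i & f.[z] = 0].

Lemma family_poly n (c : 'I_n -> E) y :
  \sum_k j (c k) * y ^+ k = 0 -> (exists k, c k != 0) -> algebraicOver j y.
Proof.
move=> h [k hk]; pose f := \sum_(k < n) c k *: 'X^k.
exists f.
  apply: contra hk => /eqP f0; have := congr1 (fun g : {poly E} => g`_k) f0.
  rewrite coef_sum coef0 (bigD1 k) //= coefZ coefXn eqxx mulr1 big1 ?addr0 => [->//|i hi].
  by rewrite coefZ coefXn eq_sym val_eqE (negbTE hi) mulr0.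
rewrite rootE /f rmorph_sum horner_sum; apply/eqP; rewrite -[RHS]h; apply: eq_bigr => i _.
by rewrite /= map_polyZ map_polyXn hornerZ hornerXn.
Qed.

Section Closure.
Variable S : set L.
Hypothesis hS : finite_subfield S.

Lemma fs0 : S 0. Proof. by rewrite -(rmorph0 j); apply: fs_img. Qed.
Lemma fs1 : S 1. Proof. by rewrite -(rmorph1 j); apply: fs_img. Qed.

Lemma fs_opp y : S y -> S (- y).
Proof.
move=> hy; rewrite -mulN1r -(rmorphN1 j); apply: (fs_mul hS) => //; exact: fs_img.
Qed.

Lemma fs_sum (I : Type) (s : seq I) (P : pred I) (F : I -> L) :
  (forall i, P i -> S (F i)) -> S (\sum_(i <- s | P i) F i).
Proof. by move=> h; apply: (big_ind S) => //; [exact: fs0 | exact: fs_add]. Qed.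

Lemma fs_prod (I : Type) (s : seq I) (P : pred I) (F : I -> L) :
  (forall i, P i -> S (F i)) -> S (\prod_(i <- s | P i) F i).
Proof. by move=> h; apply: (big_ind S) => //; [exact: fs1 | exact: fs_mul]. Qed.

Lemma fs_exp y n : S y -> S (y ^+ n).
Proof.
by move=> h; elim: n => [|n IH]; rewrite ?expr0 ?exprS; [exact: fs1 | exact: (fs_mul hS)].
Qed.

Lemma fs_algebraic y : S y -> algebraicOver j y.
Proof.
move=> hy; have [N [b hb]] := fs_span hS.
have : ~ independent j (fun k : 'I_N.+1 => y ^+ k).
  by apply: (@linear_dependence _ _ _ _ _ b); [move=> k; apply/hb/fs_exp | rewrite !card_ord].
move=> /existsNP[c] /not_implyP[hc /existsNP[k /eqP hk]].
by apply: (family_poly hc); exists k.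
Qed.

(** An equation for [y] over [E] with nonzero constant term expresses [1 / y] as a polynomial in
    [y]. *)
Lemma fs_inv y : S y -> S y^-1.
Proof.
move=> hy; have [->|y0] := eqVneq y 0; first by rewrite invr0; apply: fs0.
have [f f0 hf] := fs_algebraic hy.
have {f f0 hf} [f f0 hf] : exists2 f : {poly E}, f`_0 != 0 & root (map_poly j f) y.
  move: f0 hf; have [n] := ubnP (size f); elim: n f => // n IH f hn f0 hf.
  have [h|h] := eqVneq f`_0 0; last by exists f.
  have [g hg] : exists g, f = g * 'X.
    have hr : root f 0 by rewrite rootE horner_coef0 h.
    by have /factor_theorem[g ->] := hr; exists g; rewrite polyC0 subr0.
  have g0 : g != 0 by apply: contraNneq f0 => h0; rewrite hg h0 mul0r.
  apply: (IH g) => //; first by move: hn; rewrite hg size_mulX.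
  by move: hf; rewrite hg rmorphM /= map_polyX rootM rootX (negbTE y0) orbF.
have jf0 : j f`_0 != 0 by rewrite fmorph_eq0.
have -> : y^-1 = - (j f`_0)^-1 * \sum_(i < (size f).-1) j f`_i.+1 * y ^+ i.
  apply: (mulfI y0); rewrite mulfV //.
  have sf : size f = (size f).-1.+1.
    by rewrite prednK // size_poly_gt0; apply: contraNneq f0 => ->; rewrite coef0.
  move: hf => /rootP; rewrite horner_coef size_map_poly sf big_ord_recl /= expr0 mulr1 coef_map.
  move=> /(canRL (addrK _)); rewrite sub0r => /esym h.
  set X := \sum_(i < _) _ in h *; set Y := \sum_(i < _) _.
  have hX : X = y * Y.
    by rewrite mulr_sumr; apply: eq_bigr => i _; rewrite coef_map /= exprS mulrCA.
  by rewrite -[LHS](mulfV jf0) -{1}h hX; field.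
apply: (fs_mul hS); first by rewrite -fmorphV -rmorphN; apply: fs_img.
by apply: fs_sum => i _; apply: (fs_mul hS); [apply: fs_img | apply: fs_exp].
Qed.

(** [f] may be any equation, not only the minimal one: its leading coefficient is invertible in [S],
    so [z ^+ d] reduces to lower powers and their span over [S] is a ring. *)
Lemma fs_adjoin z : algebraic_over_set S z ->
  exists S', [/\ finite_subfield S', S `<=` S' & S' z].
Proof.
move=> [f [f0 hf hz]]; pose d := (size f).-1.
have sf : size f = d.+1 by rewrite prednK // size_poly_gt0.
have d0 : (0 < d)%N.
  rewrite lt0n; apply/eqP => h; move: (sf); rewrite h => /eqP/size_poly1P[c c0 hc].
  by move: hz c0; rewrite hc hornerC => ->; rewrite eqxx.
have lf : f`_d != 0 by rewrite -lead_coef_eq0 lead_coefE sf in f0.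
pose S' := [set y | exists2 h : nat -> L, (forall i, S (h i)) & y = \sum_(i < d) h i * z ^+ i].
have Sadd y1 y2 : S' y1 -> S' y2 -> S' (y1 + y2).
  move=> [h1 s1 ->] [h2 s2 ->]; exists (fun i => h1 i + h2 i) => [i|].
    exact: (fs_add hS).
  by rewrite -big_split; apply: eq_bigr => i _; rewrite mulrDl.
have Sscale c y : S c -> S' y -> S' (c * y).
  move=> sc [h s ->]; exists (fun i => c * h i) => [i|]; first exact: (fs_mul hS).
  by rewrite mulr_sumr; apply: eq_bigr => i _; rewrite mulrA.
have S0 : S' 0.
  by exists (fun=> 0) => [_|]; [exact: fs0 | rewrite big1 // => i _; rewrite mul0r].
have Ssum n (F : 'I_n -> L) : (forall i, S' (F i)) -> S' (\sum_i F i).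
  by move=> h; apply: (big_ind S').
have Spow n : (n < d)%N -> S' (z ^+ n).
  move=> hn; exists (fun i => (i == n)%:R) => [i|].
    by case: eqP => _; [apply: fs1 | apply: fs0].
  rewrite (bigD1 (Ordinal hn)) //= eqxx mul1r big1 ?addr0 // => i hi.
  by rewrite -val_eqE /= in hi; rewrite (negbTE hi) mul0r.
have Sd : S' (z ^+ d).
  have -> : z ^+ d = \sum_(i < d) (- f`_i / f`_d) * z ^+ i.
    move: hz; rewrite horner_coef sf big_ord_recr /= addrC => /(canRL (addrK _)).
    rewrite sub0r => h; apply: (mulfI lf); rewrite h mulr_sumr -sumrN.
    by apply: eq_bigr => i _; rewrite !mulrA [f`_d * _]mulrC mulfK // mulNr.
  apply: Ssum => i; apply: Sscale; last exact: Spow.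
  by apply: (fs_mul hS); [apply: fs_opp | apply: fs_inv].
have Sz y : S' y -> S' (z * y).
  move=> [h s ->]; rewrite mulr_sumr; apply: Ssum => i; rewrite mulrCA -exprS.
  apply: Sscale => //; have [hi|hi] := ltnP i.+1 d; first exact: Spow.
  by have /eqP -> : i.+1 == d by rewrite eqn_leq hi ltn_ord.
have Szn n y : S' y -> S' (z ^+ n * y).
  move=> hy; elim: n => [|n IH]; first by rewrite mul1r.
  by rewrite exprS -mulrA; apply: Sz.
have SS y : S y -> S' y.
  by move=> hy; rewrite -[y]mulr1 -[1](expr0 z); apply: Sscale => //; apply: Spow.
exists S'; split; [|exact: SS|by rewrite -[z]mulr1; apply/Sz/SS/fs1].
split; [| | |].
- by move=> c; apply/SS/(fs_img hS).
- exact: Sadd.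
- move=> y1 y2 [h s ->] hy; rewrite mulr_suml; apply: Ssum => i.
  by rewrite -mulrA; apply: Sscale => //; apply: Szn.
- have [N [b hb]] := fs_span hS.
  apply: (@span_ord _ _ _ _ _ (fun k : 'I_d * 'I_N => b k.2 * z ^+ k.1)).
  move=> y [h s ->]; have /choice[c hc] := fun i => hb _ (s i).
  exists (fun k : 'I_d * 'I_N => c k.1 k.2).
  rewrite -(pair_bigA _ (fun (k1 : 'I_d) (k2 : 'I_N) => j (c k1 k2) * (b k2 * z ^+ k1))) /=.
  by apply: eq_bigr => i _; rewrite hc mulr_suml; apply: eq_bigr => k _; rewrite mulrA.
Qed.

End Closure.

Lemma fs_range : finite_subfield (range j).
Proof.
split.
- by move=> c; exists c.
- by move=> _ _ [c _ <-] [d _ <-]; exists (c + d) => //; rewrite rmorphD.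
- by move=> _ _ [c _ <-] [d _ <-]; exists (c * d) => //; rewrite rmorphM.
- exists 1%N, (fun=> 1) => _ [c _ <-]; exists (fun=> c); by rewrite big_ord1 mulr1.
Qed.

Lemma algebraic_over_setW S z : finite_subfield S -> algebraicOver j z ->
  algebraic_over_set S z.
Proof.
move=> hS [f f0 /rootP hf]; exists (map_poly j f); split=> //.
  by rewrite map_poly_eq0.
by move=> i; rewrite coef_map; apply: (fs_img hS).
Qed.

Lemma fs_adjoin_family n (g : 'I_n -> L) : (forall i, algebraicOver j (g i)) ->
  exists2 S, finite_subfield S & forall i, S (g i).
Proof.
elim: n g => [|n IH] g hg; first by exists (range j); [exact: fs_range | case].
have [S hS Sg] := IH (g \o lift ord_max) (fun i => hg _).
have [S' [hS' SS' S'g]] := fs_adjoin hS (algebraic_over_setW hS (hg ord_max)).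
exists S' => // i; case: (unliftP ord_max i) => [k|] ->; last exact: S'g.
exact/SS'/Sg.
Qed.

End FiniteSubfields.

(** * Extension of valuations *)

Section Subrings.
Variable L : fieldType.
Implicit Types (B I : set L) (x y z : L) (f g : {poly L}).

Record subring_set B : Prop := {
  sr1 : B 1 ;
  srB : forall x y, B x -> B y -> B (x - y) ;
  srM : forall x y, B x -> B y -> B (x * y)
}.

Section Ops.
Variable B : set L.
Hypothesis hB : subring_set B.

Lemma sr0 : B 0. Proof. by rewrite -(subrr 1); apply: (srB hB); apply: sr1. Qed.
Lemma srN x : B x -> B (- x).
Proof. by move=> h; rewrite -sub0r; apply: (srB hB) => //; apply: sr0. Qed.
Lemma srD x y : B x -> B y -> B (x + y).
Proof. by move=> h h'; rewrite -[y]opprK; apply: (srB hB) => //; apply: srN. Qed.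
Lemma srX x n : B x -> B (x ^+ n).
Proof.
by move=> h; elim: n => [|n IH]; [exact: sr1 | rewrite exprS; apply: (srM hB)].
Qed.
Lemma sr_sum (J : Type) (s : seq J) (P : pred J) (F : J -> L) :
  (forall i, P i -> B (F i)) -> B (\sum_(i <- s | P i) F i).
Proof. by move=> h; apply: (big_ind B) => //; [exact: sr0 | exact: srD]. Qed.

Definition adjoin z : set L :=
  [set y | exists2 f : {poly L}, (forall i, B f`_i) & y = f.[z]].

Lemma adjoin_sub z : B `<=` adjoin z.
Proof.
move=> b hb; exists b%:P; last by rewrite hornerC.
by move=> i; rewrite coefC; case: eqP => _ //; apply: sr0.
Qed.

Lemma adjoin_gen z : adjoin z z.
Proof.
exists 'X; last by rewrite hornerX.
by move=> i; rewrite coefX; case: eqP => _; [exact: (sr1 hB) | apply: sr0].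
Qed.

Lemma adjoin_subring z : subring_set (adjoin z).
Proof.
split; first by apply: (@adjoin_sub z); exact: sr1.
  move=> _ _ [f hf ->] [g hg ->]; exists (f - g); last by rewrite hornerD hornerN.
  by move=> i; rewrite coefB; apply: (srB hB).
move=> _ _ [f hf ->] [g hg ->]; exists (f * g); last by rewrite hornerM.
by move=> i; rewrite coefM; apply: sr_sum => k _; apply: (srM hB).
Qed.

End Ops.

(** The generators stay fixed, in [extension_negative] as a uniformizer and [1 / y]. Zorn's lemma
    then runs over subrings alone instead of over pairs of a ring and an ideal. *)
Definition ideal2 (a b : L) B : set L :=
  [set y | exists c d, [/\ B c, B d & y = a * c + b * d]].

Lemma ideal2D a b B x y : subring_set B ->
  ideal2 a b B x -> ideal2 a b B y -> ideal2 a b B (x + y).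
Proof.
move=> hB [c [d [hc hd ->]]] [c' [d' [hc' hd' ->]]]; exists (c + c'), (d + d').
by split; [apply: srD|apply: srD|ring].
Qed.

Lemma ideal2M a b B x y : subring_set B ->
  B x -> ideal2 a b B y -> ideal2 a b B (x * y).
Proof.
move=> hB hx [c [d [hc hd ->]]]; exists (x * c), (x * d).
by split; [apply: (srM hB)|apply: (srM hB)|ring].
Qed.

Lemma ideal2_0 a b B : subring_set B -> ideal2 a b B 0.
Proof. by move=> hB; exists 0, 0; split; [exact: sr0|exact: sr0|ring]. Qed.

Lemma ideal2_sum a b B (J : Type) (s : seq J) (P : pred J) (F : J -> L) :
  subring_set B -> (forall i, P i -> ideal2 a b B (F i)) ->
  ideal2 a b B (\sum_(i <- s | P i) F i).
Proof.
move=> hB h; apply: (big_ind (ideal2 a b B)) => //; first exact: ideal2_0.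
by move=> x y; apply: ideal2D.
Qed.

Lemma ideal2_sub a b B x : subring_set B -> B a -> B b -> ideal2 a b B x -> B x.
Proof.
by move=> hB ha hb [c [d [hc hd ->]]]; apply: srD => //; apply: (srM hB).
Qed.

Definition proper_subring a b B :=
  [/\ subring_set B, B a, B b & ~ ideal2 a b B 1].

Lemma proper_subring_maximal a b B0 : proper_subring a b B0 ->
  exists B, [/\ proper_subring a b B, B0 `<=` B &
    forall B', proper_subring a b B' -> B `<=` B' -> B' `<=` B].
Proof.
move=> hB0.
pose P := [set B | B = set0 \/ (proper_subring a b B /\ B0 `<=` B)].
have [|B [PB hmax]] := @Zorn_bigcup _ P.
  move=> F FP tot.
  have [[X FX X0]|hn] := pselect (exists2 X, F X & X !=set0); last first.
    left; apply/seteqP; split=> // x [X FX Xx].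
    by case: hn; exists X => //; exists x.
  have good Y y : F Y -> Y y -> proper_subring a b Y /\ B0 `<=` Y.
    by move=> FY Yy; have [h|//] := FP _ FY; rewrite h in Yy.
  have two x y : (\bigcup_(X in F) X) x -> (\bigcup_(X in F) X) y ->
      exists Y, [/\ F Y, Y x, Y y & subring_set Y].
    move=> [Y FY Yx] [Z FZ Zy]; have [h|h] := tot _ _ FY FZ.
      by exists Z; split=> //; [exact: h | have [[]] := good _ _ FZ Zy].
    by exists Y; split=> //; [exact: h | have [[]] := good _ _ FY Yx].
  have [x Xx] := X0; have [[hX Xa Xb _] B0X] := good _ _ FX Xx.
  right; split; last by move=> z /B0X Xz; exists X.
  split; last first.
  - move=> [c [d [hc hd h1]]]; have [Y [FY Yc Yd _]] := two _ _ hc hd.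
    by have [[_ _ _ hn] _] := good _ _ FY Yc; apply: hn; exists c, d.
  - by exists X.
  - by exists X.
  split; first by exists X => //; apply: sr1.
    move=> y z hy hz; have [Y [FY Yy Yz hY]] := two _ _ hy hz.
    by exists Y => //; apply: (srB hY).
  move=> y z hy hz; have [Y [FY Yy Yz hY]] := two _ _ hy hz.
  by exists Y => //; apply: (srM hY).
have [hB BB0] : proper_subring a b B /\ B0 `<=` B.
  case: PB => // h; exfalso; apply: (hmax B0); last by right; split.
  rewrite h; split=> // h0; have [/sr1 h1 _ _ _] := hB0.
  exact: h0 h1.
exists B; split=> // B' hB' BB' x B'x; apply: contrapT => nBx.
apply: (hmax B'); last by right; split=> // z /BB0; apply: BB'.
by split=> // h; apply/nBx/h.
Qed.

Section Maximal.
Variables (a b : L) (B : set L).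
Hypothesis hB : proper_subring a b B.
Hypothesis hmax : forall B', proper_subring a b B' -> B `<=` B' -> B' `<=` B.

Let rB : subring_set B. Proof. by case: hB. Qed.
Let Ba : B a. Proof. by case: hB. Qed.
Let Bb : B b. Proof. by case: hB. Qed.
Let I := ideal2 a b B.
Let I1 : ~ I 1. Proof. by case: hB. Qed.

(** By maximality [a] and [b] generate the unit ideal in [B[z]]; writing out 1 there gives a
    polynomial with coefficients in [I]. *)
Lemma maximal_adjoin z : ~ B z -> exists2 g : {poly L}, (forall i, I g`_i) & g.[z] = 1.
Proof.
move=> nz; have : ~ proper_subring a b (adjoin B z).
  by move=> /hmax/(_ (adjoin_sub rB z)) h; apply/nz/h/adjoin_gen.
have hsub := adjoin_sub rB z.
move=> hn; have [c [d [[f hf ->] [g hg ->] h1]]] : ideal2 a b (adjoin B z) 1.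
  apply: contrapT => h; apply: hn; split=> //; [exact: adjoin_subring|exact: hsub|exact: hsub].
exists (a *: f + b *: g); last by rewrite hornerD !hornerZ.
by move=> i; rewrite coefD !coefZ; exists f`_i, g`_i.
Qed.

(** Otherwise a relation [g(1 / s) = 1] for [s = 1 - x], cleared of denominators, puts a power of
    [s] into [I]; but [s], hence every power of it, is 1 modulo [I]. *)
Lemma maximal_unit x : I x -> B (1 - x)^-1.
Proof.
move=> Ix; apply: contrapT => /maximal_adjoin[g hg].
set s := 1 - x; have Bs : B s.
  by apply: (srB rB); [exact: sr1 | apply: ideal2_sub Ix].
have s0 : s != 0.
  by apply/eqP => h; apply: I1; have /eqP := h; rewrite subr_eq0 => /eqP ->.
move=> h1; have Isn : I (s ^+ size g).
  rewrite -[s ^+ _]mulr1 -h1 horner_coef mulr_sumr; apply: ideal2_sum => // i _.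
  rewrite mulrCA mulrC; apply: ideal2M => //; last exact: hg.
  by rewrite exprVn -expfB //; apply: srX.
have Inv n : I (1 - s ^+ n).
  elim: n => [|n IH]; first by rewrite subrr; apply: ideal2_0.
  have -> : 1 - s ^+ n.+1 = (1 - s ^+ n) + s ^+ n * x by rewrite /s exprSr; ring.
  by apply: ideal2D => //; apply: ideal2M => //; apply: srX.
apply: I1; rewrite -(subrK (s ^+ size g) 1); exact: ideal2D rB (Inv _) Isn.
Qed.

(** The descent behind [maximal_valuation_ring]: if neither [z] nor [1 / z] lay in [B], both would
    satisfy a relation with coefficients in [I], and the shorter relation shortens the longer
    one. *)
Lemma maximal_step z x (g g' : {poly L}) : z * x = 1 ->
  (forall i, I g`_i) -> g.[z] = 1 -> (forall i, I g'`_i) -> g'.[x] = 1 ->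
  (size g' <= size g)%N ->
  exists h : {poly L}, [/\ forall i, I h`_i, h.[z] = 1 & (size h < size g)%N].
Proof.
move=> zx Ig gz Ig' g'x hs.
set s := 1 - g'`_0; have Bs := maximal_unit (Ig' 0); rewrite -/s in Bs.
have s0 : s != 0.
  by apply/eqP => /eqP; rewrite subr_eq0 => /eqP h; apply: I1; rewrite h.
have sg' : (0 < size g')%N.
  rewrite size_poly_gt0; apply: contra_eq_neq g'x => ->.
  by rewrite horner0 eq_sym oner_neq0.
pose m := (size g').-1; have em : size g' = m.+1 by rewrite prednK.
(* Multiplying [g'(x) = 1] by [z ^+ m] and dividing by the unit [s] gives the monic relation
   [Q(z) = 0] over [B]; a multiple of [Q] then cancels the leading term of [g]. *)
pose Q : {poly L} := 'X^m - \sum_(i < m) (g'`_i.+1 / s) *: 'X^(m - i.+1).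
have sQ : (size (\sum_(i < m) (g'`_i.+1 / s) *: 'X^(m - i.+1))%R <= m)%N.
  apply: (big_ind (fun f : {poly L} => size f <= m)%N) => [|f1 f2 h1 h2|i _].
  - by rewrite size_poly0.
  - by apply: leq_trans (size_polyD _ _) _; rewrite geq_max h1.
  - apply: leq_trans (size_scale_leq _ _) _; rewrite size_polyXn.
    by rewrite -subSn ?subSS ?leq_subr.
have Qz : Q.[z] = 0.
  rewrite /Q hornerD hornerN hornerXn horner_sum; apply/eqP; rewrite subr_eq0; apply/eqP.
  apply: (mulfI s0); move: g'x; rewrite horner_coef em big_ord_recl expr0 mulr1.
  move=> /(canRL (addKr _)); rewrite addrC -/s => hS; rewrite -{1}hS.
  rewrite mulr_suml mulr_sumr; apply: eq_bigr => i _; rewrite hornerZ hornerXn.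
  rewrite mulrA [s * _]mulrC divfK // -mulrA; congr (_ * _).
  by rewrite lift0 -(congr1 (fun k => z ^+ k) (subnK (ltn_ord i))) exprD mulrCA -exprMn [x * z]mulrC zx expr1n mulr1.
have BQ i : B Q`_i.
  rewrite coefB coefXn coef_sum; apply: (srB rB).
    by case: eqP => _; [exact: (sr1 rB) | apply: sr0].
  apply: sr_sum => // k _; rewrite coefZ; apply: (srM rB).
    by apply: (srM rB) => //; apply: ideal2_sub (Ig' _).
  by rewrite coefXn; case: eqP => _; [exact: (sr1 rB) | apply: sr0].
pose n := (size g - size g')%N.
exists (g - lead_coef g *: ('X^n * Q)); split.
- move=> i; rewrite coefB -mulN1r coefZ; apply: ideal2D => //; first exact: Ig.
  rewrite mulrCA mulrC [-1 * _]mulrC; apply: ideal2M => //; last exact: Ig.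
  apply: (srM rB); last by apply: srN => //; exact: (sr1 rB).
  rewrite coefXnM; case: ifP => _ //; exact: sr0.
- by rewrite hornerD hornerN hornerZ hornerM Qz mulr0 mulr0 subr0.
have sg : (0 < size g)%N by apply: leq_trans hs.
rewrite -(prednK sg) ltnS; apply/leq_sizeP => k hk.
rewrite coefB coefZ coefXnM; have [hkn|hkn] := ltnP k n.
  by move: hkn hk; rewrite /n em; clear -sg sg'; case: (size g) sg => // u _ /=; lia.
have eqk : (k - n = m + (k - (size g).-1))%N.
  by move: hk hkn hs; rewrite /n em; clear -sg; case: (size g) sg => // u _ /=; lia.
rewrite eqk coefB coefXn; move: hk; rewrite leq_eqVlt => /orP[/eqP <-|hk].
  by rewrite subnn addn0 eqxx (nth_default _ sQ) subr0 mulr1 subrr.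
have hkg : (size g <= k)%N by rewrite -(prednK sg).
rewrite (nth_default _ hkg) (nth_default _ (leq_trans sQ (leq_addr _ _))).
rewrite -[X in _ == X]addn0 eqn_add2l subn_eq0 leqNgt hk.
by rewrite subrr mulr0 subrr.
Qed.

Lemma maximal_valuation_ring z x : z * x = 1 -> B z \/ B x.
Proof.
move=> zx; apply: contrapT => /not_orP[/maximal_adjoin[g0 h1 h2] /maximal_adjoin[g0' h3 h4]].
have [n] := ubnP (size g0 + size g0'); elim: n z x zx g0 g0' h1 h2 h3 h4 => // n IH.
move=> z x zx g g' h1 h2 h3 h4 hn; have [hs|hs] := leqP (size g') (size g).
  have [h [k1 k2 k3]] := maximal_step zx h1 h2 h3 h4 hs.
  by apply: (IH z x zx h g') => //; rewrite -ltnS; apply: leq_trans hn; rewrite ltnS ltn_add2r.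
have xz : x * z = 1 by rewrite mulrC.
have [h [k1 k2 k3]] := maximal_step xz h3 h4 h1 h2 (ltnW hs).
by apply: (IH z x zx g h) => //; rewrite -ltnS; apply: leq_trans hn; rewrite ltnS ltn_add2l.
Qed.

End Maximal.
End Subrings.

(** The image of [mu] is a nonzero subgroup of the integers, generated by its least positive element
    [g]. *)
Lemma normalize_hom (L : fieldType) (mu : L -> int) (b : L) :
  (forall x y, x != 0 -> y != 0 -> mu (x * y) = mu x + mu y) ->
  b != 0 -> 0 < mu b ->
  exists2 g : nat, (0 < g)%N & (forall x, x != 0 -> (g%:Z %| mu x)%Z) /\
    exists2 x, x != 0 & mu x = g%:Z.
Proof.
move=> muM b0 hb.
have mu1 : mu 1 = 0.
  have := muM 1 1 (oner_neq0 L) (oner_neq0 L); rewrite mulr1 => /eqP.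
  by rewrite -subr_eq0 opprD addNKr oppr_eq0 => /eqP.
have muV x : x != 0 -> mu x^-1 = - mu x.
  move=> x0; apply/eqP; rewrite -addr_eq0 addrC -muM ?invr_eq0 //.
  by rewrite mulfV // mu1.
have muX x n : x != 0 -> mu (x ^+ n) = mu x * n%:Z.
  move=> x0; elim: n => [|n IH]; first by rewrite mu1 mulr0.
  by rewrite exprS muM ?expf_neq0 // IH -addn1 PoszD mulrDr mulr1 addrC.
pose P g := `[< (0 < g)%N /\ exists2 x, x != 0 & mu x = g%:Z >].
have exP : exists g, P g.
  by exists `|mu b|%N; apply/asboolP; split; [lia | exists b => //; lia].
case: (ex_minnP exP) => g /asboolP[g0 [x x0 hx]] gmin; exists g => //.
split; last by exists x.
move=> y y0; apply/dvdz_mod0P.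
have g0' : g%:Z != 0 by rewrite -lt0n in g0 *; lia.
have hmod := modz_ge0 (mu y) g0'; have hlt := ltz_pmod (mu y) (_ : 0 < g%:Z).
have {hlt} hlt : (mu y %% g)%Z < g%:Z by apply: hlt; lia.
have [z z0 hz] : exists2 z, z != 0 & mu z = (mu y %% g)%Z.
  have hq : (mu y %% g)%Z = mu y - (mu y %/ g)%Z * g%:Z by [].
  case: (intP (mu y %/ g)%Z) hq => [|n|n] ->.
  - by exists y; rewrite // mul0r subr0.
  - exists (y * (x ^+ n.+1)^-1); first by rewrite mulf_neq0 ?invr_eq0 ?expf_neq0.
    by rewrite muM ?invr_eq0 ?expf_neq0 // muV ?expf_neq0 // muX // hx mulrC.
  - exists (y * x ^+ n.+1); first by rewrite mulf_neq0 ?expf_neq0.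
    by rewrite muM ?expf_neq0 // muX // hx mulNr opprK mulrC.
apply/eqP; apply: contraTT isT => hn.
have : (g <= `|mu z|)%N by apply: gmin; apply/asboolP; split; [|exists z => //]; lia.
by lia.
Qed.

(** * From a valuation ring to a normalized discrete valuation *)

Section ValuationRing.
Variables (E L : fieldType) (j : {rmorphism E -> L}) (v : E -> \bar int).
Hypotheses (hfin : finite_embedding j) (hnv : normalized_valuation v).
Variable W : set L.
Hypotheses (rW : subring_set W)
  (WV : forall z x, z * x = 1 -> W z \/ W x)
  (jW : forall c, (0 <= v c)%E -> W (j c)).
Variable a : E.
Hypotheses (va : v a = 1%E) (aW : ~ W (j a)^-1).

Let hv : valuation v := normalized_valuationW hnv.

Let ja0 : j a != 0. Proof. by rewrite fmorph_eq0; apply: (val_neq0 hv va). Qed.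

Definition ring_unit (z : L) := [/\ z != 0, W z & W z^-1].

Lemma unitM z x : ring_unit z -> ring_unit x -> ring_unit (z * x).
Proof.
move=> [z0 h1 h2] [x0 h3 h4]; split; first exact: mulf_neq0.
  exact: (srM rW).
by rewrite invfM; apply: (srM rW).
Qed.

Lemma unitV z : ring_unit z -> ring_unit z^-1.
Proof. by move=> [z0 h1 h2]; split; rewrite ?invr_eq0 ?invrK. Qed.

Lemma unit1 : ring_unit 1.
Proof. by split; rewrite ?invr1 ?oner_neq0 //; exact: (sr1 rW). Qed.

Lemma unitX z n : ring_unit z -> ring_unit (z ^+ n).
Proof.
by move=> h; elim: n => [|n IH]; [exact: unit1 | rewrite exprS; apply: unitM].
Qed.

Definition nonunit (z : L) := z = 0 \/ ~ W z^-1.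

Lemma nonunitD z x : nonunit z -> nonunit x -> nonunit (z + x).
Proof.
have main u t : u != 0 -> t != 0 -> W (t / u) -> ~ W u^-1 -> u + t != 0 -> ~ W (u + t)^-1.
  move=> u0 t0 h nu ut0 hW; apply: nu.
  have -> : u^-1 = (1 + t / u) * (u + t)^-1 by field; rewrite u0 ut0.
  by apply: (srM rW) => //; apply: srD => //; exact: (sr1 rW).
move=> [->|nz]; first by rewrite add0r.
move=> [->|nx]; first by rewrite addr0; right.
have [h|zx0] := eqVneq (z + x) 0; first by left.
have [h|z0] := eqVneq z 0; first by rewrite h add0r; right.
have [h|x0] := eqVneq x 0; first by rewrite h addr0; right.
right; have [h|h] : W (x / z) \/ W (z / x) by apply: WV; field; rewrite z0 x0.
  exact: main.
by rewrite addrC in zx0 *; apply: main.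
Qed.

Lemma dominating_term (I : finType) (F : I -> L) (k0 : I) : F k0 != 0 ->
  exists k, F k != 0 /\ forall i, W (F i / F k).
Proof.
move=> h0.
have : exists k, F k != 0 /\ forall i, i \in enum I -> W (F i / F k).
  elim: (enum I) => [|i s [k [hk hs]]]; first by exists k0.
  have [h|hi] := eqVneq (F i) 0.
    exists k; split=> // i'; rewrite inE => /orP[/eqP ->|]; last exact: hs.
    by rewrite h mul0r; apply: sr0.
  have [h|h] : W (F i / F k) \/ W (F k / F i) by apply: WV; field; rewrite hi hk.
    by exists k; split=> // i'; rewrite inE => /orP[/eqP ->|]; [|exact: hs].
  exists i; split=> // i'; rewrite inE => /orP[/eqP ->|/hs h'].
    by rewrite divff //; exact: (sr1 rW).
  have -> : F i' / F i = (F i' / F k) * (F k / F i) by field; rewrite hi hk.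
  exact: (srM rW).
by move=> [k [hk hs]]; exists k; split=> // i; apply: hs; rewrite mem_enum.
Qed.

Lemma unit_val0 c : v c = 0%E -> ring_unit (j c).
Proof.
move=> h; split; first by rewrite fmorph_eq0; exact: (val_neq0 hv h).
  by apply: jW; rewrite h.
by rewrite -fmorphV; apply: jW; rewrite (val_eq_inv hv h) oppr0.
Qed.

Lemma val_eq_expz m : v (a ^ m) = m%:E.
Proof.
case: (intP m) => [|n|n].
- by rewrite expr0z (val1 hv).
- by rewrite -exprnP (val_eq_exp hv _ va) natz.
- by rewrite -exprnN (val_eq_inv hv (val_eq_exp hv _ va)) natz.
Qed.

Lemma unit_of_val c m : v c = m%:E -> ring_unit (j c * j a ^ (- m)).
Proof.
move=> h; rewrite -fmorphXz -rmorphM; apply: unit_val0.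
by rewrite (val_eq_mul hv h (val_eq_expz _)) subrr.
Qed.

Let d := field_degree j.

(** The value group of [W] is torsion over that of [v]: the powers of [z] up to [d] satisfy a linear
    relation over [E], two terms of which have the same size; their quotient is a unit, and its
    coefficient in [E] may be replaced by a power of [a]. *)
Lemma power_unit z : z != 0 -> exists k m, [/\ (0 < k <= d)%N & ring_unit (z ^+ k * j a ^ m)].
Proof.
move=> z0.
have [|c hc [k0 hk0]] := finite_dependence (fun k : 'I_d.+1 => z ^+ k) hfin.
  by rewrite card_ord.
pose F k := j (c k) * z ^+ k.
have F0 : F k0 != 0 by rewrite mulf_neq0 ?fmorph_eq0 ?expf_neq0.
have [k [hk Wk]] := dominating_term F0.
have ck : c k != 0 by apply: contraNneq hk => h; rewrite /F h rmorph0 mul0r.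
(* If [F k] were the only term of maximal size, the other quotients by [F k] would add up to a
   nonunit; but they add up to [-1]. *)
have [i [ik hi]] : exists i, i != k /\ ring_unit (F i / F k).
  apply: contrapT => hn.
  have hN i : i != k -> nonunit (F i / F k).
    move=> ik; have [h|h] := eqVneq (F i / F k) 0; first by left.
    by right=> h'; apply: hn; exists i; split=> //; split.
  have : nonunit (\sum_(i | i != k) F i / F k).
    by apply: (big_ind nonunit) => //; [left | exact: nonunitD].
  have -> : \sum_(i | i != k) F i / F k = -1.
    have : \sum_i F i / F k = 0 by rewrite -mulr_suml /F hc mul0r.
    by rewrite (bigD1 k) //= divff // => /eqP; rewrite addrC addr_eq0 => /eqP.
  case=> [/eqP|]; first by rewrite oppr_eq0 oner_eq0.
  by apply; rewrite invrN1; apply: srN => //; exact: (sr1 rW).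
have ci : c i != 0.
  have [+ _ _] := hi; apply: contraNneq => h; by rewrite /F h rmorph0 !mul0r.
have cji : j (c i) != 0 by rewrite fmorph_eq0.
have cjk : j (c k) != 0 by rewrite fmorph_eq0.
have key u (b : E) : (0 < u <= d)%N -> b != 0 ->
    ring_unit (z ^+ u * j b) -> exists k m, [/\ (0 < k <= d)%N & ring_unit (z ^+ k * j a ^ m)].
  move=> hu b0 hb; have [l hl] := valP hv b0; exists u, l; split=> //.
  have := unitM hb (unitV (unit_of_val hl)).
  have jb0 : j b != 0 by rewrite fmorph_eq0.
  rewrite invfM invr_expz opprK mulrA.
  by have -> : z ^+ u * j b / j b * j a ^ l = z ^+ u * j a ^ l by rewrite mulfK.
have [lt|lt|h] := ltngtP i k; last by rewrite -val_eqE /= h eqxx in ik.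
  apply: (key (k - i)%N (c k / c i)) => //.
  - by rewrite subn_gt0 lt /= (leq_trans (leq_subr _ _)) // -ltnS.
  - by rewrite mulf_neq0 ?invr_eq0.
  have := unitV hi; rewrite /F fmorph_div.
  have -> : z ^+ k = z ^+ (k - i) * z ^+ i by rewrite -exprD subnK // ltnW.
  have zi0 : z ^+ i != 0 by rewrite expf_neq0.
  have zki0 : z ^+ (k - i) != 0 by rewrite expf_neq0.
  by have -> : (j (c i) * z ^+ i / (j (c k) * (z ^+ (k - i) * z ^+ i)))^-1
    = z ^+ (k - i) * (j (c k) / j (c i)) by field; rewrite cji cjk zi0 zki0.
apply: (key (i - k)%N (c i / c k)) => //.
- by rewrite subn_gt0 lt /= (leq_trans (leq_subr _ _)) // -ltnS.
- by rewrite mulf_neq0 ?invr_eq0.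
move: hi; rewrite /F fmorph_div.
have -> : z ^+ i = z ^+ (i - k) * z ^+ k by rewrite -exprD subnK // ltnW.
have zk0 : z ^+ k != 0 by rewrite expf_neq0.
by have -> : j (c i) * (z ^+ (i - k) * z ^+ k) / (j (c k) * z ^+ k)
  = z ^+ (i - k) * (j (c i) / j (c k)) by field; rewrite cjk zk0.
Qed.

Let D := (d`!)%N.

(** The exponent in [power_unit] depends on [z] but is at most [d], so it divides the factorial [D],
    which serves for all [z] at once. *)
Lemma factorial_power_unit z : exists m, z != 0 -> ring_unit (z ^+ D * j a ^ (- m)).
Proof.
have [->|z0] := eqVneq z 0; first by exists 0.
have [k [m [/andP[k0 kd] h]]] := power_unit z0.
have kD : (k %| D)%N by apply: dvdn_fact; rewrite k0.
exists (- (m * (D %/ k)%N%:Z)) => _; rewrite opprK.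
have := unitX (D %/ k) h; rewrite exprMn -exprM mulnC divnK //.
by rewrite [(_ ^ _) ^+ _]exprnP exprz_exp.
Qed.

Lemma unit_exp0 m : ring_unit (j a ^ m) -> m = 0.
Proof.
have aux n : ~ W (j a ^- n.+1).
  move=> h; apply: aW; have -> : (j a)^-1 = j a ^+ n * j a ^- n.+1.
    by rewrite exprS invfM mulrCA mulfV ?mulr1 // expf_neq0.
  by apply: (srM rW) => //; apply: srX => //; apply: jW; rewrite va.
case: (intP m) => // n [_ h1 h2]; exfalso; apply: (aux n) => //.
Qed.

(** Let [mu z] be the exponent for which [z ^+ D] and [j a ^ mu z] differ by a unit; [unit_exp0]
    makes it unique. This is a homomorphism that equals [D * v] on [E], and [W] is where it is
    nonnegative, whence the ultrametric inequality. Dividing by the generator [g] of its image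
    normalizes it, with ramification index [D / g]. *)
Lemma extension_of_valuation_ring :
  exists w, [/\ normalized_valuation w, lies_over j v w & forall z, ~ W z -> (w z < 0)%E].
Proof.
have /choice[mu hmu] := factorial_power_unit.
have mu_uniq z m : z != 0 -> ring_unit (z ^+ D * j a ^ (- m)) -> mu z = m.
  move=> z0 h; have := unitM (unitV h) (hmu z z0).
  have zD : z ^+ D != 0 by rewrite expf_neq0.
  rewrite invfM invr_expz opprK mulrACA mulVf // mul1r -expfzDr //.
  by move=> /unit_exp0 /eqP; rewrite subr_eq0 => /eqP.
have muM x y : x != 0 -> y != 0 -> mu (x * y) = mu x + mu y.
  move=> x0 y0; apply: mu_uniq; first exact: mulf_neq0.
  have := unitM (hmu x x0) (hmu y y0).
  by rewrite mulrACA -expfzDr // exprMn opprD.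
have mu_j c m : v c = m%:E -> mu (j c) = m * D%:Z.
  move=> h; apply: mu_uniq; first by rewrite fmorph_eq0; exact: (val_neq0 hv h).
  have := unitX D (unit_of_val h); rewrite exprMn.
  by rewrite (exprnP (j a ^ (- m))) exprz_exp mulNr.
have muW z : z != 0 -> W z <-> 0 <= mu z.
  move=> z0; have Wexp m : 0 <= m -> W (j a ^ m).
    by case: m => // m _; rewrite -exprnP; apply: srX => //; apply: jW; rewrite va.
  have [_ h1 h2] := hmu z z0; have za : j a ^ mu z != 0 by rewrite expfz_neq0.
  split.
    move=> Wz; rewrite leNgt; apply/negP => hlt.
    have h3 : W (j a ^ (mu z)).
      have -> : j a ^ mu z = z ^+ D * (z ^+ D * j a ^ (- mu z))^-1.
        by rewrite invfM invr_expz opprK mulrA mulfV ?mul1r // expf_neq0.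
      by apply: (srM rW) => //; apply: srX.
    have : mu z = 0; last by move=> h; rewrite h ltxx in hlt.
    apply: unit_exp0; split=> //.
    by rewrite invr_expz; apply: Wexp; rewrite oppr_ge0 ltW.
  move=> hge.
  have h3 : W (z ^+ D).
    rewrite -[z ^+ D](divfK za) invr_expz.
    by apply: (srM rW) => //; exact: Wexp.
  have [//|Wzi] : W z \/ W z^-1 by apply: WV; rewrite mulfV.
  have D0 : (0 < D)%N by exact: fact_gt0.
  have -> : z = z^-1 ^+ D.-1 * z ^+ D.
    by rewrite -{2}(prednK D0) exprSr mulrA -exprMn mulVf // expr1n mul1r.
  by apply: (srM rW) => //; apply: srX.
have mua : mu (j a) = D%:Z by rewrite (mu_j _ 1) ?mul1r.
have D0 : (0 < D)%N by exact: fact_gt0.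
have [|g g0 [gdvd [x1 x10 hx1]]] := normalize_hom muM ja0; first by rewrite mua.
have g0' : g%:Z != 0 by lia.
pose w z : \bar int := if z == 0 then +oo%E else ((mu z %/ g)%Z)%:E.
have muE z : z != 0 -> mu z = (mu z %/ g)%Z * g%:Z by move=> /gdvd/divzK.
have wW z : (w z < 0)%E = (z != 0) && (mu z < 0).
  rewrite /w; case: eqP => [//|/eqP z0] /=; rewrite lte_fin [in RHS]muE //.
  by rewrite pmulr_llt0 //; lia.
exists w; split; last first.
- move=> z nz; rewrite wW; have z0 : z != 0.
    by apply: contra_not_neq nz => ->; apply: sr0.
  by rewrite z0 ltNge; apply/negP => /(muW z z0).
- have gD : (g %| D)%N by have := gdvd _ ja0; rewrite mua.
  exists (D %/ g)%N; first by rewrite divn_gt0 // dvdn_leq.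
  move=> z; rewrite /w fmorph_eq0; have [->|z0] := eqVneq z 0.
    by rewrite (val0 hv) gt0_muley // lte_fin ltz_nat divn_gt0 // dvdn_leq.
  have [m hm] := valP hv z0; rewrite (mu_j _ _ hm) hm; congr EFin.
  by rewrite -[in LHS](divnK gD) PoszM mulrA mulzK // mulrC.
split.
- by rewrite /w eqxx.
- by move=> z z0; rewrite /w (negbTE z0).
- move=> y z; rewrite /w mulf_eq0; case: (eqVneq y 0) => [_|y0] /=.
    by case: ifP => _; rewrite ?addye.
  case: (eqVneq z 0) => [_|z0] /=; first by rewrite addey.
  rewrite -EFinD; congr EFin; apply: (mulIf g0').
  by rewrite mulrDl -!muE ?mulf_neq0 // muM.
- move=> y z.
  have [->|y0] := eqVneq y 0; first by rewrite add0r {1}/w eqxx minye.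
  have [->|z0] := eqVneq z 0; first by rewrite addr0 [X in Order.min _ X]/w eqxx miney.
  have main s u : s != 0 -> u != 0 -> mu s <= mu u -> (w s <= w (s + u)%R)%E.
    move=> s0 u0 su; rewrite /w (negbTE s0); case: ifP => [_|/negbT su0]; first by rewrite leey.
    rewrite lee_fin -(@ler_pM2r _ g%:Z); last by lia.
    rewrite -!muE //; have us0 : u / s != 0 by rewrite mulf_neq0 ?invr_eq0.
    have h1 : W (u / s).
      apply/(muW _ us0); have := muM _ _ us0 s0; rewrite divfK // => h.
      by rewrite -(lerD2r (mu s)) add0r -h.
    have sus : s + u = s * (1 + u / s) by rewrite mulrDr mulr1 mulrC divfK.
    have h2 : 1 + u / s != 0 by apply: contraNneq su0 => h; rewrite sus h mulr0.
    rewrite sus muM // lerDl; apply/(muW _ h2).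
    by apply: srD => //; exact: (sr1 rW).
  rewrite ge_min; have [h|h] := leP (mu y) (mu z); first by rewrite main.
  by rewrite (addrC y) (main z y) ?orbT // ltW.
- exists x1; rewrite /w (negbTE x10) hx1 divzz; by case: eqP g0' => // ->.
Qed.

End ValuationRing.

(** * Gauss's lemma for a valuation *)

Section Gauss.
Variables (E : fieldType) (v : E -> \bar int).
Hypothesis hv : valuation v.
Implicit Types (f g h : {poly E}).

Lemma gauss_index f : f != 0 -> exists m, [/\ f`_m != 0,
  forall i, (v f`_m <= v f`_i)%E & forall i, (m < i)%N -> (v f`_m < v f`_i)%E].
Proof.
move=> f0.
have key n : (forall i, (i < n)%N -> f`_i = 0) \/ exists m, [/\ f`_m != 0,
    forall i, (i < n)%N -> (v f`_m <= v f`_i)%E &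
    forall i, (i < n)%N -> (m < i)%N -> (v f`_m < v f`_i)%E].
  elim: n => [|n [IH|[m [hm h1 h2]]]]; first by left.
    have [h|h] := eqVneq f`_n 0.
      by left=> i; rewrite ltnS leq_eqVlt => /orP[/eqP ->|/IH].
    right; exists n; split=> // i; rewrite ltnS leq_eqVlt => /orP[/eqP ->|hi] //.
    - by rewrite (IH i hi) (val0 hv) leey.
    - by rewrite ltnn.
    - by rewrite ltnNge ltnW.
  have [h|h] := leP (v f`_n) (v f`_m).
    right; exists n; split=> [|i|i].
    - by apply: contraNneq hm => h'; move: h; rewrite h' (val0 hv) leye_eq (val_eqy hv).
    - by rewrite ltnS leq_eqVlt => /orP[/eqP -> //|/h1]; apply: le_trans.
    - by rewrite ltnS => hin; rewrite ltnNge hin.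
  right; exists m; split=> // i; rewrite ltnS leq_eqVlt => /orP[/eqP ->|hi] //.
  - exact: ltW.
  - exact: h1.
  - exact: h2.
have sf : (0 < size f)%N by rewrite size_poly_gt0.
have [h|[m [hm h1 h2]]] := key (size f).
  by move: f0; rewrite -lead_coef_eq0 lead_coefE h ?eqxx // prednK.
have out i : (size f <= i)%N -> (v f`_m < v f`_i)%E.
  by move=> hi; rewrite [f`_i]nth_default // (val0 hv) ltey (val_eqy hv).
exists m; split=> // i.
  by have [/h1 //|/out/ltW] := ltnP i (size f).
by have [/h2 h|/out h _] := ltnP i (size f).
Qed.

(** Take in each factor the last index of minimal valuation: at the sum of these indices the
    coefficient of the product has valuation the sum of the two minima. Both minima are at most 0,
    the factors being monic, and their sum is nonnegative. *)
Lemma gauss_lemma f h : f \is monic -> h \is monic ->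
  (forall i, (0 <= v (f * h)`_i)%E) -> forall i, (0 <= v f`_i)%E.
Proof.
move=> mf mh hfh i.
have [m [m0 hm hm']] := gauss_index (monic_neq0 mf).
have [k [k0 hk hk']] := gauss_index (monic_neq0 mh).
have fm : (v f`_m <= 0)%E.
  by have := hm (size f).-1; rewrite -lead_coefE (monicP mf) (val1 hv).
have hk0 : (v h`_k <= 0)%E.
  by have := hk (size h).-1; rewrite -lead_coefE (monicP mh) (val1 hv).
have hlt : (m < (m + k).+1)%N by rewrite ltnS leq_addr.
have hsum : v (f * h)`_(m + k) = (v f`_m + v h`_k)%E.
  rewrite coefM (val_lt_sum hv (i0 := Ordinal hlt)) /= ?addKn.
  - by rewrite (valM hv).
  - by rewrite mulf_neq0.
  move=> s hs; rewrite !(valM hv); have [x hx] := valP hv m0; have [y hy] := valP hv k0.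
  have [h1|h1|h1] := ltngtP s m; last by rewrite -val_eqE /= h1 eqxx in hs.
    have h2 : (k < m + k - s)%N by rewrite ltn_subRL ltn_add2r.
    by rewrite hx lee_ltD // -?hx ?hm ?hk'.
  by rewrite hy lte_leD // -?hy ?hk ?hm'.
apply: le_trans (hm i); have := hfh (m + k)%N; rewrite hsum.
move: fm hk0; have [x ->] := valP hv m0; have [y ->] := valP hv k0.
by rewrite !lee_fin; lia.
Qed.

End Gauss.

(** * Integral elements and negative extensions *)

Section ExtendValuation.
Variables (E L : fieldType) (j : {rmorphism E -> L}).
Hypothesis hfin : finite_embedding j.
Implicit Types (y : L).

Lemma finite_algebraic y : algebraicOver j y.
Proof.
have [|c hc hk] := finite_dependence (fun k : 'I_(field_degree j).+1 => y ^+ k) hfin.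
  by rewrite card_ord.
exact: family_poly hc hk.
Qed.

Lemma minimal_poly_exists y : exists f : {poly E}, [/\ f \is monic,
  root (map_poly j f) y & forall g, root (map_poly j g) y -> (f %| g)%R].
Proof.
have [g g0 hg] := finite_algebraic y.
pose P n := `[< exists f : {poly E}, [/\ f != 0, size f = n & root (map_poly j f) y] >].
have exP : exists n, P n by exists (size g); apply/asboolP; exists g.
case: (ex_minnP exP) => n /asboolP[f [f0 sf hf]] nmin.
exists ((lead_coef f)^-1 *: f); split.
- by rewrite monicE lead_coefZ mulVf // lead_coef_eq0.
- by rewrite map_polyZ rootZ // fmorph_eq0 invr_eq0 lead_coef_eq0.
move=> h hh; rewrite dvdpZl ?invr_eq0 ?lead_coef_eq0 // /dvdp.
apply: contraT => r0.
have : (n <= size (h %% f)%R)%N.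
  apply: nmin; apply/asboolP; exists (h %% f)%R; split=> //.
  move: hh; rewrite {1}(divp_eq h f) !rootE rmorphD rmorphM hornerD hornerM.
  by have /rootP -> := hf; rewrite mulr0 add0r.
by rewrite leqNgt -sf ltn_modp f0.
Qed.

Definition integral_over_val (v : E -> \bar int) y := exists f : {poly E},
  [/\ f \is monic, forall i, (0 <= v f`_i)%E & root (map_poly j f) y].

Lemma integral_minimal_poly v f y : valuation v -> f \is monic ->
  (forall g, root (map_poly j g) y -> (f %| g)%R) -> integral_over_val v y ->
  forall i, (0 <= v f`_i)%E.
Proof.
move=> hv mf fmin [g [mg hg /fmin/dvdpP[h gE]]].
apply: (gauss_lemma hv (h := h)) => //; last by move=> i; rewrite mulrC -gE.
by rewrite -(monicMl _ mf) mulrC -gE.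
Qed.

Lemma neg_coef (w : L -> \bar int) (f : {poly E}) y : valuation w -> f \is monic ->
  root (map_poly j f) y -> (w y < 0)%E -> exists i, (w (j f`_i) < 0)%E.
Proof.
move=> hw mf /rootP hr wy; apply: contrapT => hn.
have hge i : (0%:E <= w (j f`_i))%E by rewrite leNgt; apply/negP => h; apply: hn; exists i.
have y0 : y != 0 by apply: contraTneq wy => ->; rewrite (val0 hw).
have [k hk] := valP hw y0; move: wy; rewrite hk lte_fin => k0.
have sf : size f = (size f).-1.+1 by rewrite prednK // size_poly_gt0 monic_neq0.
set n := (size f).-1 in sf.
have fn : f`_n = 1 by have := monicP mf; rewrite lead_coefE.
move: hr; rewrite horner_coef size_map_poly sf big_ord_recr /= coef_map fn /= rmorph1 mul1r.
rewrite addrC => /(canRL (addrK _)); rewrite sub0r => h.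
have h1 : w (y ^+ n) = (k *+ n)%:E by exact: val_eq_exp.
have h2 : ((k *+ n)%:E < w (y ^+ n)%R)%E.
  rewrite [in X in (_ < X)%E]h (valN hw); apply: (val_gt_sum hw) => [|i _]; first exact: ltry.
  rewrite coef_map; apply: lt_le_trans (val_ge_mul hw (hge i) (_ : ((k *+ i)%:E <= _)%E)).
    have := ltn_ord i; rewrite add0r lte_fin !mulrnZ => hi.
    by rewrite ltr_nM2l.
  by rewrite (val_eq_exp hw _ hk).
by rewrite h1 ltxx in h2.
Qed.

Section Normalized.
Variable v : E -> \bar int.
Hypothesis hnv : normalized_valuation v.
Let hv : valuation v := normalized_valuationW hnv.

(* The valuation ring is a maximal subring containing [1 / y] in which [1 / y]
   and the uniformizer generate a proper ideal. *)
Lemma extension_negative y : ~ integral_over_val v y ->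
  exists w, [/\ normalized_valuation w, lies_over j v w & (w y < 0)%E].
Proof.
move=> hint.
have y0 : y != 0.
  apply: contra_not_neq hint => ->; exists 'X; split; first exact: monicX.
    by move=> i; rewrite coefX; case: eqP => _; rewrite ?(val1 hv) ?(val0 hv).
  by rewrite map_polyX rootX.
have [a va] := nval_norm hnv.
pose O : set L := [set z | exists2 c, (0 <= v c)%E & z = j c].
have rO : subring_set O.
  split; first by exists 1; rewrite ?(val1 hv) ?rmorph1.
    move=> _ _ [c hc ->] [d hd ->]; exists (c - d); rewrite ?rmorphB //.
    exact: (valB hv).
  move=> _ _ [c hc ->] [d hd ->]; exists (c * d); rewrite ?rmorphM //.
  by rewrite -[0%E]adde0 (valM hv) leeD.
have Oa : O (j a) by exists a; rewrite ?va.
have proper0 : proper_subring (j a) y^-1 (adjoin O y^-1).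
  split; [exact: adjoin_subring|exact: (adjoin_sub rO)|exact: adjoin_gen|].
  move=> [_ [_ [[f hf ->] [g hg ->] h1]]]; apply: hint.
  (* The supposed relation becomes [h(1 / y) = 1], where the constant coefficient [c0] of [h] has
     positive valuation. Multiplied by [y ^+ m] and divided by the unit [1 - c0], it is a monic
     integral equation for [y]. *)
  pose h := j a *: f + 'X * g.
  have hO i : O h`_i.
    rewrite coefD coefZ; apply: srD => //; first exact: (srM rO).
    by rewrite coefXM; case: ifP => _; [exact: sr0|].
  have h0 : exists2 c, (0 < v c)%E & h`_0 = j c.
    have [c hc ec] := hf 0%N; exists (a * c).
      by rewrite (valM hv) va; case: (v c) hc => [r||] //; rewrite lee_fin lte_fin; lia.
    by rewrite coefD coefZ coefXM /= addr0 ec rmorphM.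
  have hy : h.[y^-1] = 1 by rewrite hornerD hornerZ hornerM hornerX -h1.
  have /choice[c hc] : forall i, exists c, (0 <= v c)%E /\ h`_i = j c.
    by move=> i; have [c] := hO i; exists c.
  have [c0 vc0 ec0] := h0; set m := size h.
  have sc : v (1 - c0) = 0%E by rewrite (val_lt_add hv) ?(val1 hv) // (valN hv).
  have s0 : 1 - c0 != 0 := val_neq0 hv sc.
  have vs : v (1 - c0)^-1 = 0%E by rewrite (val_eq_inv hv sc) oppr0.
  pose G := \sum_(i < m) (c i.+1 / (1 - c0)) *: 'X^(m - i.+1).
  have sG : (size G <= m)%N.
    apply: (big_ind (fun f : {poly E} => size f <= m)%N) => [|f1 f2 k1 k2|i _].
    - by rewrite size_poly0.
    - by apply: leq_trans (size_polyD _ _) _; rewrite geq_max k1.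
    - apply: leq_trans (size_scale_leq _ _) _; rewrite size_polyXn.
      by rewrite -subSn ?subSS ?leq_subr.
  have Gge i : (0 <= v G`_i)%E.
    rewrite coef_sum; apply: (val_ge_sum hv) => k _; rewrite coefZ.
    rewrite !(valM hv) vs adde0 -[0%E]adde0; apply: leeD; first by have [] := hc k.+1.
    by rewrite coefXn; case: eqP => _; rewrite ?(val1 hv) ?(val0 hv).
  exists ('X^m - G); split.
  - by rewrite monicE lead_coefDl ?lead_coefXn // size_polyXn size_polyN ltnS.
  - move=> i; rewrite coefB coefXn; apply: (valB hv) => //.
    by case: eqP => _; rewrite ?(val1 hv) ?(val0 hv).
  rewrite rootE rmorphB /= map_polyXn hornerD hornerN hornerXn subr_eq0; apply/eqP.
  have js : j (1 - c0) != 0 by rewrite fmorph_eq0.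
  apply: (mulfI js); rewrite rmorph_sum horner_sum mulr_sumr.
  move: hy; rewrite (horner_coef_wide _ (leqnSn _)) -/m big_ord_recl expr0 mulr1 ec0.
  move=> /(canRL (addKr _)); rewrite addrC -[1](rmorph1 j) -rmorphB => hS; rewrite -{1}hS.
  rewrite mulr_suml; apply: eq_bigr => i _.
  rewrite /= map_polyZ map_polyXn hornerZ hornerXn fmorph_div mulrA [j (1 - c0) * _]mulrC divfK //.
  have [_ ->] := hc i.+1; rewrite -mulrA; congr (_ * _).
  by rewrite -(congr1 (fun k => y ^+ k) (subnK (ltn_ord i))) exprD mulrCA -exprMn mulVf // expr1n mulr1.
have [W [hW sub Wmax]] := proper_subring_maximal proper0.
have [rW Wa Wy W1] := hW.
have nW x c : x != 0 -> ideal2 (j a) y^-1 W x -> ~ W x^-1.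
  move=> x0 Ix Wx; apply: W1; rewrite -(mulVf x0); exact: ideal2M.
have [||w [h1 h2 h3]] := @extension_of_valuation_ring _ _ j v hfin hnv W rW
    (maximal_valuation_ring hW Wmax) _ a va.
- by move=> c hc; apply: sub; apply: (adjoin_sub rO); exists c.
- apply: nW => //; first by rewrite fmorph_eq0; exact: (val_neq0 hv va).
  exists 1, 0; split; [exact: sr1|exact: sr0|ring].
exists w; split=> //; apply: h3; rewrite -[y]invrK; apply: nW => //.
  by rewrite invr_eq0.
exists 0, 1; split; [exact: sr0|exact: sr1|ring].
Qed.

End Normalized.
End ExtendValuation.

(** * Independence of valuations *)

Section Approximation.
Variable L : fieldType.
Implicit Types (w : L -> \bar int) (z : L).

Lemma val_eq_exprz w z k m : valuation w -> w z = k%:E -> w (z ^ m) = (k * m)%:E.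
Proof.
move=> hw hz; case: (intP m) => [|n|n].
- by rewrite expr0z (val1 hw) mulr0.
- by rewrite -exprnP (val_eq_exp hw _ hz) mulrnZ.
- by rewrite -exprnN (val_eq_inv hw (val_eq_exp hw _ hz)) mulrnZ mulrN.
Qed.

(** Units for [w1] are units for [w2], so [w2 = s * w1] with [s] the value of [w2] at a uniformizer
    of [w1]; as both are normalized, [s = 1]. *)
Lemma normalized_valuation_le w1 w2 :
  normalized_valuation w1 -> normalized_valuation w2 ->
  (forall z, (0 <= w1 z -> 0 <= w2 z)%E) -> w1 = w2.
Proof.
move=> n1 n2 h; have h1 := normalized_valuationW n1; have h2 := normalized_valuationW n2.
have [b hb] := nval_norm n1; have b0 := val_neq0 h1 hb.
have [s hs] := valP h2 b0.
have key z m : w1 z = m%:E -> w2 z = (s * m)%:E.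
  move=> hz; have z0 := val_neq0 h1 hz.
  pose u := z * b ^ (- m).
  have u1 : w1 u = 0%E.
    by rewrite (val_eq_mul h1 hz (val_eq_exprz _ h1 hb)) mul1r subrr.
  have uV : w1 u^-1 = 0%E by rewrite (val_eq_inv h1 u1) oppr0.
  have [x hx] := valP h2 (val_neq0 h1 u1).
  have x0 : x = 0.
    have := h u; have := h u^-1; rewrite u1 uV hx (val_eq_inv h2 hx) !lee_fin.
    by move=> /(_ isT) a1 /(_ isT) a2; lia.
  have -> : z = u * b ^ m by rewrite /u -invr_expz divfK // expfz_neq0.
  by rewrite (val_eq_mul h2 hx (val_eq_exprz _ h2 hs)) x0 add0r.
have s0 : 0 <= s by have := h b; rewrite hb hs !lee_fin; apply.
have [z hz] := nval_norm n2; have [m hm] := valP h1 (val_neq0 h2 hz).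
have s1 : s = 1.
  by have := key _ _ hm; rewrite hz => -[] h3; have [m0|m0] := leP m 0; nia.
apply/funext => x; have [->|x0] := eqVneq x 0; first by rewrite (val0 h1) (val0 h2).
by have [l hl] := valP h1 x0; rewrite hl (key _ _ hl) s1 mul1r.
Qed.

Lemma val_separate w1 w2 : normalized_valuation w1 -> normalized_valuation w2 ->
  w1 <> w2 -> exists z, (w1 z < 0)%E /\ (0 < w2 z)%E.
Proof.
move=> n1 n2 ne; have h1 := normalized_valuationW n1; have h2 := normalized_valuationW n2.
have aux u1 u2 : normalized_valuation u1 -> normalized_valuation u2 -> u1 <> u2 ->
    exists z k l, [/\ u1 z = k%:E, u2 z = l%:E, 0 <= k & l < 0].
  move=> m1 m2 nu; apply: contrapT => hn; apply: nu.
  apply: normalized_valuation_le => // z hz; rewrite leNgt; apply/negP => hlt.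
  have hv1 := normalized_valuationW m1; have hv2 := normalized_valuationW m2.
  have z0 : z != 0 by apply: contraTneq hlt => ->; rewrite (val0 hv2).
  have [k hk] := valP hv1 z0; have [l hl] := valP hv2 z0.
  by apply: hn; exists z, k, l; rewrite -!lee_fin -!lte_fin -hk -hl.
have [x [k [l [x1 x2 k0 l0]]]] := aux _ _ n1 n2 ne.
have [y [k' [l' [y2 y1 k0' l0']]]] := aux _ _ n2 n1 (nesym ne).
exists (y / x); rewrite (val_eq_mul h1 y1 (val_eq_inv h1 x1)) (val_eq_mul h2 y2 (val_eq_inv h2 x2)).
by rewrite !lte_fin; split; lia.
Qed.

(** In the induction [z] is right for the first [n] valuations and [y] separates [w0] from the next
    one. The product of [y] with a factor [t k] works if [t k] is very positive at the first [n] and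
    harmless at the other two. *)
Lemma weak_approximation w0 (ws : nat -> L -> \bar int) :
  normalized_valuation w0 -> (forall i, normalized_valuation (ws i)) ->
  forall n, (forall i, (i < n)%N -> ws i <> w0) ->
  exists z, (w0 z < 0)%E /\ forall i, (i < n)%N -> (0 < ws i z)%E.
Proof.
move=> n0 ns; have h0 := normalized_valuationW n0.
have hs i := normalized_valuationW (ns i).
elim=> [|n IH] hne.
  have [b hb] := nval_norm n0; exists b^-1; split=> //.
  by rewrite (val_eq_inv h0 hb).
have [z [z0 zi]] := IH (fun i hi => hne i (ltnW hi)).
have [y [y0 yn]] := val_separate n0 (ns n) (nesym (hne n (ltnSn n))).
have zn0 : z != 0 by apply: contraTneq z0 => ->; rewrite (val0 h0).
have yn0 : y != 0 by apply: contraTneq y0 => ->; rewrite (val0 h0).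
have step (t : nat -> L) : (forall k, (0 < k)%N -> (w0 (t k) <= 0)%E) ->
    (forall k, (0 < k)%N -> (0 <= ws n (t k))%E) ->
    (forall k i, (0 < k)%N -> (i < n)%N -> (k%:Z%:E <= ws i (t k))%E) ->
    exists z, (w0 z < 0)%E /\ forall i, (i < n.+1)%N -> (0 < ws i z)%E.
  move=> t0 tn ti; pose k := (\sum_(i < n) `|fine (ws i y)|).+1.
  have k0 : (0 < k)%N by [].
  exists (t k * y); split.
    rewrite (valM h0); have := t0 k k0; have [m hm] := valP h0 yn0; move: y0; rewrite hm.
    by case: (w0 (t k)) => [s||] //; rewrite !lte_fin lee_fin; lia.
  move=> i; rewrite ltnS leq_eqVlt => /orP[/eqP ->|hi]; rewrite (valM (hs _)).
    have := tn k k0; have [m hm] := valP (hs n) yn0; move: yn; rewrite hm.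
    by case: (ws n (t k)) => [s||] //; rewrite !lte_fin lee_fin; lia.
  have := ti k i k0 hi; have [m hm] := valP (hs i) yn0; rewrite hm.
  have : (`|m| < k)%N by rewrite /k ltnS (bigD1 (Ordinal hi)) //= hm leq_addr.
  by case: (ws i (t k)) => [s||] //; rewrite !lte_fin lee_fin; lia.
have tk i k : (i < n)%N -> (k%:Z%:E <= ws i (z ^+ k)%R)%E.
  move=> hi; have := zi i hi; have [m hm] := valP (hs i) zn0.
  rewrite (val_eq_exp (hs i) _ hm) hm lte_fin lee_fin mulrnZ => m0.
  by rewrite ler_peMl; lia.
have [k0 hk0] := valP h0 zn0; have k00 : k0 < 0 by rewrite hk0 lte_fin in z0.
have [kn hkn] := valP (hs n) zn0.
(* A positive value at [ws n] needs no correction. When it is 0, [z ^+ k] is harmless there; when it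
   is negative, [z ^+ k / (1 + z ^+ k)] has value 0 both there and at [w0]. *)
have [hlt|hgt|heq] := ltgtP kn 0.
- have inv1 w m k : valuation w -> w z = m%:E -> m < 0 -> (0 < k)%N ->
      w (z ^+ k / (1 + z ^+ k)) = 0%E.
    move=> hw hm m0 kp; have e1 := val_eq_exp hw k hm.
    have e2 : w (1 + z ^+ k) = (m *+ k)%:E.
      rewrite addrC (val_lt_add hw) ?e1 // (val1 hw) lte_fin mulrnZ.
      by rewrite pmulr_llt0 // ltz_nat.
    by rewrite (val_eq_mul hw e1 (val_eq_inv hw e2)) subrr.
  apply: (step (fun k => z ^+ k / (1 + z ^+ k))).
  + by move=> k kp; rewrite (inv1 w0 k0).
  + by move=> k kp; rewrite (inv1 (ws n) kn).
  move=> k i kp hi; have h1 := tk i k hi.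
  have e2 : ws i (1 + z ^+ k) = 0%E.
    rewrite (val_lt_add (hs i)) (val1 (hs i)) //; apply: lt_le_trans h1.
    by rewrite lte_fin ltz_nat.
  by rewrite (valM (hs i)) (val_eq_inv (hs i) e2) oppr0 adde0.
- exists z; split=> // i; rewrite ltnS leq_eqVlt => /orP[/eqP ->|/zi //].
  by rewrite hkn lte_fin.
- apply: (step (fun k => z ^+ k)).
  + move=> k kp; rewrite (val_eq_exp h0 _ hk0) lee_fin mulrnZ.
    by rewrite mulr_le0_ge0 // ltW.
  + by move=> k kp; rewrite (val_eq_exp (hs n) _ hkn) heq mul0rn.
  + by move=> k i kp hi; apply: tk.
Qed.

End Approximation.

(** * Number of extensions and residue degrees *)

Section ExtensionsOfValuation.
Variables (E L : fieldType) (j : {rmorphism E -> L}) (v : E -> \bar int).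
Hypotheses (hfin : finite_embedding j) (hv : valuation v).

Lemma minimal_coefficient (I : finType) (c : I -> E) : (exists k, c k != 0) ->
  exists k, c k != 0 /\ forall i, (v (c k) <= v (c i))%E.
Proof.
case=> k0 hk0; case: (@arg_minP _ _ I k0 (fun k => c k != 0) (fun i => v (c i)) hk0) => k hk hmin; exists k; split=> // i.
have [->|/hmin //] := eqVneq (c i) 0; by rewrite (val0 hv) leey.
Qed.

(* Separating elements of distinct extensions are linearly independent. *)
Lemma extensions_independent N (ws : nat -> L -> \bar int) :
  (forall i, normalized_valuation (ws i)) -> (forall i, lies_over j v (ws i)) ->
  (forall i k, (i < k <= N)%N -> ws i <> ws k) -> (N < field_degree j)%N.
Proof.
move=> ns hov hinj; rewrite ltnNge; apply/negP => hN.
have hs i := normalized_valuationW (ns i).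
have hz (i : 'I_N.+1) : exists z, (ws i z < 0)%E /\
    forall k : 'I_N.+1, k != i -> (0 < ws k z)%E.
  have [|z [z0 zi]] := weak_approximation (ns i) (fun k => ns (bump i k)) (n := N).
    move=> k kN; have := neq_bump i k; rewrite neq_ltn /bump => /orP[h|h].
      by apply/nesym/hinj; rewrite h -ltnS; have := ltn_ord i; case: leqP h => /=; lia.
    by apply: hinj; rewrite h -ltnS ltn_ord.
  exists z; split=> // k ki.
  have ki' : k != i :> nat by rewrite val_eqE.
  have := zi (unbump i k); rewrite unbumpK ?inE //; apply.
  by rewrite /unbump; have := ltn_ord k; have := ltn_ord i; case: ltnP; lia.
have /choice[z hz'] := hz.
have [|c hc /minimal_coefficient[i [ci cmin]]] := finite_dependence z hfin.
  by rewrite card_ord.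
have [zi0 zi] := hz' i.
have zin : z i != 0 by apply: contraTneq zi0 => ->; rewrite (val0 (hs i)).
have jci : j (c i) != 0 by rewrite fmorph_eq0.
(* At [ws i], where [i] has the coefficient of least valuation, the [i]-th term strictly dominates:
   [z i] is negative there and every other [z k] positive. So the sum cannot be 0. *)
have : ws i (\sum_k j (c k) * z k) = ws i (j (c i) * z i).
  apply: (val_lt_sum (hs i)); first by rewrite mulf_neq0.
  move=> k ki; rewrite !(valM (hs i)); have [e e0 he] := hov i; rewrite !he.
  have [_ /(_ i)] := hz' k; rewrite eq_sym => /(_ ki) hzk.
  have [m hm] := valP hv ci; have [l hl] := valP (hs i) zin.
  have := cmin k; move: zi0; rewrite hm hl -EFinM lte_fin => l0.
  case: (v (c k)) => [s||] //.
    rewrite lee_fin -EFinM => ms; move: hzk.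
    case: (ws i (z k)) => [u||] // u0; rewrite -?EFinD ?lte_fin; last by rewrite ltry.
    by rewrite ler_ltD // ?ler_wpM2l //; move: u0; rewrite lte_fin; lia.
  move=> _; rewrite gt0_muley ?lte_fin ?ltz_nat // addye; first exact: ltry.
  by move: hzk; case: (ws i (z k)).
by rewrite hc (val0 (hs i)) => /esym/eqP; rewrite (val_eqy (hs i)) mulf_eq0 (negbTE jci) (negbTE zin).
Qed.

Lemma finite_extensions :
  finite_set [set w : L -> \bar int | normalized_valuation w /\ lies_over j v w].
Proof.
set A := [set w | _]; have [//|hinf] := pselect (finite_set A).
set N := field_degree j.
have [B BA cB] := infinite_set_fset N.+1 hinf.
have [w0 Bw0] : exists w, w \in B by apply/fset0Pn; rewrite -cardfs_gt0; lia.
pose ws i := nth w0 (enum_fset B) i.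
have Bws i : w0 \in B -> ws i \in B.
  by move=> _; rewrite /ws; have [h|h] := ltnP i #|` B|; [exact: mem_nth | rewrite nth_default].
have Aws i : A (ws i) by apply: BA; exact: Bws.
suff : (N < N)%N by rewrite ltnn.
apply: (@extensions_independent N ws) => [i|i|i k /andP[ik kN]].
- by have [] := Aws i.
- by have [] := Aws i.
have kB : (k < #|` B|)%N by apply: leq_trans cB.
move/eqP; rewrite nth_uniq ?fset_uniq //; last exact: ltn_trans ik kB.
by rewrite (ltn_eqF ik).
Qed.

(** The default value 0 must be excluded. Integral elements with independent residues number at most
    [[L : E]], since a relation over [E] can be divided by a coefficient of least valuation; a
    maximal such family is a residue basis. The class of 1 prevents a residue basis from being
    empty. *)
Lemma residue_degree_gt0 w : normalized_valuation w -> lies_over j v w ->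
  (0 < residue_degree j v w)%N.
Proof.
move=> nw [e e0 he]; have hw := normalized_valuationW nw.
have wj c : (0 < w (j c))%E = (0 < v c)%E.
  rewrite he; case: (v c) => [s||].
  - by rewrite -EFinM !lte_fin pmulr_rgt0 // ltz_nat.
  - by rewrite gt0_muley ?lte_fin.
  - by rewrite gt0_muleNy ?lte_fin.
have wj0 c : (0 <= v c)%E -> (0 <= w (j c))%E.
  by rewrite he => h; rewrite mule_ge0.
pose P d (b : 'I_d -> L) := (forall k, (0 <= w (b k))%E) /\
  forall c : 'I_d -> E, (forall k, (0 <= v (c k))%E) ->
    (0 < w (\sum_(k < d) j (c k) * b k)%R)%E -> forall k, (0 < v (c k))%E.
have [||d [b [[bge bind] bmax]]] := @maximal_family _ P (field_degree j).
- by exists (fun=> 0); split; [case | move=> c _ _ []].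
- move=> d b [bge bind]; rewrite leqNgt; apply/negP => hd.
  have [|c hc /minimal_coefficient[i [ci cmin]]] := finite_dependence b hfin.
    by rewrite card_ord.
  have [m hm] := valP hv ci.
  have hVi := val_eq_inv hv hm.
  have := bind (fun k => (c i)^-1 * c k) _ _ i; rewrite mulVf // (val1 hv) ltxx => h.
  suff : false by []; apply: h.
    move=> k; rewrite (valM hv) hVi; have := cmin k; rewrite hm.
    by case: (v (c k)) => [s||] //; rewrite -EFinD !lee_fin; lia.
  under eq_bigr => k _ do rewrite rmorphM -mulrA.
  by rewrite -mulr_sumr hc mulr0 (val0 hw).
have hb : residue_basis j v w b.
  split=> // y hy.
  have : ~ P d.+1 (extend_family b y) by exact: bmax.
  move=> /not_andP[h|].
    exfalso; apply: h => k; rewrite /extend_family; case: (unliftP ord_max k) => [k'|] _ //=.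
  move=> /existsNP[c] /not_implyP[cge] /not_implyP[]; rewrite extend_family_sum => hc.
  move=> /existsNP[k hk].
  have cm : v (c ord_max) = 0%E.
    apply/eqP; rewrite eq_le cge andbT leNgt; apply/negP => hcm; apply: hk.
    have hcb : (0 < w (\sum_(k < d) j (c (lift ord_max k)) * b k)%R)%E.
      rewrite -(addrK (j (c ord_max) * y) (\sum_(k < d) _)).
      apply: (val_gt_add hw) => //; rewrite (valN hw) (valM hw).
      move: hcm; rewrite -wj; case: (w (j _)) => [s||] //; case: (w y) hy => [u||] //.
      by rewrite -EFinD lee_fin !lte_fin; lia.
    have := bind _ (fun k => cge _) hcb.
    by case: (unliftP ord_max k) => [k'|] ->.
  have cm0 := val_neq0 hv cm.
  exists (fun k => - c (lift ord_max k) / c ord_max).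
    by move=> k'; rewrite (valM hv) (val_eq_inv hv cm) oppr0 adde0 (valN hv).
  have jcm : j (c ord_max) != 0 by rewrite fmorph_eq0.
  have -> : y - \sum_(k < d) j (- c (lift ord_max k) / c ord_max) * b k =
      (j (c ord_max))^-1 * (\sum_(k < d) j (c (lift ord_max k)) * b k + j (c ord_max) * y).
    rewrite mulrDr mulKf // addrC; congr (_ + _); rewrite mulr_sumr -sumrN.
    apply: eq_bigr => k' _; rewrite fmorph_div rmorphN.
    by rewrite !mulNr opprK mulrA; congr (_ * _); rewrite mulrC.
  have wcm : w (j (c ord_max)) = 0%E by rewrite he cm mule0.
  by rewrite (valM hw) (val_eq_inv hw wcm) oppr0 add0e.
have hd : [set d | exists b : 'I_d -> L, residue_basis j v w b] d by exists b.
rewrite /residue_degree; case: xgetP => [d' _ [b' [_ hb' _]]|/(_ d)]; last by move=> /(_ hd).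
case: d' b' hb' => // b' /(_ 1); rewrite (val1 hw) => /(_ (lexx _))[c _].
by rewrite big_ord0 subr0 (val1 hw) ltxx.
Qed.

End ExtensionsOfValuation.

(** * Systems of valuations without non-constant integral elements *)

(* In characteristic [p] these are the elements algebraic over the prime field. *)
Definition constant (p : nat) (E : fieldType) (c : E) := exists2 N, (0 < N)%N & c ^+ (p ^ N) = c.

(** * Elements fixed by a power of Frobenius *)

Section Constants.
Variables (p : nat) (E : fieldType).
Hypothesis hp : p \in [pchar E].
Let p1 : p = (p ^ 1)%N. Proof. by rewrite expn1. Qed.

Lemma constant_exp (c : E) N k : c ^+ (p ^ N) = c -> c ^+ (p ^ (N * k)) = c.
Proof.
move=> h; elim: k => [|k IH]; first by rewrite muln0.
by rewrite mulnS expnD exprM h.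
Qed.

Lemma constant_family n (c : 'I_n -> E) : (forall i, constant p (c i)) ->
  exists2 N, (0 < N)%N & forall i, c i ^+ (p ^ N) = c i.
Proof.
elim: n c => [|n IH] c hc; first by exists 1%N => // -[].
have [N N0 hN] := IH (c \o lift ord_max) (fun i => hc _).
have [M M0 hM] := hc ord_max; exists (N * M)%N; first by rewrite muln_gt0 N0.
move=> i; case: (unliftP ord_max i) => [k|] ->; first by apply: constant_exp; apply: hN.
by rewrite mulnC; apply: constant_exp.
Qed.

Lemma frob_inj m : injective (fun x : E => x ^+ (p ^ m)).
Proof.
move=> x y /= /eqP; rewrite -subr_eq0 -(frobN hp p1) -(frobD hp p1) expf_eq0 => /andP[_].
by rewrite subr_eq0 => /eqP.
Qed.

Lemma constant_val (w : E -> \bar int) c : valuation w -> constant p c -> c != 0 ->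
  w c = 0%E.
Proof.
move=> hw [N N0 hN] c0; apply: (val_exp_fixed hw _ c0 hN).
by rewrite -(exp1n N) ltn_exp2r // prime_gt1 // (pcharf_prime hp).
Qed.

(** A power of Frobenius fixing the coefficients maps roots to roots. There are finitely many, so
    two iterates of [c] coincide, and Frobenius is injective. *)
Lemma root_of_constant (f : {poly E}) (c : E) : f != 0 ->
  (forall i, constant p f`_i) -> root f c -> constant p c.
Proof.
move=> f0 hf hc.
have [N N0 hN] := constant_family (fun i : 'I_(size f) => hf i).
have rt k : root f (c ^+ (p ^ (N * k))).
  elim: k => [|k IH]; first by rewrite muln0 expn0 expr1.
  rewrite mulnS addnC expnD exprM; move: IH; set b := c ^+ _ => /rootP hb.
  rewrite rootE horner_coef.
  have -> : \sum_(i < size f) f`_i * b ^+ (p ^ N) ^+ i = (f.[b]) ^+ (p ^ N).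
    rewrite horner_coef (frob_sum hp p1); apply: eq_bigr => i _.
    by rewrite exprMn hN exprAC.
  by rewrite hb (frob0 hp p1).
have : ~~ uniq [seq c ^+ (p ^ (N * k)) | k <- iota 0 (size f)].
  apply/negP => hu; have := max_poly_roots f0 _ hu; rewrite size_map size_iota ltnn => h.
  by suff : false by []; apply: h; apply/allP => _ /mapP[k _ ->].
move=> /(uniqPn 0)[i [k [ik]]]; rewrite size_map size_iota => hk.
rewrite !(nth_map 0%N) ?size_iota ?(ltn_trans ik) // !nth_iota ?(ltn_trans ik) // !add0n => h.
exists (N * (k - i))%N; first by rewrite muln_gt0 N0 subn_gt0.
apply: (@frob_inj (N * i)%N); rewrite -exprM -expnD -mulnDr subnK 1?ltnW // h.
Qed.

End Constants.

Lemma constant_inj p (E L : fieldType) (j : {rmorphism E -> L}) c :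
  constant p (j c) <-> constant p c.
Proof.
split=> -[N N0 hN]; exists N => //; last by rewrite -rmorphXn hN.
by apply: (fmorph_inj j); rewrite rmorphXn.
Qed.

Section GoodSystem.
Variables (R : realType) (p : nat).

(* The second alternative of [gs_norm] is the place at infinity of [F] itself,
   for an empty transcendence basis: it is trivial, hence has no normalized extension. *)
Record good_system (E : fieldType) (M : set (weighted_valuation R E)) (delta : R) : Prop := {
  gs_norm : forall vd, M vd -> normalized_valuation vd.1 \/ (valuation vd.1 /\ forall c, (0 <= vd.1 c)%E);
  gs_const : forall c, (forall vd, M vd -> (0 <= vd.1 c)%E) -> constant p c;
  gs_fin : forall c, finite_set [set v | (exists d, M (v, d)) /\ (v c < 0)%E];
  gs_deg : forall vd, M vd -> delta <= vd.2
}.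

Variables (E L : fieldType) (j : {rmorphism E -> L}) (M : set (weighted_valuation R E)) (delta : R).
Hypotheses (hp : p \in [pchar E]) (hfin : finite_embedding j) (hM : good_system M delta).
Hypothesis delta0 : 0 <= delta.

Lemma lies_over_neg v w : normalized_valuation w -> lies_over j v w ->
  exists c, (v c < 0)%E.
Proof.
move=> nw [e e0 he]; have hw := normalized_valuationW nw.
have [b hb] := nval_norm nw.
have [f [mf rf _]] := minimal_poly_exists hfin b^-1.
have [|i hi] := neg_coef hw mf rf; first by rewrite (val_eq_inv hw hb).
exists f`_i; move: hi; rewrite he; case: (v f`_i) => [s||] //.
  by rewrite -EFinM !lte_fin pmulr_rlt0 // ltz_nat.
by rewrite gt0_muley ?lte_fin.
Qed.

Lemma extension_over_normalized v d w : M (v, d) -> normalized_valuation w ->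
  lies_over j v w -> normalized_valuation v.
Proof.
move=> Mv nw hov; have [//|[_ h]] := gs_norm hM Mv.
by have [c] := lies_over_neg nw hov; rewrite ltNge h.
Qed.

(** If [c] is integral everywhere, so are the coefficients of its minimal polynomial: otherwise
    [extension_negative] would produce an extension at which [c] is negative. Conversely a pole of
    [c] lies over a pole of some coefficient, and over each valuation there are finitely many
    extensions. The degree bound uses that residue degrees are at least 1. *)
Lemma good_system_extend :
  good_system (extend_valuations j M) (delta / (field_degree j)%:R).
Proof.
have D0 : 0 < (field_degree j)%:R :> R by rewrite ltr0n field_degree_gt0.
split.
- by move=> wd [nw _]; left.
- move=> c hc; have [f [mf rf fmin]] := minimal_poly_exists hfin c.
  have hpL : p \in [pchar L] by rewrite (fmorph_pchar j).
  apply: (root_of_constant hpL (f := map_poly j f)) => //.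
    by rewrite map_poly_eq0 monic_neq0.
  move=> i; rewrite coef_map; apply/constant_inj; apply: (gs_const hM) => -[v d] Mvd /=.
  have [nv|[_ ->//]] := gs_norm hM Mvd.
  have hv := normalized_valuationW nv.
  apply: (integral_minimal_poly hv mf fmin); apply: contrapT => hn.
  have [w [nw hov]] := extension_negative hfin nv hn.
  pose wd : weighted_valuation R L := (w, (residue_degree j v w)%:R * d / (field_degree j)%:R).
  rewrite ltNge; move/negP; apply; apply: (hc wd).
  by split=> //; exists (v, d).
- move=> c; have [f [mf rf _]] := minimal_poly_exists hfin c.
  apply: (@sub_finite_set _ _ (\bigcup_(i in `I_(size f))
    \bigcup_(v in [set v | (exists d, M (v, d)) /\ (v f`_i < 0)%E])
      [set w : L -> \bar int | [/\ normalized_valuation v, normalized_valuation w & lies_over j v w]])).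
    move=> w [[d [/= nw [[v d'] Mv [/= hov _]]]] wc].
    have nv := extension_over_normalized Mv nw hov.
    have [i hi] := neg_coef (normalized_valuationW nw) mf rf wc.
    have [e e0 he] := hov.
    exists i => /=.
      rewrite ltnNge; apply/negP => h; move: hi.
      by rewrite nth_default // rmorph0 (val0 (normalized_valuationW nw)).
    exists v => //; split; first by exists d'.
    move: hi; rewrite he; case: (v f`_i) => [s||] //.
      by rewrite -EFinM !lte_fin pmulr_rlt0 // ltz_nat.
    by rewrite gt0_muley ?lte_fin.
  apply: bigcup_finite => [|i _]; first exact: finite_II.
  apply: bigcup_finite => [|v [_ _]]; first exact: (gs_fin hM).
  have [nv|nv] := pselect (normalized_valuation v); last first.
    by rewrite (_ : [set w | _] = set0) //; apply/seteqP; split=> // w [].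
  apply: sub_finite_set (finite_extensions hfin (normalized_valuationW nv)).
  by move=> w [].
- move=> [w d] [/= nw [[v d'] Mv [/= hov ->]]].
  have nv := extension_over_normalized Mv nw hov.
  have rd := residue_degree_gt0 hfin (normalized_valuationW nv) nw hov.
  rewrite ler_pM2r ?invr_gt0 //; apply: le_trans (gs_deg hM Mv) _ => /=.
  rewrite ler_peMl ?ler1n //; exact: le_trans (gs_deg hM Mv).
Qed.

End GoodSystem.

(** * Valuations of rational function fields *)

Section Factorial.
Variable D : idomainType.
Implicit Types (x y a b : D).

Definition divides x y := exists s, y = s * x.
Definition irreducible_elt x := [/\ x != 0, x \isn't a GRing.unit &
  forall a b, x = a * b -> a \is a GRing.unit \/ b \is a GRing.unit].
Definition prime_elt x := [/\ x != 0, x \isn't a GRing.unit &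
  forall a b, divides x (a * b) -> divides x a \/ divides x b].

(* The length function stands for the existence of factorizations. *)
Definition factorial_domain := (exists len : D -> nat,
    (forall a b, a != 0 -> b != 0 -> len (a * b) = (len a + len b)%N) /\
    (forall a, a != 0 -> (len a == 0%N) = (a \is a GRing.unit))) /\
  forall x, irreducible_elt x -> prime_elt x.

Lemma dividesMl x y s : divides x y -> divides x (s * y).
Proof. by move=> [u ->]; exists (s * u); rewrite mulrA. Qed.

Lemma dividesMr x y s : divides x y -> divides x (y * s).
Proof. by rewrite mulrC; apply: dividesMl. Qed.

Lemma dividesD x y z : divides x y -> divides x z -> divides x (y + z).
Proof. by move=> [u ->] [s ->]; exists (u + s); rewrite mulrDl. Qed.

Lemma divides0 x : divides x 0. Proof. by exists 0; rewrite mul0r. Qed.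

Lemma factorial_ind (P : D -> Prop) : factorial_domain ->
  (forall a, a \is a GRing.unit -> P a) ->
  (forall x a, prime_elt x -> a != 0 -> P a -> P (a * x)) ->
  forall a, a != 0 -> P a.
Proof.
move=> [[len [lenM len0]] irr_prime] Pu PM a a0.
have [n] := ubnP (len a); elim: n a a0 => // n IH a a0 hn.
have [ua|ua] := boolP (a \is a GRing.unit); first exact: Pu.
have [x [s [irrx as_]]] : exists x s, irreducible_elt x /\ a = s * x.
  have [k] := ubnP (len a); elim: k {IH hn} a a0 ua => // k IHk a a0 ua hk.
  have [irra|nirr] := pselect (irreducible_elt a); first by exists a, 1; rewrite mul1r.
  have [b [c [abc ub uc]]] : exists b c,
      [/\ a = b * c, b \isn't a GRing.unit & c \isn't a GRing.unit].
    apply: contrapT => hn; apply: nirr; split=> // b c abc.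
    have [ub|ub] := boolP (b \is a GRing.unit); first by left.
    have [uc|uc] := boolP (c \is a GRing.unit); first by right.
    by case: hn; exists b, c.
  have b0 : b != 0 by apply: contraNneq a0 => h; rewrite abc h mul0r.
  have c0 : c != 0 by apply: contraNneq a0 => h; rewrite abc h mulr0.
  have [|x [s [irrx hs]]] := IHk b b0 ub.
    move: hk; rewrite abc lenM //; have := len0 c c0; rewrite (negbTE uc) => /negbT.
    by rewrite -lt0n; lia.
  by exists x, (c * s); split=> //; rewrite abc hs mulrAC [s * c]mulrC.
have px := irr_prime _ irrx; have [x0 ux _] := px.
have s0 : s != 0 by apply: contraNneq a0 => h; rewrite as_ h mul0r.
rewrite as_; apply: PM => //; apply: IH => //.
move: hn; rewrite as_ lenM //; have := len0 x x0; rewrite (negbTE ux) => /negbT.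
by rewrite -lt0n; lia.
Qed.

End Factorial.

Section GaussFactorial.
Variable D : idomainType.
Hypothesis hD : factorial_domain D.
Implicit Types (f g h P : {poly D}).

Lemma divides_polyC (x : D) f : divides x%:P f <-> forall i, divides x f`_i.
Proof.
split=> [[s ->] i|h]; first by exists s`_i; rewrite coefMC.
have /choice[c hc] := h; exists (\poly_(i < size f) c i).
apply/polyP => i; rewrite coefMC coef_poly; case: ltnP => hi; first by rewrite -hc.
by rewrite nth_default // mul0r.
Qed.

(** In each of two factors not divisible by [x] take the first coefficient not divisible by [x]; at
    the sum of the indices the product has a coefficient not divisible by [x]. *)
Lemma prime_polyC (x : D) : prime_elt x -> prime_elt x%:P.
Proof.
move=> [x0 ux px]; split.
- by rewrite polyC_eq0.
- by rewrite poly_unitE coefC /= (negbTE ux) andbF.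
have least f : ~ divides x%:P f -> exists i, ~ divides x f`_i /\
    forall k, (k < i)%N -> divides x f`_k.
  move=> hf; pose Q i := `[< ~ divides x f`_i >].
  have exQ : exists i, Q i.
    apply: contrapT => hn; apply: hf; apply/divides_polyC => i.
    by apply: contrapT => h; apply: hn; exists i; apply/asboolP.
  case: (ex_minnP exQ) => i /asboolP hi imin; exists i; split=> // k ki.
  apply: contrapT => h; have := imin k; rewrite leqNgt ki => /(_ _)/negP.
  by apply=> //; apply/asboolP.
move=> f g hfg; apply: contrapT => /not_orP[/least[i [hi ilt]] /least[k [hk klt]]].
have /divides_polyC/(_ (i + k)%N) := hfg; rewrite coefM.
have hlt : (i < (i + k).+1)%N by rewrite ltnS leq_addr.
rewrite (bigD1 (Ordinal hlt)) //= addKn.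
set S := \sum_(_ < _ | _) _ => hs.
have : divides x (f`_i * g`_k + S - S).
  apply: dividesD => //; rewrite -mulN1r; apply: dividesMl.
  apply: (big_ind (divides x)) => [|a b|s hs']; [exact: divides0|exact: dividesD|].
  have [h1|h1|h1] := ltngtP s i; last by rewrite -val_eqE /= h1 eqxx in hs'.
    by apply: dividesMr; apply: ilt.
  by apply: dividesMl; apply: klt; have := ltn_ord s; move: h1; clear; lia.
by rewrite addrK => /px[].
Qed.

(** Here [P] is primitive, so each prime factor of [c] divides [g] and cancels. *)
Lemma scale_divides P f : (forall x, prime_elt x -> ~ divides x%:P P) ->
  forall c : D, c != 0 -> forall g, c *: f = P * g -> divides P f.
Proof.
move=> nP; apply: factorial_ind => // [c uc g h|x c px c0 IH g h].
  exists (c^-1 *: g); rewrite -scalerAl [g * P]mulrC -h scalerA mulVr // scale1r.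
  by [].
have [x0 _ _] := px; have [_ _ px'] := prime_polyC px.
have [|/(nP x px)//|[s hs]] := px' P g.
  by rewrite -h mulrC -scalerA -!mul_polyC; exists (c%:P * f); ring.
apply: (IH s); apply: (@mulfI _ x%:P); rewrite ?polyC_eq0 //.
by rewrite mul_polyC scalerA [x * c]mulrC h hs; ring.
Qed.

(** The prime factors of [c] are distributed one by one over [h] and [u]; [c1] collects those that
    divide out of [h]. *)
Lemma scale_factor P : forall c : D, c != 0 -> forall h u, c *: P = h * u ->
  exists c1 h' u', [/\ c1 != 0, P = h' * u' & h = c1 *: h'].
Proof.
apply: factorial_ind => // [c uc h u e|x c px c0 IH h u e].
  exists 1, h, (c^-1 *: u); rewrite oner_neq0 scale1r; split=> //.
  by rewrite -scalerAr -e scalerA mulVr // scale1r.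
have [x0 _ _] := px; have [_ _ px'] := prime_polyC px.
have xP0 : x%:P != 0 by rewrite polyC_eq0.
have e' : x%:P * (c *: P) = h * u by rewrite -e mul_polyC scalerA mulrC.
have [[s hs]|[s hs]] := px' h u (ex_intro _ _ (etrans (esym e') (mulrC _ _))).
  have [|c1 [h' [u' [c10 -> hs']]]] := IH s u.
    by apply: (mulfI xP0); rewrite e' hs; ring.
  by exists (x * c1), h', u'; rewrite mulf_neq0 //; split=> //; rewrite hs hs' -!mul_polyC polyCM; ring.
have [|c1 [h' [u' [c10 -> hs']]]] := IH h s.
  by apply: (mulfI xP0); rewrite e' hs; ring.
by exists c1, h', u'.
Qed.

Lemma irreducible_poly_const (x : D) : irreducible_elt x%:P -> irreducible_elt x.
Proof.
move=> [x0 ux hx]; split.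
- by move: x0; rewrite polyC_eq0.
- by apply: contra ux; exact: rmorph_unit.
move=> a b e; have := hx a%:P b%:P; rewrite -polyCM e => /(_ erefl).
by rewrite !poly_unitE !coefC /= => -[/andP[_ ->]|/andP[_ ->]]; [left|right].
Qed.

Lemma irreducible_poly_primitive P x : irreducible_elt P -> (1 < size P)%N ->
  prime_elt x -> ~ divides x%:P P.
Proof.
move=> [P0 uP hP] sP [x0 ux _] [s hs]; have := hP _ _ hs.
rewrite !poly_unitE coefC /= (negbTE ux) andbF => -[/andP[/eqP ss _]|//].
have : (size P <= 1)%N.
  rewrite hs mulrC mul_polyC; apply: leq_trans (size_scale_leq _ _) _.
  by rewrite ss.
by rewrite leqNgt sP.
Qed.

(* [h] is an element of minimal degree of the ideal generated by [P] and [f];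
   it pseudo-divides both generators. *)
Lemma irreducible_poly_prime P : irreducible_elt P -> prime_elt P.
Proof.
move=> irrP; have [P0 uP hP] := irrP.
have [sP|sP] := leqP (size P) 1.
  have eP := size1_polyC sP; rewrite eP in irrP *.
  by apply: prime_polyC; apply: (hD.2); apply: irreducible_poly_const.
have nP x : prime_elt x -> ~ divides x%:P P by exact: irreducible_poly_primitive.
split=> // f g hfg; have [|nf] := pselect (divides P f); first by left.
have f0 : f != 0 by apply/eqP => h; apply: nf; rewrite h; exact: divides0.
pose I h := exists u s, h = u * P + s * f.
pose Q n := `[< exists h, [/\ h != 0, I h & size h = n] >].
have exQ : exists n, Q n.
  by exists (size P); apply/asboolP; exists P; split=> //; exists 1, 0; ring.
case: (ex_minnP exQ) => n /asboolP[h [h0 [u [s hus]] sh]] nmin.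
have pdiv k : I k -> exists2 c : D, c != 0 & exists w, c *: k = h * w.
  move=> [u' [s' ek]]; exists (lead_coef h ^+ scalp k h).
    by rewrite expf_neq0 // lead_coef_eq0.
  exists (k %/ h)%R; have ed := Pdiv.Idomain.divp_eq k h.
  rewrite ed [h * _]mulrC; suff -> : (k %% h)%R = 0 by rewrite addr0.
  apply: contraTeq isT => r0; have : (n <= size (k %% h)%R)%N.
    apply: nmin; apply/asboolP; exists (k %% h)%R; split=> //.
    exists (lead_coef h ^+ scalp k h *: u' - (k %/ h)%R * u),
      (lead_coef h ^+ scalp k h *: s' - (k %/ h)%R * s).
    apply: (addrI ((k %/ h)%R * h)); rewrite -ed ek hus -!mul_polyC; ring.
  by rewrite leqNgt -sh Pdiv.Idomain.ltn_modp h0.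
have [cP cP0 [wP eP]] : exists2 c : D, c != 0 & exists w, c *: P = h * w.
  by apply: pdiv; exists 1, 0; ring.
have [cf cf0 [wf ef]] : exists2 c : D, c != 0 & exists w, c *: f = h * w.
  by apply: pdiv; exists 0, 1; ring.
(* If [h = u P + s f] is a constant, then [h g] is a multiple of [P], since [f g] is; the primitive
   [P] therefore divides [g]. *)
have [sh1|sh1] := leqP (size h) 1.
  right; have eh := size1_polyC sh1; set c := h`_0 in eh.
  have c0 : c != 0 by apply: contraNneq h0 => e; rewrite eh e.
  have [v hv] := hfg.
  apply: (@scale_divides P g nP c c0 (u * g + s * v)).
  rewrite -mul_polyC -eh hus mulrDl [s * f * g]mulrAC -[s * g * f]mulrA [g * f]mulrC hv.
  ring.
(* Cleared of constants, the pseudo-division of [P] by [h] is a factorization [P = h' u'] with [h']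
   not constant. So [u'] is a unit, and [P] divides a constant multiple of [f], as [h] does. *)
have [c1 [h' [u' [c10 eP' eh']]]] := scale_factor cP0 eP.
have [uh|uu] := hP _ _ eP'.
  suff : (size h <= 1)%N by rewrite leqNgt sh1.
  rewrite eh'.
  apply: leq_trans (size_scale_leq _ _) _.
  by move: uh; rewrite poly_unitE => /andP[/eqP ->].
exfalso; apply: nf; apply: (scale_divides nP cf0 (g := c1 *: (u'^-1 * wf))).
rewrite ef eh' eP' -!scalerAl -scalerAr; congr (_ *: _).
by rewrite mulrA -[h' * u' * _]mulrA mulrV ?mulr1.
Qed.

Lemma factorial_poly : factorial_domain {poly D}.
Proof.
split; last exact: irreducible_poly_prime.
have [[len [lenM len0]] _] := hD.
exists (fun f => (size f).-1 + len (lead_coef f))%N; split=> [f g f0 g0|f f0].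
  rewrite size_mul // lead_coefM lenM ?lead_coef_eq0 //.
  move: f0 g0; rewrite -!size_poly_gt0; case: (size f) => // n _; case: (size g) => // m _.
  by rewrite addSn addnS /= addnACA.
rewrite addn_eq0 len0 ?lead_coef_eq0 // poly_unitE.
have sf : (0 < size f)%N by rewrite size_poly_gt0.
have [e|e] := eqVneq (size f) 1; first by rewrite lead_coefE e.
by case: (size f) sf e => // -[].
Qed.

End GaussFactorial.

Lemma factorial_transport (D D' : idomainType) (f : {rmorphism D -> D'})
    (g : {rmorphism D' -> D}) : cancel f g -> cancel g f ->
  factorial_domain D' -> factorial_domain D.
Proof.
move=> fK gK [[len [lenM len0]] irrp].
have f0 x : (f x == 0) = (x == 0) by rewrite -(can_eq fK) rmorph0.
have fu x : (f x \is a GRing.unit) = (x \is a GRing.unit).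
  by apply/idP/idP => [/(rmorph_unit g)|/(rmorph_unit f)//]; rewrite fK.
split.
  exists (len \o f); split=> [a b a0 b0|a a0] /=; first by rewrite rmorphM lenM ?f0.
  by rewrite len0 ?f0 // fu.
move=> x [x0 ux hx]; have [|fx0 ufx px] := irrp (f x).
  split; rewrite ?f0 ?fu // => a b e.
  have := hx (g a) (g b); rewrite -rmorphM -e fK => /(_ erefl).
  by rewrite -!fu !gK.
split=> // a b [s hs].
have [|[u hu]|[u hu]] := px (f a) (f b).
- by exists (f s); rewrite -!rmorphM hs.
- by left; exists (g u); rewrite -[a]fK hu rmorphM fK.
- by right; exists (g u); rewrite -[b]fK hu rmorphM fK.
Qed.

(** * Polynomials in several variables *)

Section MultivariatePolynomials.
Variable F : fieldType.

Lemma mpoly0_const (f : mpoly 0 F) : f = mpolyC 0 (mcoeff mnm0 f).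
Proof.
apply: msize1_polyC; rewrite msizeE; apply/bigmax_leqP_seq => m _ _.
by rewrite ltnS leqn0 mdeg_eq0; apply/eqP/mnmP => -[].
Qed.

Lemma mpolyC_unit n (c : F) : c != 0 -> mpolyC n c \is a GRing.unit.
Proof. by move=> c0; apply: rmorph_unit; rewrite unitfE. Qed.

Lemma factorial_mpoly0 : factorial_domain (mpoly 0 F).
Proof.
have unit0 (f : mpoly 0 F) : f != 0 -> f \is a GRing.unit.
  rewrite [f]mpoly0_const => f0; apply: mpolyC_unit.
  by apply: contraNneq f0 => ->; rewrite mpolyC0.
split; last by move=> x [x0 /negP[]]; apply: unit0.
by exists (fun=> 0%N); split=> // a a0; rewrite unit0.
Qed.

Section Uni.
Variable n : nat.

(** The inverse of [muni]: the last variable is put back for the polynomial variable, over widened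
    coefficients. *)
Definition multi (f : {poly mpoly n F}) : mpoly n.+1 F :=
  (map_poly (@mwiden n F) f).[mpolyX F (mnm1 ord_max)].

Lemma multi_zmod : zmod_morphism multi.
Proof. by move=> f g; rewrite /multi rmorphB hornerD hornerN. Qed.

Lemma multi_monoid : monoid_morphism multi.
Proof. by split=> [|f g]; rewrite /multi ?rmorph1 ?hornerC // rmorphM hornerM. Qed.

HB.instance Definition _ := GRing.isZmodMorphism.Build _ _ multi multi_zmod.
HB.instance Definition _ := GRing.isMonoidMorphism.Build _ _ multi multi_monoid.

Definition narrow (m : multinom n.+1) : multinom n :=
  Multinom [tuple m (widen_ord (leqnSn n) i) | i < n].

Lemma muni_sum (f : mpoly n.+1 F) :
  muni f = \sum_(m <- msupp f) mcoeff m f *: mpolyX F (narrow m) *: 'X^(m ord_max).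
Proof. exact: muniE. Qed.

Lemma muni_X m : muni (mpolyX F m : mpoly n.+1 F) = mpolyX F (narrow m) *: 'X^(m ord_max).
Proof. by rewrite muni_sum msuppX big_seq1 mcoeffX eqxx scale1r. Qed.

Lemma widen_narrow (m : multinom n.+1) :
  mpolyX F m = mpolyX F (mnmwiden (narrow m)) * mpolyX F (mnm1 ord_max) ^+ m ord_max.
Proof.
rewrite mpolyXn -mpolyXD; congr (mpolyX _ _); apply/mnmP => i.
rewrite mnmDE mulmnE mnm1E; have [hi|hi] := eqVneq ord_max i.
  by rewrite -hi mnmwiden_ordmax add0n mul1n.
have hin : (i < n)%N.
  by rewrite ltn_neqAle -ltnS ltn_ord andbT; apply: contraNneq hi => h; apply/eqP/val_inj.
have -> : i = widen_ord (leqnSn n) (Ordinal hin) by apply: val_inj.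
by rewrite mnmwiden_widen mnmE mul0n addn0.
Qed.

Lemma narrow_widen (m : multinom n) : narrow (mnmwiden m) = m.
Proof. by apply/mnmP => i; rewrite mnmE mnmwiden_widen. Qed.

Lemma muniK : cancel (@muni n F) multi.
Proof.
move=> f; rewrite {2}[f]mpolyE muni_sum raddf_sum /=; apply: eq_bigr => m _.
rewrite /multi map_polyZ map_polyXn hornerZ hornerXn /= mwidenZ mwidenX.
by rewrite -scalerAl -widen_narrow.
Qed.

Lemma muni_widen (g : mpoly n F) : muni (mwiden g) = g%:P.
Proof.
rewrite [in LHS](mpolyE g) (raddf_sum (@mwiden n F)) (raddf_sum (@muni n F)).
rewrite [in RHS](mpolyE g) (raddf_sum polyC); apply: eq_bigr => m _ /=.
rewrite mwidenZ mwidenX muniZ muni_X mnmwiden_ordmax narrow_widen expr0 scalerA.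
by rewrite mul_mpolyC alg_polyC.
Qed.

Lemma multiK : cancel multi (@muni n F).
Proof.
have muni_max : muni (mpolyX F (mnm1 ord_max) : mpoly n.+1 F) = 'X.
  rewrite muni_X mnm1E eqxx expr1; have -> : narrow (mnm1 ord_max) = mnm0.
    apply/mnmP => i; rewrite mnmE mnm0E mnm1E; case: eqP => // h.
    by have := ltn_ord i; rewrite -[X in (_ < X)%N]/(val (@ord_max n)) h /= ltnn.
  by rewrite mpolyX0 scale1r.
move=> f; elim/poly_ind: f => [|f c IH]; first by rewrite !raddf0.
rewrite (raddfD multi) /=.
have -> : multi (f * 'X) = multi f * multi 'X by exact: (multi_monoid.2).
rewrite muniD muniM IH; congr (_ * _ + _).
  by rewrite /multi map_polyX hornerX muni_max.
by rewrite /multi map_polyC hornerC muni_widen.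
Qed.

Lemma factorial_mpolyS : factorial_domain (mpoly n F) -> factorial_domain (mpoly n.+1 F).
Proof.
by move=> h; apply: (factorial_transport muniK multiK); apply: factorial_poly.
Qed.

End Uni.

Lemma factorial_mpoly n : factorial_domain (mpoly n F).
Proof. by elim: n => [|n IH]; [exact: factorial_mpoly0 | exact: factorial_mpolyS]. Qed.

End MultivariatePolynomials.

Local Notation "x %:F" := (@FracField.tofrac _ x).

(** * Evaluation and valuations on fraction fields *)

Section Fractions.
Variable D : idomainType.
Implicit Types (z : {fraction D}) (a b : D).

Lemma denom_neq0 z : denom z != 0.
Proof. exact: denom_ratioP. Qed.

Lemma frac_numden z : z = (numer z)%:F / (denom z)%:F.
Proof.
have hd := denom_neq0 z; rewrite /numer /denom in hd *.
rewrite -[LHS]reprK; move: (repr z) hd => x hd.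
rewrite !piE; apply/eqmodP; rewrite /= FracField.equivfE /FracField.mulf /FracField.invf.
by rewrite !numden_Ratio ?mulf_neq0 ?oner_neq0 //= ?mul1r ?mulr1 // mulrC.
Qed.

Lemma numer_eq0 z : (numer z == 0) = (z == 0).
Proof.
rewrite [z in RHS]frac_numden mulf_eq0 invr_eq0 !tofrac_eq0.
by rewrite (negbTE (denom_neq0 z)) orbF.
Qed.

(** [numer] and [denom] belong to a chosen representative that may not be in lowest terms;
    cross-multiplication compares it with any other presentation. *)
Lemma frac_cross z a b : b != 0 -> z = a%:F / b%:F -> numer z * b = a * denom z.
Proof.
move=> b0; rewrite {1}[z]frac_numden => /eqP.
rewrite eqr_div ?tofrac_eq0 ?denom_neq0 //.
by rewrite -!rmorphM tofrac_eq mulrC [b * _]mulrC => /eqP; rewrite mulrC.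
Qed.

Section Eval.
Variables (K : fieldType) (h : {rmorphism D -> K}).
Hypothesis hinj : forall a, a != 0 -> h a != 0.

Definition frac_eval z : K := h (numer z) / h (denom z).

Lemma frac_evalE z a b : b != 0 -> z = a%:F / b%:F -> frac_eval z = h a / h b.
Proof.
move=> b0 /(frac_cross b0) e; apply/eqP.
by rewrite eqr_div ?hinj ?denom_neq0 // -!rmorphM e.
Qed.

Lemma frac_eval_zmod : zmod_morphism frac_eval.
Proof.
move=> x y; have dx := denom_neq0 x; have dy := denom_neq0 y.
rewrite (@frac_evalE (x - y) (numer x * denom y - numer y * denom x) (denom x * denom y)).
- by rewrite /frac_eval rmorphB !rmorphM; field; rewrite !hinj.
- by rewrite mulf_neq0.
rewrite {1}[x]frac_numden {1}[y]frac_numden -mulNr addf_div ?tofrac_eq0 //.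
by rewrite mulNr rmorphB !rmorphM.
Qed.

Lemma frac_eval_monoid : monoid_morphism frac_eval.
Proof.
split=> [|x y].
  by rewrite (@frac_evalE 1 1 1) ?oner_neq0 ?rmorph1 ?divr1.
have dx := denom_neq0 x; have dy := denom_neq0 y.
rewrite (@frac_evalE (x * y) (numer x * numer y) (denom x * denom y)).
- by rewrite /frac_eval !rmorphM; field; rewrite !hinj.
- by rewrite mulf_neq0.
by rewrite {1}[x]frac_numden {1}[y]frac_numden mulf_div !rmorphM.
Qed.

Definition frac_eval_rmorphism : {rmorphism {fraction D} -> K} :=
  HB.pack frac_eval
    (GRing.isZmodMorphism.Build _ _ frac_eval frac_eval_zmod)
    (GRing.isMonoidMorphism.Build _ _ frac_eval frac_eval_monoid).

End Eval.

Section FracValuation.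
Variable ord : D -> int.
Hypotheses (ordM : forall a b, a != 0 -> b != 0 -> ord (a * b) = ord a + ord b)
  (ordD : forall a b, a != 0 -> b != 0 -> a + b != 0 -> Num.min (ord a) (ord b) <= ord (a + b)).

Definition frac_val z : \bar int :=
  if z == 0 then +oo%E else (ord (numer z) - ord (denom z))%:E.

Lemma frac_valE z a b : a != 0 -> b != 0 -> z = a%:F / b%:F ->
  frac_val z = (ord a - ord b)%:E.
Proof.
move=> a0 b0 e; have z0 : z != 0 by rewrite e mulf_neq0 ?invr_eq0 ?tofrac_eq0.
have := frac_cross b0 e => /(congr1 ord).
rewrite !ordM ?numer_eq0 ?denom_neq0 // /frac_val (negbTE z0) => h.
by congr EFin; lia.
Qed.

Lemma frac_valuation : valuation frac_val.
Proof.
split=> [|x x0|x y|x y].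
- by rewrite /frac_val eqxx.
- by rewrite /frac_val (negbTE x0).
- have [->|x0] := eqVneq x 0; first by rewrite mul0r /frac_val eqxx; case: ifP; rewrite ?addye.
  have [->|y0] := eqVneq y 0; first by rewrite mulr0 /frac_val eqxx (negbTE x0) addey.
  have dx := denom_neq0 x; have dy := denom_neq0 y.
  have nx : numer x != 0 by rewrite numer_eq0.
  have ny : numer y != 0 by rewrite numer_eq0.
  rewrite (@frac_valE (x * y) (numer x * numer y) (denom x * denom y)) ?mulf_neq0 //.
    by rewrite /frac_val (negbTE x0) (negbTE y0) -EFinD !ordM //; congr EFin; ring.
  by rewrite {1}[x]frac_numden {1}[y]frac_numden mulf_div !rmorphM.
- have [->|x0] := eqVneq x 0; first by rewrite add0r {1}/frac_val eqxx minye.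
  have [->|y0] := eqVneq y 0; first by rewrite addr0 [X in Order.min _ X]/frac_val eqxx miney.
  have [->|xy0] := eqVneq (x + y) 0; first by rewrite [X in (_ <= X)%E]/frac_val eqxx leey.
  have dx := denom_neq0 x; have dy := denom_neq0 y.
  have nx : numer x != 0 by rewrite numer_eq0.
  have ny : numer y != 0 by rewrite numer_eq0.
  have e : x + y = (numer x * denom y + numer y * denom x)%:F / (denom x * denom y)%:F.
    rewrite {1}[x]frac_numden {1}[y]frac_numden addf_div ?tofrac_eq0 //.
    by rewrite rmorphD !rmorphM.
  have n0 : numer x * denom y + numer y * denom x != 0.
    by apply: contraNneq xy0 => h; rewrite e h rmorph0 mul0r.
  rewrite (frac_valE n0 _ e) ?mulf_neq0 // /frac_val (negbTE x0) (negbTE y0).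
  have := ordD _ _ n0; rewrite ?mulf_neq0 // => /(_ isT isT); rewrite !ordM //.
  rewrite -EFin_min lee_fin !ge_min; rewrite ?ge_min => /orP[h|h]; apply/orP; [left|right].
    by rewrite lerBlDr opprD addrA addrAC subrK lerBrDr.
  by rewrite lerBlDr opprD addrA subrK lerBrDr.
Qed.

End FracValuation.
End Fractions.

Lemma divides_exp_unitl (D : idomainType) (s P f : D) k : s \is a GRing.unit ->
  divides ((s * P) ^+ k) f <-> divides (P ^+ k) f.
Proof.
move=> us; split=> -[u ->]; first by exists (u * s ^+ k); rewrite exprMn mulrA.
by exists (u * s ^- k); rewrite exprMn -mulrA mulKr // unitrX.
Qed.

(** * Order valuations and the valuation at infinity *)

Section RationalFunctionValuations.
Variables (n : nat) (F : fieldType).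
Implicit Types (P Q f g : mpoly n F).

Lemma mpoly_irreducible_prime P : mpoly_irreducible P -> prime_elt P.
Proof. by case: (factorial_mpoly F n) => _ h; apply: h. Qed.

Lemma prime_mpoly_irreducible P : prime_elt P -> mpoly_irreducible P.
Proof.
move=> [P0 uP pP]; split=> // a b e.
have [|[s hs]|[s hs]] := pP a b; first by exists 1; rewrite mul1r.
  right; apply/unitrPr; exists s; apply: (mulIf P0).
  by rewrite mul1r [RHS]e {1}hs; ring.
left; apply/unitrPr; exists s; apply: (mulIf P0).
by rewrite mul1r [RHS]e {1}hs; ring.
Qed.

Lemma mdegreeM f g : f != 0 -> g != 0 -> mdegree (f * g) = (mdegree f + mdegree g)%N.
Proof.
move=> f0 g0; rewrite /mdegree msizeM //.
move: f0 g0; rewrite -!msize_poly_eq0; case: (msize f) => // u _; case: (msize g) => // v _.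
by rewrite addSn addnS.
Qed.

Lemma mdegree0_const f : mdegree f = 0%N -> f = mpolyC n (mcoeff mnm0 f).
Proof. by rewrite /mdegree => h; apply: msize1_polyC; case: (msize f) h => // -[]. Qed.

Lemma mdegree_unit f : f != 0 -> mdegree f = 0%N -> f \is a GRing.unit.
Proof.
move=> f0 /mdegree0_const e; rewrite e; apply: mpolyC_unit.
by apply: contraNneq f0 => h; rewrite e h mpolyC0.
Qed.

Lemma irreducible_mdegree P : mpoly_irreducible P -> (0 < mdegree P)%N.
Proof.
by move=> [P0 uP _]; rewrite lt0n; apply: contra uP => /eqP; apply: mdegree_unit.
Qed.

Section Order.
Variable P : mpoly n F.
Hypothesis irrP : mpoly_irreducible P.
Let P0 : P != 0. Proof. by case: irrP. Qed.
Let pP : forall a b, divides P (a * b) -> divides P a \/ divides P b.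
Proof. by have [] := mpoly_irreducible_prime irrP. Qed.

Lemma mpoly_order_eq Q s k : Q = s * P ^+ k -> ~ divides P s -> mpoly_order P Q = k.
Proof.
move=> e ns.
have hk : [set k | mpoly_dvd (P ^+ k) Q /\ ~ mpoly_dvd (P ^+ k.+1) Q] k.
  split; first by exists s.
  move=> [u hu]; apply: ns; exists u.
  by apply: (mulIf (expf_neq0 k P0)); rewrite -e hu exprS; ring.
rewrite /mpoly_order; case: xgetP => [m _ [[u hu] nm]|/(_ k)/(_ hk)//].
apply/eqP; rewrite eqn_leq; apply/andP; split; rewrite leqNgt; apply/negP => h.
  have [_ nk] := hk; apply: nk; exists (u * P ^+ (m - k.+1)).
  by rewrite -mulrA -exprD subnK.
apply: nm; exists (s * P ^+ (k - m.+1)).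
by rewrite -mulrA -exprD subnK.
Qed.

Lemma mpoly_order_factor Q : Q != 0 ->
  exists2 s, Q = s * P ^+ mpoly_order P Q & ~ divides P s.
Proof.
move=> Q0; suff [k [s [e ns]]] : exists k s, Q = s * P ^+ k /\ ~ divides P s.
  by exists s; rewrite // (mpoly_order_eq e ns).
have [m] := ubnP (mdegree Q); elim: m Q Q0 => // m IH Q Q0 hm.
have [[s hs]|h] := pselect (divides P Q); last by exists 0%N, Q; rewrite mulr1.
have s0 : s != 0 by apply: contraNneq Q0 => h; rewrite hs h mul0r.
have [|k [u [e nu]]] := IH s s0.
  by move: hm; rewrite hs mdegreeM //; have := irreducible_mdegree irrP; lia.
by exists k.+1, u; split=> //; rewrite hs e exprSr mulrA.
Qed.

Lemma mpoly_orderM f g : f != 0 -> g != 0 ->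
  mpoly_order P (f * g) = (mpoly_order P f + mpoly_order P g)%N.
Proof.
move=> /mpoly_order_factor[s ef ns] /mpoly_order_factor[u eg nu].
apply: (@mpoly_order_eq _ (s * u)); last by move=> /pP[].
by rewrite exprD mulrACA -ef -eg.
Qed.

Lemma mpoly_order_ge Q s k : Q != 0 -> Q = s * P ^+ k -> (k <= mpoly_order P Q)%N.
Proof.
move=> Q0 e; have s0 : s != 0 by apply: contraNneq Q0 => h; rewrite e h mul0r.
have [u es nu] := mpoly_order_factor s0.
have -> : mpoly_order P Q = (mpoly_order P s + k)%N.
  by apply: (@mpoly_order_eq Q u) nu; rewrite exprD mulrA -es.
exact: leq_addl.
Qed.

Lemma mpoly_order1 : mpoly_order P 1 = 0%N.
Proof.
apply: (@mpoly_order_eq _ 1); first by rewrite mulr1.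
move=> [s hs]; have [_ uP _] := irrP; case/negP: uP; apply/unitrPr; exists s.
by rewrite mulrC -hs.
Qed.

Lemma mpoly_order_self : mpoly_order P P = 1%N.
Proof.
apply: (@mpoly_order_eq _ 1); first by rewrite mul1r.
move=> [s hs]; have [_ uP _] := irrP; case/negP: uP; apply/unitrPr; exists s.
by rewrite mulrC -hs.
Qed.

Lemma mpoly_order_gt0 Q : Q != 0 -> (0 < mpoly_order P Q)%N -> divides P Q.
Proof.
move=> /mpoly_order_factor[s e _]; case: (mpoly_order P Q) e => // k e _.
by exists (s * P ^+ k); rewrite -mulrA -exprSr.
Qed.

Lemma mpoly_order_ndvd Q : ~ divides P Q -> mpoly_order P Q = 0%N.
Proof. by move=> h; apply: mpoly_order_eq h; rewrite mulr1. Qed.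

Let ord Q : int := mpoly_order P Q.

Lemma order_valuationE : order_valuation P = frac_val ord.
Proof. by []. Qed.

Let ordM a b : a != 0 -> b != 0 -> ord (a * b) = ord a + ord b.
Proof. by move=> a0 b0; rewrite /ord mpoly_orderM // PoszD. Qed.

Let ordD a b : a != 0 -> b != 0 -> a + b != 0 -> Num.min (ord a) (ord b) <= ord (a + b).
Proof.
move=> /mpoly_order_factor[s ea _] /mpoly_order_factor[u eb _] ab0.
rewrite /ord ge_min !lez_nat; have [h|h] := leqP (mpoly_order P a) (mpoly_order P b).
  apply/orP; left; apply: (@mpoly_order_ge _ (s + u * P ^+ (mpoly_order P b - mpoly_order P a)) _ ab0).
  by rewrite mulrDl -mulrA -exprD subnK // -ea -eb.
apply/orP; right; apply: (@mpoly_order_ge _ (s * P ^+ (mpoly_order P a - mpoly_order P b) + u) _ ab0).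
by rewrite mulrDl -mulrA -exprD subnK 1?ltnW // -ea -eb.
Qed.

Lemma order_valuation_normalized : normalized_valuation (order_valuation P).
Proof.
have [h1 h2 h3 h4] := frac_valuation ordM ordD.
rewrite order_valuationE; split=> //; exists (P%:F).
rewrite (frac_valE ordM P0 (oner_neq0 _)) ?rmorph1 ?divr1 //.
by rewrite /ord mpoly_order1 mpoly_order_self.
Qed.

Lemma order_valuation_frac f g : f != 0 -> g != 0 ->
  order_valuation P (f%:F / g%:F) = ((mpoly_order P f)%:Z - (mpoly_order P g)%:Z)%:E.
Proof. by move=> f0 g0; rewrite order_valuationE (frac_valE ordM f0 g0). Qed.

End Order.

Let dord f : int := - (mdegree f)%:Z.

Let dordM a b : a != 0 -> b != 0 -> dord (a * b) = dord a + dord b.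
Proof. by move=> a0 b0; rewrite /dord mdegreeM // PoszD opprD. Qed.

Let dordD a b : a != 0 -> b != 0 -> a + b != 0 -> Num.min (dord a) (dord b) <= dord (a + b).
Proof.
move=> a0 b0 ab0; rewrite /dord ge_min !lerN2 !lez_nat.
have := msizeD_le a b; rewrite leq_max => /orP[h|h]; apply/orP; [left|right];
  by rewrite /mdegree -!subn1 leq_sub2r.
Qed.

Lemma infinity_valuationE : @infinity_valuation n F = frac_val dord.
Proof.
by apply/funext => z; rewrite /infinity_valuation /frac_val /dord opprK addrC.
Qed.

Lemma infinity_valuation_normalized :
  normalized_valuation (@infinity_valuation n F) \/
  (valuation (@infinity_valuation n F) /\ forall z, (0 <= @infinity_valuation n F z)%E).
Proof.
rewrite infinity_valuationE; have hv := frac_valuation dordM dordD.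
have [hn|hn] := posnP n; [right|left].
  split=> // z; have [->|z0] := eqVneq z 0; first by rewrite (val0 hv) leey.
  have hd f : mdegree f = 0%N.
    rewrite /mdegree; have : (msize f <= 1)%N; last by case: (msize f) => // -[].
    rewrite msizeE; apply/bigmax_leqP_seq => m _ _.
    by rewrite ltnS leqn0 mdeg_eq0; apply/eqP/mnmP => i; have := ltn_ord i; rewrite [in X in (_ < X)%N]hn.
  by rewrite /frac_val (negbTE z0) /dord !hd.
have [h1 h2 h3 h4] := hv; split=> //.
pose X := mpolyX F (mnm1 (Ordinal hn)).
have X0 : X != 0 by rewrite -msize_poly_eq0 msizeX.
exists (1%:F / X%:F); rewrite (frac_valE dordM (oner_neq0 _) X0) //.
by rewrite /dord /mdegree msize1 msizeX mdeg1.
Qed.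

Lemma infinity_valuation_poly f : f != 0 -> (0 <= infinity_valuation f%:F)%E -> mdegree f = 0%N.
Proof.
move=> f0; rewrite infinity_valuationE (frac_valE dordM f0 (oner_neq0 _)).
  by rewrite /dord /mdegree msize1 /= oppr0 addr0 lee_fin; lia.
by rewrite rmorph1 divr1.
Qed.

(** Valuations are counted as functions, so associated irreducible polynomials count once;
    [finite_prime_divisors] rests on this. *)
Lemma associate_order P Q : mpoly_irreducible P -> mpoly_irreducible Q -> divides P Q ->
  order_valuation P = order_valuation Q.
Proof.
move=> [P0 uP _] [Q0 uQ hQ] [s e].
have h := hQ _ _ e.
have us : s \is a GRing.unit.
  case: h => //.
  by move/(negP uP).
have hdvd k f : mpoly_dvd (P ^+ k) f = mpoly_dvd (Q ^+ k) f.
  rewrite e; apply: propext; apply: iff_sym; exact: (divides_exp_unitl P f k us).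
have ho f : mpoly_order P f = mpoly_order Q f.
  have hset : [set k | mpoly_dvd (P ^+ k) f /\ ~ mpoly_dvd (P ^+ k.+1) f] =
              [set k | mpoly_dvd (Q ^+ k) f /\ ~ mpoly_dvd (Q ^+ k.+1) f].
    by apply/funext => k; rewrite /mkset (hdvd k f) (hdvd k.+1 f).
  exact: (congr1 (xget 0%N) hset).
by apply/funext => z; rewrite /order_valuation !ho.
Qed.

Lemma finite_prime_divisors g : g != 0 ->
  finite_set [set v | exists P, [/\ mpoly_irreducible P, divides P g & v = order_valuation P]].
Proof.
move: g; apply: (factorial_ind (factorial_mpoly F n)) => [g ug|Q g pQ g0 IH].
  rewrite (_ : [set v | _] = set0) //; apply/seteqP; split=> // v [P [[_ uP _] [s e] _]].
  by move: ug; rewrite e unitrM (negbTE uP) andbF.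
apply: (@sub_finite_set _ _ ([set v | exists P, [/\ mpoly_irreducible P, divides P g &
  v = order_valuation P]] `|` [set order_valuation Q])).
  move=> v [P [irrP dP ->]]; have [_ _ pP] := mpoly_irreducible_prime irrP.
  have [h|h] := pP _ _ dP; first by left; exists P.
  by right; apply: associate_order => //; apply: prime_mpoly_irreducible.
by rewrite finite_setU; split.
Qed.

Lemma prime_divisor_exists g : g != 0 -> g \isn't a GRing.unit ->
  exists2 P, mpoly_irreducible P & divides P g.
Proof.
move: g; apply: (factorial_ind (factorial_mpoly F n)) => [g ->//|Q g pQ _ _ _].
by exists Q; [exact: prime_mpoly_irreducible | exists g].
Qed.

Lemma frac_lowest_terms (z : {fraction mpoly n F}) : z != 0 ->
  exists f g, [/\ f != 0, g != 0, z = f%:F / g%:F &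
    forall P, mpoly_irreducible P -> divides P g -> ~ divides P f].
Proof.
move=> z0.
have [m] := ubnP (mdegree (denom z)); move: (frac_numden z) (denom_neq0 z).
have : numer z != 0 by rewrite numer_eq0.
move: (numer z) (denom z) => f g; elim: m f g => // m IH f g f0 e g0 hm.
have [[P [irrP dg df]]|hn] := pselect (exists P,
    [/\ mpoly_irreducible P, divides P g & divides P f]); last first.
  by exists f, g; split=> // P irrP dg df; apply: hn; exists P.
have [P0 _ _] := irrP; have [f' ef] := df; have [g' eg] := dg.
have f'0 : f' != 0 by apply: contraNneq f0 => h; rewrite ef h mul0r.
have g'0 : g' != 0 by apply: contraNneq g0 => h; rewrite eg h mul0r.
apply: (IH f' g') => //.
  by rewrite e ef eg !rmorphM -mulf_div divff ?tofrac_eq0 // mulr1.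
by move: hm; rewrite eg mdegreeM //; have := irreducible_mdegree irrP; lia.
Qed.

Section GoodSystem.
Variables (R : realType) (p : nat).
Hypotheses (hp : p \in [pchar F]) (hF : forall c : F, constant p c).

(** In lowest terms an irreducible factor of the denominator is a pole, so integrality at all [P]
    leaves a polynomial and integrality at infinity a constant of [F]. The bound 1 holds because
    irreducible polynomials have positive degree. *)
Lemma ratfun_good_system : good_system p (@ratfun_valuations n F R) 1.
Proof.
split.
- move=> _ [[P irrP ->]|->] /=; first by left; exact: order_valuation_normalized.
  exact: infinity_valuation_normalized.
- move=> z hz; have [->|z0] := eqVneq z 0.
    by exists 1%N => //; rewrite expr0n expn1; case: (p) (pcharf_prime hp).
  have [f [g [f0 g0 e hfg]]] := frac_lowest_terms z0.
  have [ug|ug] := boolP (g \is a GRing.unit); last first.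
    have [P irrP dg] := prime_divisor_exists g0 ug.
    have := hz (order_valuation P, (mdegree P)%:R) (or_introl (ex_intro2 _ _ P irrP erefl)).
    rewrite /= e order_valuation_frac // (mpoly_order_ndvd irrP (hfg P irrP dg)).
    have [s es _] := mpoly_order_factor irrP g0.
    have [u eu] := dg; have := mpoly_order_ge irrP g0 (s := u) (k := 1).
    by rewrite expr1 lee_fin => /(_ eu); lia.
  have ez : z = (f * g^-1)%:F.
    by rewrite e rmorphM; congr (_ * _); rewrite rmorphV.
  have fg0 : f * g^-1 != 0 by rewrite mulf_neq0 ?invr_eq0.
  have := hz (@infinity_valuation n F, 1) (or_intror erefl); rewrite /= ez.
  move=> /(infinity_valuation_poly fg0)/mdegree0_const ->.
  have [N N0 hN] := hF (mcoeff mnm0 (f * g^-1)); exists N => //.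
  by rewrite -rmorphXn -rmorphXn hN.
- move=> z; have [->|z0] := eqVneq z 0.
    rewrite (_ : [set v | _] = set0) //; apply/seteqP; split=> // v [[d hv]].
    by case: hv => [[P irrP [-> _]]|[-> _]]; rewrite /order_valuation /infinity_valuation eqxx.
  apply: (@sub_finite_set _ _ ([set v | exists P, [/\ mpoly_irreducible P,
      divides P (denom z) & v = order_valuation P]] `|` [set @infinity_valuation n F])).
    move=> v [[d [[P irrP [-> _]]|[-> _]]] vz]; [left|by right].
    exists P; split=> //; apply: (mpoly_order_gt0 irrP); first exact: denom_neq0.
    by move: vz; rewrite /order_valuation (negbTE z0) lte_fin; lia.
  by rewrite finite_setU; split=> //; apply/finite_prime_divisors/denom_neq0.
- move=> _ [[P irrP ->]|->] //=.
  by rewrite ler1n irreducible_mdegree.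
Qed.

End GoodSystem.
End RationalFunctionValuations.

(** * Drinfeld modules over curves *)

Section FieldsOfCharacteristicP.
Variables (p : nat) (K : fieldType).
Hypothesis hp : p \in [pchar K].

(** A finite subfield that contains the generators contains all quotients of polynomial expressions
    in them, hence all of [K]. *)
Lemma finite_of_finitely_generated (E : fieldType) (j : {rmorphism E -> K}) :
  finitely_generated_field (@prime_field_map p K) ->
  (forall y, algebraicOver j y) -> finite_embedding j.
Proof.
move=> [m [g hg]] halg; have [S hS Sg] := fs_adjoin_family (fun i => halg (g i)).
have Snat n : S n%:R by rewrite -(rmorph_nat j); apply: (fs_img hS).
have Smap (Q : mpoly m 'F_p) : S (mmap (@prime_field_map p K) g Q).
  apply: (fs_sum hS) => mm _; apply: (fs_mul hS); first exact: Snat.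
  by apply: (fs_prod hS) => i _; apply: (fs_exp hS).
have [N [b hb]] := fs_span hS; exists N, b => y; apply: hb.
have [Q1 [Q2 [_ ->]]] := hg y; apply: (fs_mul hS) => //; exact: (fs_inv hS).
Qed.

Lemma constant_nat n : constant p (n%:R : K).
Proof.
by exists 1%N => //; rewrite expn1; exact: (pFrobenius_aut_nat hp).
Qed.

Lemma prime_field_map_eq0 (c : 'F_p) : (prime_field_map K c == 0) = (c == 0).
Proof.
have pp := pcharf_prime hp.
rewrite /prime_field_map -(dvdn_pcharf hp); apply/idP/eqP => [h|->]; last exact: dvdn0.
apply/val_inj => /=; apply/eqP; apply: contraTT h; rewrite -lt0n => h.
by rewrite gtnNdvd //; have := ltn_ord c; rewrite [X in (_ < X)%N](Fp_cast pp).
Qed.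

Lemma algebraic_constant (y : K) : algebraicOver (@prime_field_map p K) y -> constant p y.
Proof.
move=> [f f0 hf]; have map0 : prime_field_map K (0 : 'F_p) = 0 by apply/eqP; rewrite prime_field_map_eq0.
apply: (root_of_constant hp (f := map_poly (@prime_field_map p K) f)) => //.
  rewrite -lead_coef_eq0 in f0; apply: contra f0 => /eqP h.
  have := congr1 (fun g : {poly K} => g`_(size f).-1) h.
  by rewrite coef_map_id0 // coef0 -lead_coefE => /eqP; rewrite prime_field_map_eq0.
by move=> i; rewrite coef_map_id0 //; apply: constant_nat.
Qed.

End FieldsOfCharacteristicP.

Section RationalFunctionSubfield.
Variables (n : nat) (F K : fieldType) (k : {rmorphism F -> K}) (g : 'I_n -> K).
Hypothesis hg : forall Q : mpoly n F, Q != 0 -> mmap k g Q != 0.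

(** Its function is [ratfun_eval k g] by conversion, so results on field embeddings apply to
    [good_valuations]. *)
Definition ratfun_rmorphism : {rmorphism {fraction (mpoly n F)} -> K} :=
  frac_eval_rmorphism (h := mmap k g) hg.

End RationalFunctionSubfield.

Lemma mulf_cancel (K : fieldType) (a b c : K) : b != 0 -> b * c * (a / b) = c * a.
Proof. by move=> b0; field. Qed.

Section ClearDenominators.
Variables (D : idomainType) (K : fieldType) (h : {rmorphism D -> K}).
Hypothesis hinj : forall a, a != 0 -> h a != 0.
Let j := frac_eval_rmorphism hinj.

Lemma frac_eval_tofrac a : j a%:F = h a.
Proof.
rewrite /j /= (@frac_evalE _ _ _ hinj _ a 1) ?oner_neq0 ?rmorph1 ?divr1 //.
Qed.

Lemma common_denominator (f : {poly {fraction D}}) : exists c (d : {poly D}),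
  c != 0 /\ c%:F *: f = map_poly (@FracField.tofrac D) d.
Proof.
elim/poly_ind: f => [|f z [c [d [c0 e]]]].
  by exists 1, 0; rewrite oner_neq0 scaler0 rmorph0.
exists (denom z * c), (denom z *: d * 'X + (c * numer z)%:P).
split; first by rewrite mulf_neq0 ?denom_neq0.
rewrite (rmorphD (map_poly _)) (rmorphM (map_poly _)) /= map_polyX map_polyC map_polyZ /= -e.
rewrite scalerDr scalerA (rmorphM (@FracField.tofrac D)) -scalerAl; congr (_ + _).
rewrite -mul_polyC -polyCM; congr (_%:P); move: (frac_numden z) (denom_neq0 z).
move: (numer z) (denom z) => a b -> b0.
by rewrite !(rmorphM (@FracField.tofrac D)) mulf_cancel ?tofrac_eq0.
Qed.

Lemma clear_denominators y : algebraicOver j y ->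
  exists2 d : {poly D}, d != 0 & (map_poly h d).[y] = 0.
Proof.
move=> [f f0 /rootP hf]; have [c [d [c0 e]]] := common_denominator f; exists d.
  apply: contraNneq f0 => d0; move: e; rewrite d0 rmorph0 => /eqP.
  by rewrite scaler_eq0 tofrac_eq0 (negbTE c0).
have -> : map_poly h d = h c *: map_poly j f.
  rewrite -frac_eval_tofrac -map_polyZ e -map_poly_comp; apply: eq_map_poly => a /=.
  exact/esym/frac_eval_tofrac.
by rewrite hornerZ hf mulr0.
Qed.

Lemma algebraic_of_relation y (d : {poly D}) : d != 0 -> (map_poly h d).[y] = 0 ->
  algebraicOver j y.
Proof.
move=> d0 hd; exists (map_poly (@FracField.tofrac D) d).
  by rewrite map_poly_eq0_id0 // tofrac_eq0 lead_coef_eq0.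
rewrite rootE -map_poly_comp -[X in _ == X]hd; apply/eqP; congr (_.[y]).
by apply: eq_map_poly => a /=; exact: frac_eval_tofrac.
Qed.

End ClearDenominators.

(** * Algebraic relations between two functions on a curve *)

Section CurveRelations.
Variables (F C : fieldType) (k : {rmorphism F -> C}).

Definition poly_ev (y : C) : {rmorphism {poly F} -> C} := horner_eval y \o map_poly k.

Lemma poly_evE y f : poly_ev y f = (map_poly k f).[y].
Proof. by []. Qed.

Lemma poly_ev_inj y : nonconstant k y -> forall f, f != 0 -> poly_ev y f != 0.
Proof.
by move=> hy f f0; apply/negP => /eqP h; apply: hy; exists f => //; apply/rootP.
Qed.

Lemma poly_ev_swap (y z : C) (u : {poly {poly F}}) :
  (map_poly (poly_ev y) (polyXY.swapXY u)).[z] = (map_poly (poly_ev z) u).[y].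
Proof.
elim/poly_ind: u => [|u c IH]; first by rewrite !rmorph0 !horner0.
rewrite !rmorphD !rmorphM /= !hornerD !hornerM IH; congr (_ * _ + _).
  rewrite polyXY.swapXY_X map_polyX hornerX map_polyC hornerC.
  by rewrite /= /horner_eval map_polyX hornerX.
rewrite polyXY.swapXY_polyC [in RHS]map_polyC hornerC -map_poly_comp.
rewrite [RHS]poly_evE; congr (_.[z]); apply: eq_map_poly => a /=.
by rewrite /horner_eval map_polyC hornerC.
Qed.

Hypothesis hC : exists g : 'I_1 -> C, transcendence_basis k g.

(* Transcendence degree one: [g] is algebraic over [F(b)], hence so is [y]. *)
Lemma curve_relation b y : nonconstant k b ->
  exists2 d : {poly {poly F}}, d != 0 & (map_poly (poly_ev b) d).[y] = 0.
Proof.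
move=> hb; have [g [ginj galg]] := hC.
pose jg := ratfun_rmorphism ginj; pose jb := frac_eval_rmorphism (poly_ev_inj hb).
pose to_poly : {rmorphism mpoly 1 F -> {poly F}} := mmap polyC (fun=> 'X).
have to_polyE Q : poly_ev (g ord0) (to_poly Q) = mmap k g Q.
  rewrite -[to_poly Q]/(mmap polyC (fun=> 'X) Q) /mmap rmorph_sum; apply: eq_bigr => m _.
  rewrite rmorphM; congr (_ * _); first by rewrite poly_evE map_polyC hornerC.
  rewrite /mmap1 !big_ord1 rmorphXn; congr (_ ^+ _).
  by rewrite poly_evE map_polyX hornerX.
(* Exchange: the relation of [b] over [F(g)], with its two variables swapped, is one of [g] over
   [F(b)]. It stays nontrivial because [b] is nonconstant. *)
have galgb : algebraicOver jb (g ord0).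
  have [d d0 hd] := clear_denominators (hinj := ginj) (galg b).
  apply: (@algebraic_of_relation _ _ _ _ _ (polyXY.swapXY (map_poly to_poly d))).
    rewrite polyXY.swapXY_eq0; apply: contra d0 => /eqP h; apply/eqP/polyP => i.
    rewrite coef0; apply: contrapT => /eqP di; have /eqP := ginj _ di; apply.
    by rewrite -to_polyE -coef_map h coef0 rmorph0.
  rewrite poly_ev_swap -map_poly_comp -[RHS]hd; congr (_.[b]).
  by apply: eq_map_poly => a; exact: to_polyE.
have galgbi i : algebraicOver jb (g i) by rewrite ord1.
have [S hS Sg] := fs_adjoin_family galgbi.
have SF c : S (k c).
  have -> : k c = jb (c%:P)%:F by rewrite frac_eval_tofrac poly_evE map_polyC hornerC.
  exact: (fs_img hS).
have Smap Q : S (mmap k g Q).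
  apply: (fs_sum hS) => m _; apply: (fs_mul hS) => //.
  by apply: (fs_prod hS) => i _; apply: (fs_exp hS).
have [f f0 /rootP hf] := galg y.
have [|S' [hS' _ S'y]] := @fs_adjoin _ _ jb S hS y.
  exists (map_poly jg f); split=> //; first by rewrite map_poly_eq0.
  by move=> i; rewrite coef_map; apply: (fs_mul hS); [exact: Smap | apply: (fs_inv hS); exact: Smap].
exact: clear_denominators (fs_algebraic hS' S'y).
Qed.

(* Divide the relation by [b] as long as possible. *)
Lemma curve_relation_primitive b y : nonconstant k b ->
  exists d : {poly {poly F}}, (map_poly (poly_ev b) d).[y] = 0 /\ exists i, d`_i`_0 != 0.
Proof.
move=> hb; have [d d0 hd] := curve_relation y hb.
have b0 : b != 0.
  by apply: contra_not_neq hb => ->; apply: algebraic0.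
have [i0 hi0] : exists i, d`_i != 0.
  by exists (size d).-1; rewrite -lead_coefE lead_coef_eq0.
(* The size of one fixed nonzero coefficient bounds the number of divisions. *)
have [n] := ubnP (size d`_i0); elim: n d d0 hd hi0 => // n IH d d0 hd hi0 hn.
have [h|hnx] := pselect (exists i, d`_i`_0 != 0); first by exists d.
have [s es] : divides ('X : {poly F})%:P d.
  apply/divides_polyC => i; have /factor_theorem[s e] : root d`_i 0.
    rewrite rootE horner_coef0; apply/negP => /negP h; apply: hnx; by exists i.
  by exists s; rewrite e polyC0 subr0.
have si0 : s`_i0 != 0 by apply: contraNneq hi0 => h; rewrite es coefMC h mul0r.
apply: (IH s) => //.
- by apply: contraNneq d0 => h; rewrite es h mul0r.
- move: hd; rewrite es rmorphM hornerM /= map_polyC hornerC /= /horner_eval map_polyX hornerX.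
  by move/eqP; rewrite mulf_eq0 (negbTE b0) orbF => /eqP.
- by move: hn; rewrite es coefMC size_mulX.
Qed.

End CurveRelations.

Lemma size_sum_top (K : fieldType) n (f : 'I_n -> {poly K}) (i0 : 'I_n) : f i0 != 0 ->
  (forall i, i != i0 -> (size (f i) < size (f i0))%N) -> size (\sum_i f i) = size (f i0).
Proof.
move=> f0 h; rewrite (bigD1 i0) //= size_polyDl //.
apply: (big_ind (fun g : {poly K} => size g < size (f i0))%N) => //.
- by rewrite size_poly0 size_poly_gt0.
- by move=> g1 g2 h1 h2; apply: leq_ltn_trans (size_polyD _ _) _; rewrite gtn_max h1.
Qed.

(** * Degrees and kernel of a Drinfeld module *)

Section DrinfeldOverCurve.
Variables (p q e : nat) (Fq : finFieldType) (C : fieldType) (k : {rmorphism Fq -> C}).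
Variables (A : comNzRingType) (emb : {rmorphism A -> C}).
Hypotheses (hFq : #|Fq| = q) (hemb : injective emb).

(** The image of a nonzero element of [Fq] satisfies [c ^+ q = c], so its valuation is 0
    everywhere. *)
Lemma constants_in_regular vinf : (1 < q)%N -> range emb = regular_away vinf ->
  exists kappa : {rmorphism Fq -> A}, forall c, emb (kappa c) = k c.
Proof.
move=> q1 hA.
have /choice[f hf] : forall c, exists a, emb a = k c.
  move=> c; suff : regular_away vinf (k c) by rewrite -hA => -[a _ h]; exists a.
  move=> v nv _; have hv := normalized_valuationW nv.
  have [->|c0] := eqVneq c 0; first by rewrite rmorph0 (val0 hv) leey.
  rewrite (val_exp_fixed hv q1) ?fmorph_eq0 //.
  by rewrite -rmorphXn -hFq expf_card.
have fB : zmod_morphism f by move=> x y; apply: hemb; rewrite rmorphB !hf rmorphB.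
have fM : monoid_morphism f.
  by split=> [|x y]; apply: hemb; rewrite ?rmorph1 ?rmorphM !hf ?rmorph1 ?rmorphM.
pose kappa : {rmorphism Fq -> A} := HB.pack f
  (GRing.isZmodMorphism.Build _ _ f fB) (GRing.isMonoidMorphism.Build _ _ f fM).
by exists kappa.
Qed.

Variable kappa : {rmorphism Fq -> A}.
Hypothesis hkappa : forall c, emb (kappa c) = k c.
Variables (K : fieldType) (i : {rmorphism A -> K}) (phi : A -> {poly K}).
Hypotheses (hp : p \in [pchar K]) (hq : q = (p ^ e)%N) (he : (0 < e)%N).
Hypothesis hphi : drinfeld_module q i phi.

Lemma mul_neq0 a b : a != 0 -> b != 0 -> a * b != 0 :> A.
Proof.
move=> a0 b0; rewrite -(inj_eq hemb) rmorph0 rmorphM mulf_neq0 //.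
  by rewrite -(rmorph0 emb) (inj_eq hemb).
by rewrite -(rmorph0 emb) (inj_eq hemb).
Qed.

Lemma drinfeld_size_mul a b : phi a != 0 -> phi b != 0 ->
  size (phi (a * b)) = (size (phi a) + size (phi b)).-1.
Proof.
by move=> a0 b0; rewrite (drinfeldM hphi); have [] := twisted_mul_lead hp hq he a0 b0.
Qed.

Lemma size_drinfeld_const c : c != 0 -> size (phi (kappa c)) = 1%N.
Proof.
move=> c0; have e1 : phi (kappa c * kappa c^-1) = 1.
  by rewrite -rmorphM mulfV // rmorph1 (drinfeld1 hphi).
have n1 : phi (kappa c) != 0.
  apply/eqP => h; move: e1; rewrite (drinfeldM hphi) h twisted_mul0 => /esym/eqP.
  by rewrite oner_eq0.
have n2 : phi (kappa c^-1) != 0.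
  apply/eqP => h; move: e1; rewrite mulrC (drinfeldM hphi) h twisted_mul0 => /esym/eqP.
  by rewrite oner_eq0.
have := drinfeld_size_mul n1 n2; rewrite e1 size_poly1.
move: n1 n2; rewrite -!size_poly_gt0; case: (size _) => // u _; case: (size _) => // w _.
by rewrite addSn addnS /=; case: u => // -[].
Qed.

Lemma size_drinfeld_monomial c b m : c != 0 -> phi b != 0 ->
  size (phi (kappa c * b ^+ m)) = (m * (size (phi b)).-1).+1.
Proof.
move=> c0 b0; have bm0 : phi (b ^+ m) != 0.
  by rewrite -size_poly_gt0 (drinfeld_exp hp hq he hphi).
rewrite drinfeld_size_mul // ?size_drinfeld_const //.
  by rewrite (drinfeld_exp hp hq he hphi).
by rewrite -size_poly_gt0 size_drinfeld_const.
Qed.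

(* The terms have distinct degrees in tau. *)
Lemma size_drinfeld_poly m (c : 'I_m -> Fq) b : (1 < size (phi b))%N ->
  (exists i, c i != 0) -> exists2 i0 : 'I_m, c i0 != 0 &
    size (phi (\sum_(i < m) kappa (c i) * b ^+ i)) = (i0 * (size (phi b)).-1).+1.
Proof.
move=> sb [i1 ci1]; have b0 : phi b != 0 by rewrite -size_poly_gt0 ltnW.
have [i0 ci0 imax] : exists2 i0 : 'I_m, c i0 != 0 & forall i, c i != 0 -> (i <= i0)%N.
  by case: (@arg_maxnP _ i1 (fun i => c i != 0) (@nat_of_ord m) ci1) => i0 h1 h2; exists i0.
exists i0 => //; rewrite (drinfeld_sum hphi) -(size_drinfeld_monomial i0 ci0 b0).
apply: (size_sum_top (f := fun i : 'I_m => phi (kappa (c i) * b ^+ i))).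
  by rewrite -size_poly_gt0 size_drinfeld_monomial.
move=> i' ii; rewrite [X in (_ < X)%N]size_drinfeld_monomial //.
have [->|ci] := eqVneq (c i') 0.
  by rewrite rmorph0 mul0r (drinfeld0 hphi) size_poly0.
rewrite size_drinfeld_monomial // ltnS ltn_pmul2r.
  by rewrite ltn_neqAle imax // andbT.
by move: sb; case: (size _) => // -[].
Qed.

(** Suppose [phi_b = 0] and take a primitive relation of [a'] with coefficients polynomial in [b].
    Under [phi] each coefficient reduces to its constant term, and these terms are not all 0: a
    nonzero polynomial in [a'] over [Fq] would be killed, against [size_drinfeld_poly]. *)
Lemma drinfeld_ker_nonconstant b : (exists g : 'I_1 -> C, transcendence_basis k g) ->
  nonconstant k (emb b) -> phi b <> 0.
Proof.
move=> hC hb phib0; have [a' sa'] := drinfeld_nontrivial hphi.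
have [d [hd hi0]] := curve_relation_primitive hC (emb a') hb.
pose ev (f : {poly Fq}) : A := (map_poly kappa f).[b].
have embev f : emb (ev f) = poly_ev k (emb b) f.
  rewrite /ev -horner_map poly_evE -map_poly_comp; congr (_.[_]).
  by apply: eq_map_poly => c; exact: hkappa.
have B0 : \sum_(j < size d) ev d`_j * a' ^+ j = 0.
  apply: hemb; rewrite rmorph0 -[RHS]hd rmorph_sum.
  rewrite (horner_coef_wide _ (size_poly _ _)).
  by apply: eq_bigr => j _; rewrite rmorphM rmorphXn embev coef_map.
have phiev f z : phi (ev f * z) = phi (kappa f`_0 * z).
  elim/poly_ind: f => [|g c _]; first by rewrite /ev rmorph0 horner0 coef0 rmorph0.
  have -> : ev (g * 'X + c%:P) = b * ev g + kappa c.
    by rewrite /ev rmorphD rmorphM /= map_polyX map_polyC hornerD hornerM hornerX hornerC mulrC.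
  rewrite coefD coefMX coefC /= add0r mulrDl (drinfeldD hphi) -mulrA (drinfeldM hphi) phib0.
  by rewrite twisted_mul0 add0r.
have hi : exists j : 'I_(size d), (d`_j)`_0 != 0.
  have [j hj] := hi0; have [h|h] := ltnP j (size d); first by exists (Ordinal h).
  by move: hj; rewrite (nth_default _ h) coef0 eqxx.
have [j0 _] := size_drinfeld_poly (c := fun j : 'I_(size d) => (d`_j)`_0) sa' hi.
have -> : phi (\sum_(j < size d) kappa (d`_j)`_0 * a' ^+ j) = 0; last by rewrite size_poly0.
transitivity (phi (\sum_(j < size d) ev d`_j * a' ^+ j)); last by rewrite B0 (drinfeld0 hphi).
rewrite !(drinfeld_sum hphi).
by apply: eq_bigr => j _; rewrite phiev.
Qed.

(* If [phi b] is a constant, it lies in a finite field because it commutes with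
   some non-constant [phi a'], so that [b ^ N - b] is in the kernel of [phi]. *)
Lemma drinfeld_nonconstant_size b : (exists g : 'I_1 -> C, transcendence_basis k g) ->
  nonconstant k (emb b) -> (1 < size (phi b))%N.
Proof.
move=> hC hb; rewrite ltnNge; apply/negP => sb.
have [a' sa'] := drinfeld_nontrivial hphi.
have b0 : phi b != 0 by apply/eqP; exact: drinfeld_ker_nonconstant.
have a0 : phi a' != 0 by rewrite -size_poly_gt0 ltnW.
have sb1 : size (phi b) = 1%N by apply/eqP; rewrite eqn_leq sb size_poly_gt0.
have lb : lead_coef (phi b) = i b by rewrite lead_coefE sb1 (drinfeld_const hphi).
set s := (size (phi a')).-1; have s0 : (0 < s)%N by rewrite /s; case: (size _) sa' => // -[].
have ib : i b ^+ (q ^ s) = i b.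
  have [_ h1] := twisted_mul_lead hp hq he b0 a0.
  have [_ h2] := twisted_mul_lead hp hq he a0 b0.
  have l0 : lead_coef (phi a') != 0 by rewrite lead_coef_eq0.
  move: h1; rewrite -(drinfeldM hphi) mulrC (drinfeldM hphi) h2 sb1 expn0 expr1 lb mulrC.
  by move/(mulIf l0).
apply: (@drinfeld_ker_nonconstant (b ^+ (q ^ s) - b)) => //.
  move=> hal; apply: hb; apply/integral_algebraic.
  have N1 : (1 < q ^ s)%N by rewrite -(exp1n s) ltn_exp2r // (q_gt1 hp hq he).
  pose f : {poly C} := 'X^(q ^ s) - ('X + (emb (b ^+ (q ^ s) - b))%:P).
  have sX : (size ('X + (emb (b ^+ (q ^ s) - b))%:P)%R <= 2)%N by rewrite size_XaddC.
  apply: (@integral_root_monic _ _ k _ f).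
  - by rewrite monicE lead_coefDl ?lead_coefXn // size_polyN size_polyXn ltnS (leq_trans sX).
  - rewrite rootE /f !hornerE rmorphB rmorphXn; apply/eqP; ring.
  apply/integral_poly => j; rewrite coefB coefXn coefD coefX coefC.
  apply: integral_sub; first exact: integral_nat.
  apply: integral_add; first exact: integral_nat.
  by case: eqP => _; [exact/integral_algebraic|rewrite -(rmorph0 k); exact: integral_id].
have sz : (size (phi (b ^+ (q ^ s) - b)) <= 1)%N.
  rewrite (drinfeldD hphi) (drinfeldN hphi); apply: leq_trans (size_polyD _ _) _.
  by rewrite geq_max size_polyN sb (drinfeld_exp hp hq he hphi) // sb1 muln0.
by rewrite (size1_polyC sz) (drinfeld_const hphi) rmorphB rmorphXn ib subrr.
Qed.

End DrinfeldOverCurve.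

(** * The lower bound *)

Section PositiveSubspace.
Variables (Fq : finFieldType) (L : fieldType) (m D : nat) (psi : 'rV[Fq]_m -> L).
Hypothesis psiB : forall u v, psi (u - v) = psi u - psi v.

(** Codimension at most [D] of the vectors of positive valuation, expressed as a bound on additive
    families that avoid them. Only additivity is asked of [chi], to fit [bad_reduction_bound]. *)
Record codim_le (w : L -> \bar int) : Prop := {
  codim_val : valuation w ;
  codim_scale : forall c u, (0 < w (psi u))%E -> (0 < w (psi (c *: u)))%E ;
  codim_card : forall (V : finZmodType) (chi : V -> 'rV[Fq]_m),
    (forall x y, chi (x - y) = chi x - chi y) ->
    (forall x, x != 0 -> (w (psi (chi x)) <= 0)%E) -> (#|V| <= #|Fq| ^ D)%N
}.

Lemma psi_0 : psi 0 = 0. Proof. by rewrite -(subrr 0) psiB subrr. Qed.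

Lemma psi_D u v : psi (u + v) = psi u + psi v.
Proof. by rewrite -{1}[v]opprK psiB -[- v]sub0r psiB psi_0 sub0r opprK. Qed.

(** [U'] is spanned by the vectors of [U] of positive valuation. A complement of [U'] in [U]
    contains no such vector except 0, so [codim_card] bounds its dimension by [D]. *)
Lemma positive_subspace w (U : {vspace 'rV[Fq]_m}) : codim_le w ->
  exists U' : {vspace 'rV[Fq]_m}, [/\ (U' <= U)%VS, (\dim U <= \dim U' + D)%N &
    forall u, u \in U' -> (0 < w (psi u))%E].
Proof.
move=> [hw hscale hcard].
pose X := in_tuple [seq u <- enum U | (0 < w (psi u))%E]; pose U' := <<X>>%VS.
have pos u : u \in U' -> (0 < w (psi u))%E.
  move=> /coord_span ->; apply: (big_ind (fun z => (0 < w (psi z))%E)).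
  - by rewrite psi_0 (val0 hw).
  - by move=> x y hx hy; rewrite psi_D; apply: (val_gt_add hw).
  - move=> i _; apply: hscale; have : X`_i \in tval X by apply: mem_nth.
    by rewrite mem_filter => /andP[].
have sub : (U' <= U)%VS.
  by apply/span_subvP => u; rewrite mem_filter mem_enum => /andP[].
exists U'; split=> //; rewrite -(dimv_cap_compl U U') addnC (capv_idPr sub) addnC leq_add2l.
set V := (U :\: U')%VS; set d := \dim V.
pose chi (x : 'rV[Fq]_d) := \sum_(i < d) x 0 i *: (vbasis V)`_i.
have chiV x : chi x \in V.
  by apply: memv_suml => i _; apply/memvZ/vbasis_mem/mem_nth; rewrite size_tuple.
have chi0 x : chi x = 0 -> x = 0.
  move=> h; apply/rowP => i; rewrite mxE.
  have /freeP := basis_free (vbasisP V); exact.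
have := hcard 'rV[Fq]_d chi _ _; rewrite card_mx mul1n leq_exp2l; last exact: finNzRing_gt1.
apply=> [x y|x x0].
  rewrite /chi -sumrB; apply: eq_bigr => i _.
  by rewrite !mxE scalerBl.
rewrite leNgt; apply/negP => hpos.
have : chi x \in U' by apply: memv_span; rewrite mem_filter hpos mem_enum (subvP (diffvSl U U')).
move=> hU'; have : chi x \in (V :&: U')%VS by rewrite memv_cap chiV.
by rewrite capv_diff memv0 => /eqP/chi0 h; rewrite h eqxx in x0.
Qed.

(* Each valuation of the list costs at most [D] dimensions. *)
Lemma common_positive (s : seq (L -> \bar int)) (U : {vspace 'rV[Fq]_m}) :
  (forall w, w \in s -> codim_le w) -> (D * size s < \dim U)%N ->
  exists u, [/\ u \in U, u != 0 & forall w, w \in s -> (0 < w (psi u))%E].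
Proof.
elim: s U => [|w s IH] U hs hd.
  exists (vpick U); rewrite memv_pick vpick0; split=> //.
  by rewrite -dimv_eq0 -lt0n (leq_trans _ hd).
have [U' [sub hdim pos]] := positive_subspace U (hs w (mem_head _ _)).
have [||u [uU' u0 hu]] := IH U'.
- by move=> w' hw'; apply: hs; rewrite inE hw' orbT.
- by move: hd hdim; rewrite /= mulnS; lia.
exists u; split=> //; first exact: (subvP sub).
by move=> w'; rewrite inE => /orP[/eqP ->|/hu //]; apply: pos.
Qed.

End PositiveSubspace.

(** * Good reduction read off [phi_t] *)

Section Reduction.
Variables (p q e : nat) (A : comNzRingType) (K : fieldType) (i : A -> K).
Variables (phi : A -> {poly K}) (L : fieldExtType K) (w : L -> \bar int).
Hypotheses (hp : p \in [pchar K]) (hq : q = (p ^ e)%N) (he : (0 < e)%N).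
Hypotheses (hphi : drinfeld_module q i phi) (hw : valuation w).
Variables (t : A) (r : nat).
Hypotheses (hr : size (phi t) = r.+1) (r0 : (0 < r)%N) (hmonic : phi t \is monic).
Hypothesis hint : forall m, (0 <= w (in_alg L (phi t)`_m))%E.

(* Compare [phi_t phi_a] and [phi_a phi_t] at the last coefficient of [phi_a]
   of minimal valuation. *)
Lemma reduction_integral a m : (0 <= w (in_alg L (phi a)`_m))%E.
Proof.
rewrite leNgt; apply/negP => hm.
have [c [s [c0 hc hs hmax]]] := coefs_ge_tight hp hq he hw (ex_intro (fun m => w (in_alg L (phi a)`_m) < 0)%E m hm).
have hcomm : (twisted_mul q (phi t) (phi a))`_(r + s) = (twisted_mul q (phi a) (phi t))`_(r + s).
  by rewrite -!(drinfeldM hphi) mulrC.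
have h1 : (((- c%:Z))%:E <= w (in_alg L (twisted_mul q (phi a) (phi t))`_(r + s)))%E.
  rewrite (coef_twisted_mul hp hq) rmorph_sum; apply: (val_ge_sum hw) => k _.
  rewrite (rmorphM (in_alg L)) (rmorphXn (in_alg L)) -[- c%:Z]addr0.
  apply: (val_ge_mul hw); first exact: hc.
  by have := val_ge_exp hw (q ^ k) (hint (r + s - k)); rewrite mul0rn.
have : w (in_alg L (twisted_mul q (phi t) (phi a))`_(r + s)) = (- c%:Z *+ (q ^ r))%:E.
  rewrite (coef_twisted_mul hp hq) rmorph_sum.
  have hi : (r < (r + s).+1)%N by rewrite ltnS leq_addr.
  have e0 : w (in_alg L ((phi t)`_r * (phi a)`_(r + s - r) ^+ (q ^ r))) = (- c%:Z *+ (q ^ r))%:E.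
    have -> : (phi t)`_r = 1 by have := monicP hmonic; rewrite lead_coefE hr.
    by rewrite mul1r addKn rmorphXn (val_eq_exp hw _ hs).
  rewrite (val_lt_sum hw (i0 := Ordinal hi)) //; first exact: (val_neq0 hw e0).
  move=> k hk; rewrite e0; have [rk|kr] := ltnP r k.
    by rewrite [(phi t)`_k]nth_default ?hr // mul0r rmorph0 (val0 hw) ltey.
  have {}kr : (k < r)%N by rewrite ltn_neqAle kr andbT; move: hk; rewrite -val_eqE.
  rewrite (rmorphM (in_alg L)) (rmorphXn (in_alg L)).
  apply: lt_le_trans (val_ge_mul hw (hint k) (val_ge_exp hw (q ^ k) (hc _))).
  move: kr; rewrite lte_fin add0r !mulrnZ -(ltn_exp2l _ _ (q_gt1 hp hq he)) => kr.
  by rewrite ltr_nM2l ?ltz_nat // oppr_lt0 ltz_nat.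
rewrite hcomm => h2; move: h1; rewrite h2 lee_fin mulrnZ mulNr lerN2 -PoszM lez_nat.
by rewrite leqNgt ltn_Pmulr // -(exp1n r) ltn_exp2r // (q_gt1 hp hq he).
Qed.

Lemma reduction_good : (forall a, a != 0 -> phi a != 0) -> good_reduction phi w.
Proof.
move=> inj a a0; split; first exact: reduction_integral.
exact: (val_drinfeld_lead hp hq he hphi hw hr r0 hmonic (inj a a0)).
Qed.

End Reduction.

(** * The orbit of a point of small height *)

Section LehmerBound.
Variables (R : realType) (p q e : nat) (Fq : finFieldType) (C : fieldType).
Variables (k : {rmorphism Fq -> C}) (A : comNzRingType) (emb : {rmorphism A -> C}).
Hypotheses (hFq : #|Fq| = q) (hemb : injective emb).
Hypothesis hC : exists g : 'I_1 -> C, transcendence_basis k g.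
Variable kappa : {rmorphism Fq -> A}.
Hypothesis hkappa : forall c, emb (kappa c) = k c.
Variables (K : fieldType) (i : {rmorphism A -> K}) (phi : A -> {poly K}).
Hypotheses (hp : p \in [pchar K]) (hq : q = (p ^ e)%N) (he : (0 < e)%N).
Hypothesis hphi : drinfeld_module q i phi.

(** Besides the nonconstant elements there are the nonzero ones algebraic over [Fq]; these are roots
    of unity, hence units of [A], which [phi] cannot send to 0. *)
Lemma drinfeld_injective b : b != 0 -> phi b != 0.
Proof.
move=> b0; have [hal|hn] := pselect (algebraicOver k (emb b)); last first.
  by rewrite -size_poly_gt0 ltnW // (drinfeld_nonconstant_size hemb hkappa hp hq he hphi hC).
have pC : p \in [pchar C].
  rewrite (fmorph_pchar k); apply: card_finPcharP (pcharf_prime hp).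
  by rewrite hFq hq.
have [f f0 hf] := hal.
have [||N N0 hN] := root_of_constant pC (f := map_poly k f) _ _ hf.
- by rewrite map_poly_eq0.
- by move=> j; rewrite coef_map; exists e => //; rewrite -hq -rmorphXn -hFq expf_card.
have pN : (1 < p ^ N)%N.
  by rewrite -(exp1n N) ltn_exp2r // prime_gt1 // (pcharf_prime hp).
have eb0 : emb b != 0 by rewrite -(rmorph0 emb) (inj_eq hemb).
have e1 : b ^+ (p ^ N).-1 = 1.
  apply: hemb; rewrite rmorphXn rmorph1; apply: (mulIf eb0).
  by rewrite mul1r -exprSr prednK // ltnW.
apply: contraTneq pN => h; rewrite -leqNgt.
case: (p ^ N)%N e1 => [|[|n]] // e1; exfalso.
have := drinfeld1 hphi; rewrite -e1 exprS (drinfeldM hphi) h twisted_mul0.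
by move/esym/eqP; rewrite oner_eq0.
Qed.

Variable L : fieldExtType K.
Variables (t a : A) (r : nat) (x : L).
Hypotheses (ht : nonconstant k (emb t)) (ha : nonconstant k (emb a)).
Hypotheses (hr : size (phi t) = r.+1) (hmonic : phi t \is monic).
Hypothesis hx : ~ torsion_point q phi x.

Local Notation act b y := (twisted_eval q (phi b) y).

Let st : (1 < size (phi t))%N.
Proof. exact: (drinfeld_nonconstant_size hemb hkappa hp hq he hphi hC). Qed.
Let sa : (1 < size (phi a))%N.
Proof. exact: (drinfeld_nonconstant_size hemb hkappa hp hq he hphi hC). Qed.
Let r0 : (0 < r)%N. Proof. by move: st; rewrite hr. Qed.
Let q1 : (1 < q)%N := q_gt1 hp hq he.

Section Orbit.
Variable m : nat.

Definition tpoly (u : 'rV[Fq]_m) : A := \sum_(j < m) kappa (u 0 j) * t ^+ j.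
Definition psi (u : 'rV[Fq]_m) : L := act (tpoly u) x.

Lemma psiB u v : psi (u - v) = psi u - psi v.
Proof.
rewrite /psi -(drinfeld_actN hphi) -(drinfeld_actD hphi); congr (act _ x).
rewrite /tpoly -sumrB; apply: eq_bigr => j _.
by rewrite !mxE rmorphB mulrBl.
Qed.

Lemma psiZ c u : psi (c *: u) = act (kappa c) (psi u).
Proof.
rewrite /psi -(drinfeld_actM hp hq hphi); congr (act _ x).
rewrite /tpoly mulr_sumr; apply: eq_bigr => j _.
by rewrite mxE rmorphM mulrA.
Qed.

Lemma psi_scale w c u : valuation w -> (0 < w (psi u))%E -> (0 < w (psi (c *: u)))%E.
Proof.
move=> hw h; rewrite psiZ; have [->|c0] := eqVneq c 0.
  by rewrite rmorph0 (drinfeld0 hphi) twisted_eval0l (val0 hw).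
have s1 := size_drinfeld_const kappa hp hq he hphi c0.
rewrite /twisted_eval s1 big_ord1 expn0 expr1 (drinfeld_const hphi) -mulr_algl -in_algE.
rewrite (valM hw) (val_exp_fixed hw q1) ?add0e //.
  by rewrite fmorph_eq0 -[i _]/((i \o kappa) c) fmorph_eq0.
by rewrite -!rmorphXn -hFq expf_card.
Qed.

Lemma tpoly_size u : u != 0 -> exists2 j, (j < m)%N & size (phi (tpoly u)) = (j * r).+1.
Proof.
move=> u0; have [|j _ hj] := size_drinfeld_poly kappa hp hq he hphi (c := fun j => u 0 j) st.
  apply: contrapT => hn; move/eqP: u0; apply; apply/rowP => j; rewrite mxE.
  by apply: contrapT => /eqP h; apply: hn; exists j.
by exists j; rewrite // hj hr.
Qed.

Lemma psi_size s u : u != 0 -> exists2 j, (j < m)%N &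
  size (phi (t ^+ s * tpoly u)) = ((s + j) * r).+1.
Proof.
move=> u0; have [j jm hj] := tpoly_size u0; exists j => //.
have n1 : phi (tpoly u) != 0 by rewrite -size_poly_gt0 hj.
have n2 : size (phi (t ^+ s)) = (s * r).+1.
  by rewrite (drinfeld_exp hp hq he hphi) ?(monic_neq0 hmonic) // hr.
by rewrite (drinfeld_size_mul hp hq he hphi) // -?size_poly_gt0 ?n2 // hj addSn addnS -mulnDl.
Qed.

Lemma tpoly_neq0 u : u != 0 -> tpoly u != 0.
Proof.
move=> /tpoly_size[j _]; apply: contra_eq_neq => ->.
by rewrite (drinfeld0 hphi) size_poly0.
Qed.

Lemma psi_neq0 u : u != 0 -> psi u != 0.
Proof. by move=> u0; apply/eqP => h; apply: hx; exists (tpoly u) => //; apply: tpoly_neq0. Qed.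

Section Small.
Variables (w : L -> \bar int) (n : nat).
Hypotheses (hw : valuation w) (hm : m = n.+1).
Hypothesis hsmall : local_height0 q phi R w a x <= q%:R ^- (r * (2 + n)).

Let Q1 : 1 < q%:R :> R. Proof. by rewrite ltr1n. Qed.

(** Here the exponent [r (2 + n)] is spent: [r (s + n)] is strictly smaller for [s = 0], because
    [r > 0], and equal to it for [s = 2]. *)
Lemma small_height s u : u != 0 -> exists2 d, (d <= r * (s + n))%N &
  local_height0 q phi R w a (act (t ^+ s) (psi u)) <= q%:R ^+ d / q%:R ^+ (r * (2 + n)).
Proof.
move=> u0; have [j jm hj] := psi_size s u0.
exists (r * (s + j))%N.
  by rewrite leq_mul2l leq_add2l -ltnS -hm jm orbT.
have n1 : phi (t ^+ s * tpoly u) != 0 by rewrite -size_poly_gt0 hj.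
rewrite /psi -(drinfeld_actM hp hq hphi).
rewrite (local_height0_scale hp hq he hphi R hw hr r0 hmonic sa) // hj /= mulnC natrX.
by rewrite ler_wpM2l // exprn_ge0.
Qed.

Lemma small_lt1 u : u != 0 -> local_height0 q phi R w a (psi u) < 1.
Proof.
move=> u0; have [d hd] := small_height 0 u0.
rewrite expr0 (drinfeld1 hphi) /twisted_eval size_poly1 big_ord1 coefC eqxx scale1r expn0 expr1.
move=> /le_lt_trans; apply; rewrite ltr_pdivrMr ?exprn_gt0 ?(lt_trans ltr01) // mul1r.
rewrite ltr_eXn2l //; apply: leq_ltn_trans hd _.
by rewrite ltn_mul2l r0 ltn_add2r.
Qed.

Lemma small_le1 u : u != 0 -> local_height0 q phi R w a (act t (act t (psi u))) <= 1.
Proof.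
move=> u0; have [d hd] := small_height 2 u0.
rewrite expr2 (drinfeld_actM hp hq hphi) => /le_trans; apply.
rewrite ler_pdivrMr ?exprn_gt0 ?(lt_trans ltr01) // mul1r.
by rewrite ler_eXn2l.
Qed.

(** With integral coefficients the escape threshold is 0, so a pole would have local height at least
    1, against the strict bound [small_lt1]. *)
Lemma psi_good u : coefs_ge w 0 (phi t) -> u != 0 -> (0 <= w (psi u))%E.
Proof.
move=> hc u0; rewrite leNgt; apply/negP => hneg.
have [l hl] := valP hw (psi_neq0 u0); move: hneg; rewrite hl lte_fin => hneg.
have := small_lt1 u0.
rewrite (local_height0_escape hp hq he hphi R hw hr r0 hmonic sa hc hl) ?oppr0 //.
rewrite -intrN -[1]/(1%:~R) ltr_int; lia.
Qed.

(* [phi_t (phi_t (psi u))] has height at most 1, so it cannot be as large as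
   [bad_reduction_bound] predicts on a big subspace without positive values. *)
Lemma psi_codim : (exists j, (w (in_alg L (phi t)`_j) < 0)%E) -> codim_le (r + r) psi w.
Proof.
move=> hbad; split=> //; first by move=> c u; apply: psi_scale.
move=> V chi chiB hle; rewrite hFq leqNgt; apply/negP => hV.
have [c [c0 hc hall]] := bad_reduction_bound hp hq he hw hmonic hr hbad.
have [||//|v hv] := hall V (psi \o chi).
- by move=> y z; rewrite /= chiB psiB.
- by move=> y /hle.
rewrite /= in hv; set z := twisted_eval _ _ _ in hv.
have z0 : z != 0.
  by apply: contraTneq hv => ->; rewrite (val0 hw) -ltNge ltry.
have u0 : chi v != 0.
  apply: contraNneq z0 => h; rewrite /z h (psi_0 psiB).
  by rewrite !(twisted_eval0 hp hq).
have [l hl] := valP hw z0; move: hv; rewrite hl lee_fin => hv.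
(* As [c >= 1] and [q ^ r >= 2], [l] is strictly below [- c], and the height [- l] is at least 2. *)
have qr : (1 < q ^ r)%N by rewrite -(exp1n r) ltn_exp2r.
have := small_le1 u0.
rewrite -/z (local_height0_escape hp hq he hphi R hw hr r0 hmonic sa hc hl).
  rewrite -intrN -[1]/(1%:~R) ler_int; move: hv; rewrite PoszM.
  by move: (q ^ r)%N qr c0 => s; clear; nia.
by move: hv; rewrite PoszM; move: (q ^ r)%N qr c0 => s; clear; nia.
Qed.

End Small.
End Orbit.

(** One power of Frobenius fixes [y] and the coefficients of [phi_t], hence the whole orbit, which
    thus consists of roots of [X ^ (p ^ N) - X]. *)
Lemma constant_orbit (y : L) : constant p y ->
  (forall j, constant p (in_alg L (phi t)`_j)) ->
  exists s s', (s < s')%N /\ act (t ^+ s) y = act (t ^+ s') y.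
Proof.
move=> [N1 N10 hy] hc; have pL : p \in [pchar L] by rewrite (pchar_ext hp).
have p1 : p = (p ^ 1)%N by rewrite expn1.
have [N2 N20 hN2] := constant_family (fun j : 'I_(size (phi t)) => hc j).
set N := (N1 * N2)%N; have N0 : (0 < N)%N by rewrite muln_gt0 N10.
have fix_t (z : L) : z ^+ (p ^ N) = z -> (act t z) ^+ (p ^ N) = act t z.
  move=> hz; rewrite /twisted_eval.
  rewrite (frob_sum pL p1); apply: eq_bigr => j _.
  rewrite -mulr_algl -in_algE exprMn exprAC hz; congr (_ * _).
  by rewrite /N mulnC; apply: constant_exp; exact: hN2.
have fix_s s : (act (t ^+ s) y) ^+ (p ^ N) = act (t ^+ s) y.
  elim: s => [|s IH]; last by rewrite exprS (drinfeld_actM hp hq hphi); apply: fix_t.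
  rewrite expr0 (drinfeld1 hphi) /twisted_eval size_poly1 big_ord1 coefC eqxx scale1r expn0 expr1.
  exact: constant_exp.
pose f : {poly L} := 'X^(p ^ N) - 'X.
have pN : (1 < p ^ N)%N by rewrite -(exp1n N) ltn_exp2r // prime_gt1 // (pcharf_prime hp).
have f0 : f != 0.
  by rewrite -size_poly_gt0 size_polyDl size_polyXn // size_polyN size_polyX ltnS.
have : ~~ uniq [seq act (t ^+ s) y | s <- iota 0 (size f)].
  apply/negP => hu; have := max_poly_roots f0 _ hu; rewrite size_map size_iota ltnn => h.
  suff : false by []; apply: h; apply/allP => _ /mapP[s _ ->].
  by rewrite rootE /f !hornerE fix_s subrr.
move=> /(uniqPn 0)[s [s' [ss]]]; rewrite size_map size_iota => hs.
rewrite !(nth_map 0%N) ?size_iota ?(ltn_trans ss) // !nth_iota ?(ltn_trans ss) // !add0n => h.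
by exists s, s'.
Qed.

Lemma nonconstant_pow s s' : (s < s')%N -> t ^+ s - t ^+ s' != 0.
Proof.
move=> ss; rewrite subr_eq0; apply/eqP => h; apply: ht; exists ('X^s - 'X^s').
  rewrite subr_eq0; apply/eqP => /(congr1 (fun f : {poly Fq} => f`_s)).
  by rewrite !coefXn eqxx (ltn_eqF ss) => /eqP; rewrite oner_eq0.
by rewrite rootE rmorphB /= !map_polyXn !hornerE -!rmorphXn h subrr.
Qed.

Variables (M : set (weighted_valuation R L)) (delta : R).
Hypothesis hM : good_system p M delta.
Hypothesis hMn : forall wd, M wd -> normalized_valuation wd.1.

Lemma bad_place_coef w : bad_places phi M w ->
  exists j, (w (in_alg L (phi t)`_j) < 0)%E.
Proof.
move=> [[d Mw] nw]; apply: contrapT => hn; apply: nw.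
have hw := normalized_valuationW (hMn Mw).
apply: (reduction_good hp hq he hphi hw hr r0 hmonic) => [m|b]; last exact: drinfeld_injective.
by rewrite leNgt; apply/negP => h; apply: hn; exists m.
Qed.

(** [fset_set] is empty on an infinite set; finiteness makes its cardinal the true [|S_x|]. *)
Lemma bad_places_finite : finite_set (bad_places phi M).
Proof.
apply: (@sub_finite_set _ _ (\bigcup_(j in `I_(size (phi t)))
  [set w | (exists d, M (w, d)) /\ (w (in_alg L (phi t)`_j) < 0)%E])).
  move=> w bw; have [j hj] := bad_place_coef bw; have [[d Mw] _] := bw.
  exists j; last by split=> //; exists d.
  rewrite /= ltnNge; apply/negP => h; move: hj.
  have hw : valuation w := normalized_valuationW (hMn Mw).
  by rewrite nth_default // rmorph0 (val0 hw).
by apply: bigcup_finite => [|j _]; [exact: finite_II | exact: (gs_fin hM)].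
Qed.

Lemma large_local_height : exists2 wd, M wd &
  q%:R ^- (r * (2 + (r ^ 2 + r) * #|` fset_set (bad_places phi M)|))
    < local_height0 q phi R wd.1 a x.
Proof.
apply: contrapT => hn.
set n := ((r ^ 2 + r) * _)%N in hn.
have small wd : M wd -> local_height0 q phi R wd.1 a x <= q%:R ^- (r * (2 + n)).
  by move=> Mwd; rewrite leNgt; apply/negP => h; apply: hn; exists wd.
set s := enum_fset (fset_set (bad_places phi M)).
have mem_s w : (w \in s) = `[< bad_places phi M w >].
  have -> : (w \in s) = (w \in fset_set (bad_places phi M)) by [].
  by rewrite (in_fset_set bad_places_finite).
have [||u [_ u0 hu]] := @common_positive Fq L n.+1 (r + r) (@psi n.+1) (@psiB _) s fullv.
- move=> w; rewrite mem_s => /asboolP bw; have [[d Mw] _] := bw.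
  apply: (psi_codim (normalized_valuationW (hMn Mw)) erefl (small _ Mw)).
  exact: bad_place_coef.
(* [r >= 1] gives [r + r <= r ^ 2 + r]; the one extra dimension makes the inequality strict. *)
- rewrite dimvf /dim /= mul1n ltnS /n leq_mul2r; apply/orP; right.
  by rewrite leq_add2r -mulnn leq_pmull.
have pL : p \in [pchar L] by rewrite (pchar_ext hp).
set y := psi u in hu; have y0 : y != 0 by exact: psi_neq0.
have t0 : t != 0.
  by apply: contra_not_neq ht => ->; rewrite rmorph0; exact: algebraic0.
have hge wd : M wd -> (0 <= wd.1 y)%E.
  case: wd => w d Mw; have [bw|gw] := pselect (bad_places phi M w).
    by apply/ltW/hu; rewrite mem_s; apply/asboolP.
  have {}gw : good_reduction phi w.
    by apply: contrapT => h; apply: gw; split=> //; exists d.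
  apply: (psi_good (normalized_valuationW (hMn Mw)) erefl (small _ Mw) _ u0).
  by have [h _] := gw t t0.
have yc := gs_const hM hge.
have [[w bw]|nobad] := pselect (exists w, bad_places phi M w).
  have [[d Mw] _] := bw.
  have := hu w; rewrite mem_s => /(_ (asboolT bw)).
  have hw : valuation w := normalized_valuationW (hMn Mw).
  by rewrite (constant_val pL hw yc y0) ltxx.
have coefc j : constant p (in_alg L (phi t)`_j).
  apply: (gs_const hM) => -[w d] Mw; have gw : good_reduction phi w.
    by apply: contrapT => h; apply: nobad; exists w; split=> //; exists d.
  by have [h _] := gw t t0; exact: h.
have [s1 [s2 [ss]]] := constant_orbit yc coefc.
move=> /eqP; rewrite -subr_eq0 => /eqP h; apply: hx.
(* The annihilator is nonzero because [A] embeds in a field and [t] is nonconstant. *)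
exists ((t ^+ s1 - t ^+ s2) * tpoly u).
  by apply: (mul_neq0 hemb); [exact: nonconstant_pow | exact: tpoly_neq0].
by rewrite (drinfeld_actM hp hq hphi) (drinfeld_actD hphi) (drinfeld_actN hphi).
Qed.

End LehmerBound.

Theorem mainTheorem3 (R : realType) (p q : nat)
  (hp : prime p) (hq : exists2 e, (0 < e)%N & q = (p ^ e)%N)
  (* A: functions regular away from vinf on the curve with function field C *)
  (Fq : finFieldType) (hFq : #|Fq| = q)
  (C : fieldType) (k : {rmorphism Fq -> C}) (hC : curve_function_field k)
  (vinf : C -> \bar int) (hvinf : normalized_valuation vinf)
  (A : comNzRingType) (emb : {rmorphism A -> C})
  (hemb : injective emb) (hA : range emb = regular_away vinf)
  (* K *)
  (K : fieldType) (hKp : p \in [pchar K])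
  (hKfg : finitely_generated_field (@prime_field_map p K))
  (hKtr : exists m (g : 'I_m.+1 -> K),
     transcendence_basis (@prime_field_map p K) g)
  (* the Drinfeld module *)
  (i : {rmorphism A -> K}) (phi : A -> {poly K})
  (hphi : drinfeld_module q i phi)
  (t : A) (ht : nonconstant k (emb t))
  (r : nat) (hr : size (phi t) = r.+1) (hmonic : phi t \is monic)
  (* F, embedded in K by jF, and the transcendence basis X *)
  (F : fieldType) (jF : {rmorphism F -> K})
  (hF : range jF = [set c | algebraicOver (@prime_field_map p K) c])
  (n : nat) (X : 'I_n -> K) (hX : transcendence_basis jF X)
  (* the element of A used to compute the heights *)
  (a : A) (ha : nonconstant k (emb a))
  (* x algebraic over K, with L = K(x) *)
  (L : fieldExtType K) (x : L) (hL : <<1; x>>%VS = fullv)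
  (hx : ~ torsion_point q phi x) :
  let ML := extend_valuations (in_alg L) (good_valuations R jF X) in
  let Sx := bad_places phi ML in
  let deg := field_degree (in_alg L \o ratfun_eval jF X) in
  (((q%:R ^- (r * (2 + (r ^ 2 + r) * #|` fset_set Sx|))%N) / deg%:R)%:E
     < global_height q phi a ML x)%E.
Proof.
cbv zeta; set ML := extend_valuations _ _; set deg := field_degree _.
have [e e0 qe] := hq.
have q1 : (1 < q)%N := q_gt1 hKp qe e0.
have [hCfg hCg] := hC.
have [kappa hkappa] := constants_in_regular k hFq hemb q1 hA.
pose jX := ratfun_rmorphism hX.1; pose jL := in_alg L.
have finX : finite_embedding jX by apply: (finite_of_finitely_generated hKfg); exact: hX.2.
have finL : finite_embedding jL := finite_embedding_in_alg L.
have pF : p \in [pchar F] by rewrite -(fmorph_pchar jF).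
have pE : p \in [pchar {fraction (mpoly n F)}] by rewrite -(fmorph_pchar jX).
have constF (c : F) : constant p c.
  apply/(constant_inj p jF); apply: (algebraic_constant hKp).
  have : range jF (jF c) by exists c.
  by rewrite hF.
(* The lower bound 1 for the degrees on [F(X_1, ..., X_n)] is divided by [[K : F(X_1, ..., X_n)]],
   then by [[L : K]]; by the tower law the product of these is [deg]. *)
have good0 := ratfun_good_system n R pF constF.
have goodK := good_system_extend pE finX good0 ler01.
have dX : 0 < (field_degree jX)%:R :> R by rewrite ltr0n field_degree_gt0.
have dL : 0 < (field_degree jL)%:R :> R by rewrite ltr0n field_degree_gt0.
have dX0 : 0 <= 1 / (field_degree jX)%:R :> R by rewrite divr_ge0 // ltW.
have goodL := good_system_extend hKp finL goodK dX0.
have degE : deg = (field_degree jX * field_degree jL)%N := field_degree_comp finX finL.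
have hMn wd : ML wd -> normalized_valuation wd.1 by case.
have [wd Mwd hwd] := large_local_height hFq hemb hCg hkappa hKp qe e0 hphi ht ha hr hmonic hx
  goodL hMn.
have wd2 := gs_deg goodL Mwd.
(* The sum is a supremum over finite subsets, so the single term at [wd] bounds it from below. *)
apply: (@lt_le_trans _ _ (local_height q phi a wd x)%:E); last first.
  apply: esum_ge; exists [set wd]; last by rewrite fsbig_set1.
  by split; [exact: finite_set1 | move=> _ ->].
rewrite lte_fin /local_height mulNr -mulrN.
apply: (@lt_le_trans _ _ (wd.2 * local_height0 q phi R wd.1 a x)) => //.
have dpos : 0 < 1 / (field_degree jX)%:R / (field_degree jL)%:R :> R by rewrite !divr_gt0.
apply: (@lt_le_trans _ _ (1 / (field_degree jX)%:R / (field_degree jL)%:R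
  * local_height0 q phi R wd.1 a x)).
  rewrite degE natrM invfM mulrC div1r ltr_pM2l //.
  by move: dpos; rewrite div1r.
rewrite ler_wpM2r //; apply: ltW; apply: le_lt_trans hwd.
by rewrite invr_ge0 exprn_ge0.
Qed.
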